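(* Let $T$ be a finite graph with a right action of a finite group $\Gamma$, and let $r\ge0$, $s\ge1$. Consider the statements: (i) For every $\Gamma$-invariant triangulation $X$ of $E_r\Gamma$, $\chi(T\times_\Gamma X^1)\ge s$. (ii) There is no $\Gamma$-equivariant map $E_r\Gamma\to|\operatorname{Hom}(T,K_{s-1})|$. (iii) For all graphs $G$ such that there is a $\Gamma$-equivariant map $E_r\Gamma\to|\operatorname{Hom}(T,G)|$, $\chi(G)\ge s$. (iv) For all graphs $G$ such that $|\operatorname{Hom}(T,G)|$ is $(r-1)$-connected, $\chi(G)\ge s$. Then (i) implies (ii), (ii) implies (iii), and (iii) implies (iv). If moreover $T$ is vertex critical and $\Gamma=\operatorname{Aut}(T)$, then (iv) implies (i), so all four statements are equivalent.
   Context: Graphs have a symmetric adjacency relation (loops allowed); homomorphisms preserve adjacency; $K_s$ is the loopless complete graph on $s$ vertices; $\chi(G)$ is the least $s$ with a homomorphism $G\to K_s$ (infinite if none). $T$ is vertex critical if deleting any vertex lowers its chromatic number. $\operatorname{Hom}(T,G)$ is the poset of functions $f$ from $V(T)$ to nonempty subsets of $V(G)$ with $f(u)\times f(v)\subseteq E(G)$ for $(u,v)\in E(T)$, ordered by pointwise inclusion, with order complex realization $|\cdot|$; $\Gamma$ acts on it via its action on $T$. $E_r\Gamma$ is a fixed $(r-1)$-connected, $r$-dimensional free $\Gamma$-CW-complex (e.g. the join of $r+1$ copies of $\Gamma$); $(-1)$-connected means nonempty. For a simplicial complex $X$, $X^1$ is the reflexive graph whose vertices are the vertices of $X$, with $u,v$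 adjacent iff $u=v$ or $\{u,v\}$ is a simplex. For a graph $T$ with right $\Gamma$-action and a graph $Z$ with (left) $\Gamma$-action, $T\times_\Gamma Z$ is the quotient of the product graph $T\times Z$ (vertices $V(T)\times V(Z)$, $(t,z)\sim(t',z')$ iff $t\sim t'$ and $z\sim z'$) by the identification $(t\gamma,z)\sim(t,\gamma z)$, where two classes are adjacent iff some representatives are adjacent.
   Formalization: For ''(i) implies (ii)'' and the equivalence of all four statements, E_rΓ is assumed to have at least one Γ-invariant triangulation; otherwise (i) is vacuously true while (ii) can fail, since some free Γ-CW-complexes have no triangulation. *)

(* Defs.v *)
From HB Require Import structures.
From mathcomp Require Import all_boot all_order all_algebra all_fingroup.
From mathcomp Require Import all_classical all_reals all_analysis.

Set Implicit Arguments.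
Unset Strict Implicit.
Unset Printing Implicit Defensive.

Import Order.TTheory GRing.Theory Num.Theory.
Import numFieldNormedType.Exports.

Local Open Scope classical_set_scope.
Local Open Scope ring_scope.

(** * Graphs *)

Record graph := Graph {
  vertex :> Type;
  adj : vertex -> vertex -> Prop;
  adj_sym : forall u v, adj u v -> adj v u }.

Definition graph_hom (G H : graph) (f : G -> H) :=
  forall u v, adj u v -> adj (f u) (f v).

Lemma complete_sym s (i j : 'I_s) : i <> j -> j <> i.
Proof. by move=> ij /esym. Qed.

Definition complete_graph s := Graph (@complete_sym s).

Definition colorable (G : graph) s :=
  exists f : G -> complete_graph s, graph_hom f.

(* [\bar int] only serves as an ordered copy of the integers with a [+oo]. *)
Definition chi (G : graph) : \bar int :=
  if pselect (exists s, `[< colorable G s >]) is left h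
  then ((ex_minn h)%:Z)%:E else +oo%E.

Definition delete_vertex (G : graph) (v : G) : graph :=
  @Graph {w : G | w <> v} (fun a b => adj (sval a) (sval b))
    (fun a b => @adj_sym G (sval a) (sval b)).

Definition vertex_critical (G : graph) :=
  forall v : G, (chi (delete_vertex v) < chi G)%E.

(** * Group actions on graphs *)

(* MathComp's actions are right actions: [to x (g * h) = to (to x g) h]. *)
Record graph_action (gT : finGroupType) (T : graph) := GraphAction {
  ract :> {action gT &-> T};
  ract_adj : forall g u v, adj u v -> adj (ract u g) (ract v g) }.

Section GraphActionLaws.
Variables (gT : finGroupType) (T : graph) (to : graph_action gT T).

(* [act1] and [actM] of the library are restricted to finite carriers. *)
Lemma ractM g h t : to t (g * h)%g = to (to t g) h.
Proof.
case: to => -[a aP] /= _; case: aP => _ /(_ t); apply; exact: finset.in_setT.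
Qed.

Lemma ract1 t : to t 1%g = t.
Proof.
have inj : left_injective to by case: to => -[a aP] /= _; case: aP.
by apply: (inj 1%g); rewrite -ractM mulg1.
Qed.

End GraphActionLaws.

Record left_action (gT : finGroupType) (V : Type) := LeftAction {
  lact :> gT -> V -> V;
  lact1 : forall x, lact 1%g x = x;
  lactM : forall g h x, lact (g * h)%g x = lact g (lact h x) }.

(* The right action [to] identifies the group with [Aut(T)]. *)
Definition is_Aut (gT : finGroupType) (T : graph) (to : graph_action gT T) :=
  forall a : T -> T, bijective a ->
    (forall u v, adj (a u) (a v) <-> adj u v) ->
    exists! g : gT, forall t, a t = to t g.

Section TensorOver.
Variables (gT : finGroupType) (T : graph) (to : graph_action gT T).
Variables (Z : graph) (za : left_action gT Z).

(* Thanks to the action laws this is already an equivalence relation. *)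
Definition tensor_ident (p q : T * Z) :=
  exists t g z, p = (to t g, z) /\ q = (t, za g z).

Definition tensor_vertices : set (set (T * Z)) :=
  [set C | exists p, C = tensor_ident p].

Definition tensor_adj (C D : tensor_vertices) :=
  exists p q, [/\ val C p, val D q, adj p.1 q.1 & adj p.2 q.2].

Lemma tensor_adj_sym C D : tensor_adj C D -> tensor_adj D C.
Proof. by move=> [p [q [Cp Dq /adj_sym ? /adj_sym ?]]]; exists q, p. Qed.

Definition tensor_over := Graph tensor_adj_sym.

End TensorOver.

(** * Simplicial complexes *)

(* Every type is classically a [choiceType], so this is no restriction on the
   vertex set; it is needed for sums over the vertices. *)
Record simplicial_complex := SimplicialComplex {
  sc_vertex :> choiceType;
  simplex : set (set sc_vertex);
  simplex_finite : forall s, simplex s -> finite_set s;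
  simplex_neq0 : forall s, simplex s -> s !=set0;
  simplex_vertex : forall v, simplex [set v];
  simplex_face : forall s t, simplex s -> t `<=` s -> t !=set0 -> simplex t }.

Lemma one_skeleton_sym (K : simplicial_complex) (u v : K) :
  u = v \/ simplex [set u; v] -> v = u \/ simplex [set v; u].
Proof. by move=> [->|]; [left|rewrite setUC; right]. Qed.

Definition one_skeleton (K : simplicial_complex) : graph :=
  Graph (@one_skeleton_sym K).

Record gcomplex (gT : finGroupType) := GComplex {
  gc_complex :> simplicial_complex;
  gc_act : left_action gT gc_complex;
  gc_simplex : forall g s, simplex s -> simplex (gc_act g @` s) }.

(* Barycentric coordinates. *)
Definition barycentric (R : realType) (K : simplicial_complex) :
    set (K -> R) :=
  [set x | [/\ forall v, 0 <= x v, simplex [set v | x v != 0]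
             & \sum_(v \in [set: K]) x v = 1]].

Definition realization (R : realType) (K : simplicial_complex) : Type :=
  set_type (@barycentric R K).

HB.instance Definition _ R K :=
  Choice.copy (realization R K) (set_type (@barycentric R K)).

Section Realization.
Variables (R : realType) (K : simplicial_complex).
Implicit Types (x y : realization R K) (U : set (realization R K)).

Definition in_simplex (s : set K) : set (realization R K) :=
  [set x | [set v | val x v != 0] `<=` s].

(* The coherent (weak) topology: a set is open when its trace on each closed
   simplex is open for the Euclidean topology of that simplex. *)
Definition coherent_open U :=
  forall s, simplex s -> forall x, U x -> in_simplex s x ->
    exists2 e : R, 0 < e &
      forall y, in_simplex s y -> (forall v, `|val y v - val x v| < e) -> U y.

Lemma coherent_openT : coherent_open setT.
Proof. by move=> s _ x _ _; exists 1. Qed.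

Lemma coherent_openI : setI_closed coherent_open.
Proof.
move=> U V oU oV s ss x [Ux Vx] sx.
have [e e0 eU] := oU s ss x Ux sx; have [d d0 dV] := oV s ss x Vx sx.
exists (Num.min e d); first by rewrite lt_min e0.
by move=> y sy yx; split; [apply: eU|apply: dV] => // v;
  have := yx v; rewrite lt_min => /andP[].
Qed.

Lemma coherent_open_bigU (I : Type) (f : I -> set (realization R K)) :
  (forall i, coherent_open (f i)) -> coherent_open (\bigcup_i f i).
Proof.
move=> of_ s ss x [i _ fx] sx; have [e e0 ef] := of_ i s ss x fx sx.
by exists e => // y sy yx; exists i => //; apply: ef.
Qed.

HB.instance Definition _ := isOpenTopological.Build (realization R K)
  coherent_openT coherent_openI coherent_open_bigU.

Lemma realization_openE U : open U = coherent_open U.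
Proof. by []. Qed.

End Realization.

(** * Spaces with a group action *)

Record gspace (gT : finGroupType) := GSpace {
  gs_space :> topologicalType;
  gs_act : left_action gT gs_space;
  gs_continuous : forall g, continuous (gs_act g) }.

Definition equivariant (gT : finGroupType) (X Y : gspace gT) (f : X -> Y) :=
  forall g x, f (gs_act X g x) = gs_act Y g (f x).

Definition equivariant_map (gT : finGroupType) (X Y : gspace gT) :=
  exists f : X -> Y, continuous f /\ equivariant f.

Section RealizationAction.
Variables (R : realType) (gT : finGroupType) (K : gcomplex gT).
Local Notation a := (gc_act K).

Lemma gc_actK g : cancel (a g) (a g^-1%g).
Proof. by move=> v; rewrite -lactM mulVg lact1. Qed.

Lemma gc_actVK g : cancel (a g^-1%g) (a g).
Proof. by move=> v; rewrite -lactM mulgV lact1. Qed.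

Lemma gc_act_support g (x : K -> R) :
  [set v | x (a g^-1%g v) != 0] = a g @` [set v | x v != 0].
Proof.
apply/seteqP; split=> [v xv|_ [v xv <-]] /=; last by rewrite gc_actK.
by exists (a g^-1%g v) => //; rewrite gc_actVK.
Qed.

Lemma realize_act_subproof g (x : realization R K) :
  (fun v => val x (a g^-1%g v)) \in @barycentric R K.
Proof.
apply/mem_set; have [x0 sx x1] := set_valP x; split=> [v||]; first exact: x0.
- by rewrite gc_act_support; exact: gc_simplex.
- rewrite -x1 [RHS](reindex_fsbigT (a g^-1%g)) //.
  by exists (a g); [exact: gc_actVK|exact: gc_actK].
Qed.

Definition realize_act g (x : realization R K) : realization R K :=
  exist _ (fun v => val x (a g^-1%g v)) (realize_act_subproof g x).

Lemma realize_act1 x : realize_act 1%g x = x.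
Proof. by apply: val_inj; apply/funext => v /=; rewrite invg1 lact1. Qed.

Lemma realize_actM g h x :
  realize_act (g * h)%g x = realize_act g (realize_act h x).
Proof. by apply: val_inj; apply/funext => v /=; rewrite invMg lactM. Qed.

Lemma realize_act_continuous g : continuous (realize_act g).
Proof.
apply/continuousP => U; rewrite !realization_openE => oU s ss x /= Ux sx.
have sgs (y : realization R K) : in_simplex s y ->
    in_simplex (a g @` s) (realize_act g y).
  by move=> sy; rewrite /in_simplex /= gc_act_support; exact: image_subset.
have [e e0 eU] := oU _ (gc_simplex g ss) _ Ux (sgs x sx).
exists e => // y sy yx; apply: eU; first exact: sgs.
by move=> v; exact: yx.
Qed.

Definition realization_gspace : gspace gT :=
  GSpace (gs_act := LeftAction realize_act1 realize_actM)
    realize_act_continuous.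

End RealizationAction.

(* [X] together with an equivariant homeomorphism from [|X|] to [E]. *)
Definition triangulates (R : realType) (gT : finGroupType)
    (X : gcomplex gT) (E : gspace gT) :=
  exists (f : realization_gspace R X -> E) (h : E -> realization_gspace R X),
    [/\ continuous f, continuous h, cancel f h, cancel h f & equivariant f].

(** * Order complexes and Hom complexes *)

Section OrderComplex.
Variables (d : Order.disp_t) (P : porderType d).

Definition order_simplex : set (set P) :=
  [set s | [/\ finite_set s, s !=set0
             & forall x y, s x -> s y -> (x <= y)%O \/ (y <= x)%O]].

Lemma order_simplex_finite s : order_simplex s -> finite_set s.
Proof. by case. Qed.

Lemma order_simplex_neq0 s : order_simplex s -> s !=set0.
Proof. by case. Qed.

Lemma order_simplex_vertex v : order_simplex [set v].
Proof.
split; [exact: finite_set1|by exists v|].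
by move=> x y -> ->; left.
Qed.

Lemma order_simplex_face s t :
  order_simplex s -> t `<=` s -> t !=set0 -> order_simplex t.
Proof.
move=> [fs _ cs] ts t0; split=> //; first exact: sub_finite_set fs.
by move=> x y /ts sx /ts sy; exact: cs.
Qed.

Definition order_complex : simplicial_complex :=
  SimplicialComplex order_simplex_finite order_simplex_neq0
    order_simplex_vertex order_simplex_face.

End OrderComplex.

Definition multihom (T G : graph) : set (T -> set G) :=
  [set f | (forall t, f t !=set0) /\
    forall u v, adj u v -> forall x y, f u x -> f v y -> adj x y].

Definition hom_poset (T G : graph) : Type := set_type (@multihom T G).

HB.instance Definition _ T G :=
  Choice.copy (hom_poset T G) (set_type (@multihom T G)).

Section HomPoset.
Variables (T G : graph).

Definition hom_le (f g : hom_poset T G) : bool :=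
  `[< forall t, val f t `<=` val g t >].

Lemma hom_le_refl : reflexive hom_le.
Proof. by move=> f; apply/asboolP => t x. Qed.

Lemma hom_le_anti : antisymmetric hom_le.
Proof.
move=> f g /andP[/asboolP fg /asboolP gf]; apply: val_inj.
by apply/funext => t; apply/seteqP.
Qed.

Lemma hom_le_trans : transitive hom_le.
Proof.
move=> g f h /asboolP fg /asboolP gh.
by apply/asboolP => t x /fg; exact: gh.
Qed.

Fact hom_display : Order.disp_t. Proof. exact: Order.Disp tt tt. Qed.

HB.instance Definition _ := Order.Le_isPOrder.Build hom_display
  (hom_poset T G) hom_le_refl hom_le_anti hom_le_trans.

End HomPoset.

Definition hom_complex (T G : graph) : simplicial_complex :=
  order_complex (hom_poset T G).

Section HomAction.
Variables (gT : finGroupType) (T : graph) (to : graph_action gT T).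
Variable G : graph.

Lemma hom_act_subproof g (f : hom_poset T G) :
  (fun t => val f (to t g)) \in @multihom T G.
Proof.
apply/mem_set; have [f0 fE] := set_valP f; split=> [t|u v uv]; first exact: f0.
exact/fE/ract_adj.
Qed.

Definition hom_act g (f : hom_poset T G) : hom_complex T G :=
  exist _ (fun t => val f (to t g)) (hom_act_subproof g f).

Lemma hom_act1 f : hom_act 1%g f = f.
Proof. by apply: val_inj; apply/funext => t /=; rewrite ract1. Qed.

Lemma hom_actM g h f : hom_act (g * h)%g f = hom_act g (hom_act h f).
Proof. by apply: val_inj; apply/funext => t /=; rewrite ractM. Qed.

Lemma hom_act_simplex g (s : set (hom_complex T G)) :
  simplex s -> simplex (hom_act g @` s).
Proof.
move=> [fs [f0 sf0] cs]; split; first exact: (finite_image _ fs).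
  by exists (hom_act g f0); exists f0.
move=> _ _ [f sf <-] [h sh <-].
by case: (cs f h sf sh) => /asboolP fh; [left|right]; apply/asboolP => t;
  exact: fh.
Qed.

Definition hom_gcomplex : gcomplex gT :=
  @GComplex gT (hom_complex T G) (LeftAction hom_act1 hom_actM)
    hom_act_simplex.

End HomAction.

(** * Connectivity and CW complexes *)

Section Balls.
Variables (R : realType) (n : nat).

Definition sqnorm (x : 'rV[R]_n) := \sum_i x ord0 i ^+ 2.
Definition disk : set 'rV[R]_n := [set x | sqnorm x <= 1].
Definition open_disk : set 'rV[R]_n := [set x | sqnorm x < 1].
Definition sphere : set 'rV[R]_n := [set x | sqnorm x = 1].

End Balls.
Arguments disk : clear implicits.
Arguments open_disk : clear implicits.
Arguments sphere : clear implicits.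

(* [X] is [(r - 1)]-connected: it is nonempty and, for all [i <= r - 1], every
   map from the [i]-sphere to [X] extends to the [(i + 1)]-disk. *)
Definition pred_connected (R : realType) (r : nat) (X : topologicalType) :=
  [set: X] !=set0 /\
  forall i, (i < r)%N -> forall f : 'rV[R]_i.+1 -> X,
    {within sphere R i.+1, continuous f} ->
    exists2 h : 'rV[R]_i.+1 -> X, {within disk R i.+1, continuous h} &
      {in sphere R i.+1, h =1 f}.

(* A free [gT]-CW structure on [E].  An element [c] of [cell] stands for the
   free equivariant cell [gT * D^n] with [n = cell_dim c], whose characteristic
   map is [(g, x) |-> g . cell_map c x]. *)
Record free_gcw (R : realType) (gT : finGroupType) (E : gspace gT) := FreeGCW {
  cell : Type;
  cell_dim : cell -> nat;
  cell_map : forall c, 'rV[R]_(cell_dim c) -> E;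
  cell_hausdorff : hausdorff_space E;
  cell_continuous : forall c,
    {within disk R (cell_dim c), continuous (cell_map (c := c))};
  cell_partition : forall x : E,
    exists! p : gT * {c : cell & 'rV[R]_(cell_dim c)},
      open_disk R _ (projT2 p.2) /\ x = gs_act E p.1 (cell_map (projT2 p.2));
  cell_boundary : forall c, exists2 F : set (gT * cell), finite_set F &
    (forall p, F p -> (cell_dim p.2 < cell_dim c)%N) /\
    cell_map (c := c) @` sphere R (cell_dim c) `<=`
      \bigcup_(p in F)
        gs_act E p.1 @` (cell_map (c := p.2) @` disk R (cell_dim p.2));
  cell_weak : forall A : set E,
    (forall g c, closed (disk R (cell_dim c) `&`
       [set x | A (gs_act E g (cell_map (c := c) x))])) ->
    closed A }.

Definition gcw_dimension (R : realType) (gT : finGroupType) (E : gspace gT)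
    (S : free_gcw R E) (r : nat) :=
  (forall c : cell S, (cell_dim c <= r)%N) /\
  exists c : cell S, cell_dim c = r.

(* [E] is an [(r - 1)]-connected [r]-dimensional free [gT]-CW complex. *)
Definition is_E (R : realType) (r : nat) (gT : finGroupType) (E : gspace gT) :=
  pred_connected R r E /\ exists S : free_gcw R E, gcw_dimension S r.

(* Not every CW complex can be triangulated; without a triangulation, a
   statement about all of them is vacuous. *)
Definition triangulable (R : realType) (gT : finGroupType) (E : gspace gT) :=
  exists X : gcomplex gT, triangulates R X E.

(** * The four statements *)

Section Statements.
Variables (R : realType) (gT : finGroupType) (T : graph).
Variables (to : graph_action gT T) (E : gspace gT) (r s : nat).

Definition statement_i :=
  forall X : gcomplex gT, triangulates R X E ->
    ((s%:Z)%:E <=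
       chi (@tensor_over gT T to (one_skeleton X) (gc_act X)))%E.

Definition statement_ii :=
  ~ equivariant_map E
      (realization_gspace R (hom_gcomplex to (complete_graph s.-1))).

Definition statement_iii :=
  forall G : graph,
    equivariant_map E (realization_gspace R (hom_gcomplex to G)) ->
    ((s%:Z)%:E <= chi G)%E.

Definition statement_iv :=
  forall G : graph,
    pred_connected R r (realization R (hom_complex T G)) ->
    ((s%:Z)%:E <= chi G)%E.

End Statements.

(* Main.v *)
(* (ii) => (iii): a colouring of [G] pushes [Hom(T, G)] into [Hom(T, K_(s-1))].
   (iii) => (iv): obstruction theory over the free cells of [E].

   (iv) => (i): let [K] be the barycentric subdivision of a triangulation of [E].
   The lattice points [n : K -> nat] of the cone over [K] at height at least [m],
   two being adjacent when they differ by at most one in every coordinate, form a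
   graph [Z] with [|Hom(T, Z)|] homotopically as connected as [|K|].  For large [m]
   the group moves every lattice point far away, so that homomorphisms lift
   locally from [T x_Gamma Z] to [T x Z]; if [T] is vertex critical, its
   endomorphisms are automorphisms, hence elements of [Gamma], and
   [Hom(T, T x_Gamma Z)] is isomorphic to [Hom(T, Z)].  Moreover
   [T x_Gamma Z] maps to [T x_Gamma X^1].

   (i) => (ii): let [E -> |Hom(T, K_(s-1))|] be equivariant.  Since [E] has dimension
   [r], so have its triangulations (Lebesgue's covering argument, by way of
   Sperner's lemma); hence the barycentric subdivision of a triangulation maps
   simplicially to the join [J] of [r + 1] copies of [Gamma], a compact complex
   mapping to [E].  By uniform continuity on [|J|], on a fine enough subdivision [X]
   one can pick equivariantly, near the image of each vertex [n], a vertex [S n] of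
   [Hom(T, K_(s-1))] such that adjacent vertices have comparable [S]; any element of
   [S n t] is then a colour for the class of [(t, n)] in [T x_Gamma X^1]. *)

From HB Require Import structures.
Require Import Defs.
From mathcomp Require Import all_boot all_order all_algebra all_fingroup.
From mathcomp Require Import finmap.
From mathcomp Require Import all_classical all_reals all_analysis.
From mathcomp Require Import zify ring lra.

Set Implicit Arguments.
Unset Strict Implicit.
Unset Printing Implicit Defensive.

Import Order.TTheory GRing.Theory Num.Theory.
Import numFieldNormedType.Exports.

Local Open Scope classical_set_scope.
Local Open Scope ring_scope.

(** * Geometric realizations *)

(** The triangulations of [E] may be infinite, and then no single subdivision need be fine enough
    for a map defined on one. This is why (i) => (ii) passes through a finite complex, and why the
    dimension of [E] matters there: a simplicial map to a join needs as many indices as a simplex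
    has vertices. In (iv) => (i) the obstacle is to deform multihomomorphisms without losing
    adjacency. Coordinatewise minima and maxima of integral functions change by no more than their
    arguments do, so the adjacency of lattice points survives them. The height of the cone serves a
    second purpose: a multihomomorphism spreads over a distance fixed by [T], and only high up do
    distinct translates of a point lie farther apart than that. As for continuity, the coherent
    topology is easy to handle on finite subcomplexes, so maps from compact spaces are first
    confined to finitely many vertices and then treated coordinatewise. *)

Section RealContinuity.
Variables (R : realType) (X : topologicalType).

Lemma continuous_sumr (I : Type) (r : seq I) (P : pred I) (f : I -> X -> R) :
  (forall i, P i -> continuous (f i)) ->
  continuous (fun x => \sum_(i <- r | P i) f i x : R).
Proof.
move=> cf x; elim: r => [|i r IH].
  under eq_fun do rewrite big_nil; exact: cvg_cst.
under eq_fun do rewrite big_cons; case: ifP => Pi //.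
by apply: cvgD => //; exact: cf.
Qed.

Lemma continuous_prodr (I : Type) (r : seq I) (P : pred I) (f : I -> X -> R) :
  (forall i, P i -> continuous (f i)) ->
  continuous (fun x => \prod_(i <- r | P i) f i x : R).
Proof.
move=> cf x; elim: r => [|i r IH].
  under eq_fun do rewrite big_nil; exact: cvg_cst.
under eq_fun do rewrite big_cons; case: ifP => Pi //.
by apply: cvgM => //; exact: cf.
Qed.

End RealContinuity.

Section RealizationTopology.
Variables (R : realType) (K : simplicial_complex).
Implicit Types (x : realization R K).

Definition supp x : set K := [set v | val x v != 0].

Lemma coord_ge0 x v : 0 <= val x v.
Proof. by have [x0 _ _] := set_valP x; exact: x0. Qed.

Lemma supp_simplex x : simplex (supp x).
Proof. by have [_ sx _] := set_valP x. Qed.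

Lemma supp_finite x : finite_set (supp x).
Proof. exact/simplex_finite/supp_simplex. Qed.

Lemma coord_gt0 x v : supp x v -> 0 < val x v.
Proof. by move=> xv; rewrite lt_neqAle eq_sym coord_ge0 andbT. Qed.

Lemma fsum_support (A : {fset K}) x (c : K -> R) : supp x `<=` [set` A] ->
  \sum_(v \in [set: K]) val x v * c v = \sum_(v <- A) val x v * c v.
Proof.
move=> sA; apply: fsbigTE => v vA; suff -> : val x v = 0 by rewrite mul0r.
by apply: contraNeq vA => xv; exact: sA.
Qed.

Lemma sum_coord (A : {fset K}) x : supp x `<=` [set` A] ->
  \sum_(v <- A) val x v = 1.
Proof.
have [_ _ <-] := set_valP x => sA.
apply/esym/fsbigTE => v vA.
by apply: contraNeq vA => xv; exact: sA.
Qed.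

Lemma coord_le1 x v : val x v <= 1.
Proof.
have [/eqP->//|xv] := boolP (val x v == 0).
rewrite -(@sum_coord (fset_set (supp x)) x); last first.
  by rewrite fset_setK //; exact: supp_finite.
rewrite (big_fsetD1 v) /=; last by rewrite in_fset_set ?inE//; exact: supp_finite.
by rewrite lerDl sumr_ge0 // => w _; exact: coord_ge0.
Qed.

Lemma realization_eq (x y : realization R K) : (forall v, val x v = val y v) -> x = y.
Proof. by move=> xy; apply: val_inj; exact/funext. Qed.

Lemma open_simplexwise (U : set (realization R K)) :
  (forall s, simplex s -> open (U : set (subspace (@in_simplex R K s)))) ->
  open U.
Proof.
move=> oU; rewrite realization_openE => s ss x Ux sx.
have /open_subspaceP[V oV VU] := oU s ss.
have [Vx _] : (V `&` in_simplex s) x by rewrite VU.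
have [e e0 eV] := oV s ss x Vx sx.
exists e => // y sy yx.
by have [] : (U `&` in_simplex s) y by rewrite -VU; split => //; exact: eV.
Qed.

Lemma continuous_simplexwise (Y : topologicalType) (F : realization R K -> Y) :
  (forall s, simplex s -> {within in_simplex s, continuous F}) -> continuous F.
Proof.
move=> cF; apply/continuousP => U oU; apply: open_simplexwise => s ss.
by have /continuousP := cF s ss; exact.
Qed.

(** On finitely many vertices the coherent topology is the Euclidean one. For each subset [B] of [A]
    spanning a simplex, either [F y] stays off [B] for [y] near [x], because a nonzero coordinate of
    [F x] stays nonzero, or openness of [U] on [B] applies. These finitely many conditions are
    intersected and used at the support of [F y]. *)
Lemma continuous_finite_support (X : topologicalType)
    (F : X -> realization R K) (A : {fset K}) :
  (forall z, supp (F z) `<=` [set` A]) ->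
  (forall v, v \in A -> continuous (fun z => val (F z) v : R)) ->
  continuous F.
Proof.
move=> FA cF; apply/continuousP => U oU; rewrite openE => x Ux.
have near_face (B : {fset K}) : B \in fpowerset A ->
    \forall y \near x, simplex [set` B] -> in_simplex [set` B] (F y) -> U (F y).
  rewrite fpowersetE => BA.
  have [sB|nsB] := pselect (simplex [set` B]); last first.
    by apply: nearW => y /nsB.
  have [FxB|] := pselect (in_simplex [set` B] (F x)).
    have [e e0 eU] := oU _ sB _ Ux FxB.
    have : \forall y \near x, forall v, v \in A -> `|val (F y) v - val (F x) v| < e.
      pose g v := [set y | `|val (F y) v - val (F x) v| < e].
      have := @filter_bigI _ _ A g (nbhs x) _ => H.
      have /H : forall v, v \in A -> nbhs x (g v).
        move=> v vA; have /cvgrPdist_lt/(_ e e0) := cF v vA x.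
        by apply: filterS => y; rewrite /g/= distrC.
      by apply: filterS => y + v vA; apply.
    apply: filterS => y yx _ FyB; apply: eU => // v.
    have [/yx//|vA] := boolP (v \in A).
    have FA0 z : val (F z) v = 0.
      by apply: contraNeq vA => Fzv; exact: FA Fzv.
    by rewrite !FA0 subrr normr0.
  move=> /existsNP[v /not_implyP[/= Fxv vB]].
  have vA : v \in A by exact: FA Fxv.
  have := @cvgr_neq0 _ _ _ _ _ (fun z => val (F z) v : R) _ (cF v vA x) Fxv.
  move=> H; near=> y => _ FyB; case: vB; apply: (FyB v) => /=.
  by near: y; exact: H.
have := @filter_bigI _ _ (fpowerset A)
  (fun B => [set y | simplex [set` B] -> in_simplex [set` B] (F y) -> U (F y)])
  (nbhs x) _ near_face.
move=> H; suff : \forall y \near x, U (F y) by [].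
apply: (@filterS _ _ (nbhs_filter x) _ _ _ (H (nbhs_filter x))) => y /(_ (fset_set (supp (F y)))) /=.
have E : [set` fset_set (supp (F y))] = supp (F y).
  by rewrite fset_setK//; exact: supp_finite.
rewrite E; apply; [|exact: supp_simplex|by []].
rewrite fpowersetE; apply/fsubsetP => v; rewrite in_fset_set; last exact: supp_finite.
by rewrite inE => /FA.
Unshelve. all: by end_near. Qed.

Lemma coord_cont v : continuous (fun x => val x v : R).
Proof.
apply/continuousP => U; rewrite openE => oU.
rewrite realization_openE => s ss x Ux sx.
have /nbhs_ballP[e e0 eU] := oU _ Ux.
by exists e => // y _ yx; apply: eU; rewrite /ball/= /ball/= distrC; exact: yx.
Qed.

Lemma linear_cont (c : K -> R) :
  continuous (fun x => \sum_(v \in [set: K]) val x v * c v : R).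
Proof.
apply: continuous_simplexwise => s ss.
apply: (@subspace_eq_continuous _ _ _
  (fun x => \sum_(v <- fset_set s) val x v * c v : R)).
  move=> x; rewrite inE => sx; apply/esym/fsum_support.
  by rewrite fset_setK//; exact: simplex_finite.
apply: continuous_subspaceT.
apply: (@continuous_sumr _ _ _ _ _ (fun v (y : realization R K) => val y v * c v)) => v _ x.
by have H := @coord_cont v x; exact: (cvgM H (cvg_cst _)).
Qed.

Lemma realization_hausdorff : hausdorff_space (realization R K).
Proof.
move=> x y xy; apply: realization_eq => v.
apply: (@norm_hausdorff _ R^o) => A B xA yB.
have xA' : nbhs x ((fun z => val z v) @^-1` A) := coord_cont xA.
have yB' : nbhs y ((fun z => val z v) @^-1` B) := coord_cont yB.
by have [z [? ?]] := xy _ _ xA' yB'; exists (val z v).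
Qed.

(** By Tychonoff: the simplex is the continuous image of a closed part of a product of segments and
    points. *)
Lemma simplex_compact s : simplex s -> compact (@in_simplex R K s).
Proof.
move=> ss; have fs := simplex_finite ss; have [v0 sv0] := simplex_neq0 ss.
pose A := fset_set s.
have AE v : (v \in A) = (v \in s) by rewrite in_fset_set.
have As : [set` A] = s by rewrite fset_setK.
pose P := prod_topology (fun _ : K => R : topologicalType).
pose Av v : set R := if v \in A then `[0, 1]%classic else [set 0].
pose C1 : set P := [set f : forall _ : K, R | forall v, Av v (f v)].
have cC1 : compact C1.
  apply: (@tychonoff K (fun=> R) Av) => v; rewrite /Av.
  by case: ifP => _; [exact: segment_compact|exact: compact_set1].
pose C2 : set P := [set f | \sum_(v <- A) f v = 1].
have cC2 : closed C2.
  have -> : C2 = (fun f : P => \sum_(v <- A) (f v : R)) @^-1` [set 1] by [].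
  apply: preimage_closed; last exact: closed_eq.
  move=> f _; apply: (@continuous_sumr _ _ _ _ _ (fun v (h : P) => h v : R)) => v _.
  exact: (@proj_continuous K (fun=> R)).
have Cb (f : P) : (C1 `&` C2) f -> barycentric (f : K -> R).
  move=> [f1 f2]; have f0 v : 0 <= (f v : R).
    by have := f1 v; rewrite /Av; case: ifP => _ /=; [rewrite in_itv => /andP[]|move=> ->].
  have fA v : (f v : R) != 0 -> v \in A.
    by apply: contraTT => vA; have := f1 v; rewrite /Av (negbTE vA) /= => ->; rewrite eqxx.
  have E : \sum_(v \in [set: K]) (f v : R) = 1.
    rewrite -f2; apply: fsbigTE => v vA.
    by apply: contraNeq vA => /fA.
  split => //; apply: (simplex_face ss).
    by move=> v /= /fA; rewrite AE inE.
  have : (\sum_(v \in [set: K]) (f v : R)) != 0 by rewrite E oner_neq0.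
  by move=> /(@fsbigN1 R 0 _ unit K setT (fun=> f) tt) [v _]; exists v.
have b0 : (fun v => (v == v0)%:R : R) \in @barycentric R K.
  rewrite inE; split.
  - by move=> v; exact: ler0n.
  - rewrite (_ : mkset _ = [set v0]); first exact: simplex_vertex.
    apply/seteqP; split => v /=; last by move=> ->; rewrite eqxx oner_neq0.
    by have [->|] := eqVneq v v0; rewrite //= eqxx.
  - rewrite (fsbigTE [fset v0]%fset); last by move=> v; rewrite inE => /negbTE->.
    by rewrite big_seq_fset1 eqxx.
pose x0 : realization R K := exist (fun f : K -> R => f \in @barycentric R K) _ b0.
pose iota (f : P) : realization R K :=
  if pselect ((C1 `&` C2) f) is left h
  then exist (fun f : K -> R => f \in @barycentric R K) f (mem_set (Cb f h)) else x0.
have iotaE f v : (C1 `&` C2) f -> val (iota f) v = f v :> R.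
  by move=> Cf; rewrite /iota; case: pselect.
have iotaA f : supp (iota f) `<=` [set` A].
  move=> v; rewrite /supp/= /iota; case: pselect => [[f1 _]|_] /=.
    by apply: contraTT => vA; have := f1 v; rewrite /Av (negbTE vA) /= => ->; rewrite eqxx.
  case: (eqVneq v v0) => [->|]; last by rewrite eqxx.
  by rewrite AE inE.
have -> : in_simplex s = iota @` (C1 `&` C2).
  apply/seteqP; split => [x sx|x [f Cf <-]]; last by rewrite /in_simplex/= -As; exact: iotaA.
  have Cx : (C1 `&` C2) (val x : P).
    split; last by apply: sum_coord; rewrite As.
    move=> v; rewrite /Av; case: ifPn => vA; first by rewrite /= in_itv /= coord_ge0 coord_le1.
    rewrite AE notin_setE in vA; apply/eqP; apply: contra_notT vA => ?; exact: sx.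
  by exists (val x) => //; apply: realization_eq => v; rewrite iotaE.
apply: continuous_compact; last exact: compact_closedI.
apply: (@continuous_finite_support (subspace (C1 `&` C2)) iota A) => // v vA.
apply: (@subspace_eq_continuous _ _ _ (fun f : P => f v : R)).
  by move=> f; rewrite inE => Cf; rewrite -iotaE.
apply: continuous_subspaceT; exact: (@proj_continuous K (fun=> R)).
Qed.

Lemma finite_support_compact (A : {fset K}) :
  compact [set x | supp x `<=` [set` A]].
Proof.
have -> : [set x | supp x `<=` [set` A]] =
   \big[setU/set0]_(B <- fpowerset A | `[< simplex [set` B] >]) in_simplex [set` B].
  apply/seteqP; split => x.
    move=> sA; rewrite -bigcup_seq_cond.
    have E : [set` fset_set (supp x)] = supp x by rewrite fset_setK//; exact: supp_finite.
    exists (fset_set (supp x)); rewrite /= ?E//; apply/andP.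
    split; last by apply/asboolP; exact: supp_simplex.
    rewrite fpowersetE; apply/fsubsetP => v; rewrite in_fset_set; last exact: supp_finite.
    by rewrite inE => /sA.
  rewrite -bigcup_seq_cond => -[B /andP[]]; rewrite fpowersetE => /fsubsetP BA _ xB v xv.
  by apply: BA; exact: xB.
by apply: bigsetU_compact => B /asboolP sB; exact: simplex_compact.
Qed.

(* A sum weighted so as to be at least [n] at the [n]-th point of a sequence
   using infinitely many vertices would be continuous and unbounded. *)
Lemma compact_finite_support (C : set (realization R K)) : compact C ->
  exists A : {fset K}, forall x, C x -> supp x `<=` [set` A].
Proof.
move=> cC; pose S := \bigcup_(x in C) supp x.
have [fS|] := pselect (finite_set S).
  by exists (fset_set S) => x Cx v xv; rewrite /= in_fset_set ?inE //; exists x.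
move=> /infiniteP /card_leP [f0]; exfalso.
pose f n := val (f0 (exist _ n (mem_setT n))).
have fS n : S (f n) by exact: set_valP.
have /choice[x xP] n : exists x, C x /\ supp x (f n).
  by have [y Cy yf] := fS n; exists y.
have finj n m : f n = f m -> n = m.
  by move=> /val_inj /(@inj _ _ _ f0 _ _ (mem_setT _) (mem_setT _)) [].
pose c v : R := if pselect (exists n, f n = v) is left h
  then (projT1 (cid h))%:R / val (x (projT1 (cid h))) v else 0.
have cf n : c (f n) = n%:R / val (x n) (f n).
  rewrite /c; case: pselect => [h|[]]; last by exists n.
  by case: cid => m /= /finj ->.
have c0 v : 0 <= c v.
  by rewrite /c; case: pselect => // h; rewrite mulr_ge0 // invr_ge0 coord_ge0.
pose g (y : realization R K) : R := \sum_(v \in [set: K]) val y v * c v.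
have gx n : n%:R <= g (x n).
  rewrite /g (@fsum_support (fset_set (supp (x n)))); last first.
    by rewrite fset_setK//; exact: supp_finite.
  have [_ xfn] := xP n.
  rewrite (big_fsetD1 (f n)) /=; last by rewrite in_fset_set ?inE//; exact: supp_finite.
  rewrite cf mulrCA mulfV // mulr1 lerDl sumr_ge0 // => v _.
  by rewrite mulr_ge0 // coord_ge0.
have /(continuous_compact (A := C))/(_ cC) : {within C, continuous g}.
  by apply: continuous_subspaceT; exact: linear_cont.
move=> /compact_bounded[M [_ /(_ (M + 1))]]; rewrite ltrDl ltr01 => /(_ isT) gM.
have [n Mn] : exists n : nat, M + 1 < n%:R.
  by exists (Num.bound `|M + 1|); rewrite (le_lt_trans (ler_norm _)) // archi_boundP.
have : `|g (x n)| <= M + 1 by apply: gM; exists (x n) => //; have [] := xP n.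
by rewrite leNgt (lt_le_trans Mn) // (le_trans (gx n)) // ler_norm.
Qed.

End RealizationTopology.

Lemma continuous_finite_support_within (R : realType) (K : simplicial_complex)
    (X : topologicalType) (D : set X) (F : X -> realization R K)
    (A : {fset K}) :
  (forall z, D z -> supp (F z) `<=` [set` A]) ->
  (forall v, {within D, continuous (fun z => val (F z) v : R)}) ->
  {within D, continuous F}.
Proof.
move=> FA cF.
have [[z0 Dz0]|D0] := pselect (D !=set0); last first.
  rewrite (_ : D = set0); first exact: continuous_subspace0.
  by apply/seteqP; split => // z Dz; case: D0; exists z.
(* Off [D] a fixed value of [F] is used, so that the support bound holds everywhere. *)
pose F' z := if z \in D then F z else F z0.
have F'E : {in D, F' =1 F} by move=> z; rewrite /F' => ->.
apply: (subspace_eq_continuous F'E).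
apply: (@continuous_finite_support R K (subspace D) F' A) => [z|v _].
  by rewrite /F'; case: ifPn => [/set_mem|_]; exact: FA.
by apply: (subspace_eq_continuous _ (cF v)) => z zD; rewrite F'E.
Qed.

Lemma within_comp (X Y Z : topologicalType) (D : set X) (f : X -> Y) (g : Y -> Z) :
  {within D, continuous f} -> continuous g -> {within D, continuous (g \o f)}.
Proof.
move=> cf cg x.
exact: (@continuous_comp (subspace D) _ _ f g x (cf x) (cg _)).
Qed.

(** * Points and maps given by weights on a finite index set *)

Section WeightedPoints.
Variables (R : realType) (K : simplicial_complex).

Definition weight_point (I : finType) (Phi : I -> K) (w : I -> R) : K -> R :=
  fun v => (\sum_(i | Phi i == v) w i) / \sum_i w i.

Section Static.
Variables (I : finType) (Phi : I -> K) (w : I -> R).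
Hypothesis w0 : forall i, 0 <= w i.
Hypothesis sw : simplex [set v | exists2 i, 0 < w i & Phi i = v].

Lemma weight_sum_gt0 : 0 < \sum_i w i.
Proof.
have [v [i wi _]] := simplex_neq0 sw.
by rewrite (bigD1 i) //= ltr_pwDl // sumr_ge0.
Qed.

Lemma weight_point_neq0 v :
  (weight_point Phi w v != 0) = `[< exists2 i, 0 < w i & Phi i = v >].
Proof.
rewrite /weight_point mulf_eq0 invr_eq0 (gt_eqF weight_sum_gt0) orbF.
apply/idP/asboolP => [|[i wi Pi]].
  rewrite psumr_neq0 // => /hasP[i _ /andP[/eqP Pi wi]]; by exists i.
rewrite psumr_neq0 //; apply/hasP; exists i; first by rewrite mem_index_enum.
by rewrite Pi eqxx wi.
Qed.

Lemma weight_barycentric : barycentric (weight_point Phi w).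
Proof.
have W := weight_sum_gt0.
have E : [set v | weight_point Phi w v != 0] =
    [set v | exists2 i, 0 < w i & Phi i = v].
  by apply/seteqP; split => v /=; rewrite weight_point_neq0 => /asboolP.
split; first by move=> v; rewrite mulr_ge0 ?sumr_ge0 ?invr_ge0 // ltW.
  by rewrite E.
have fS := simplex_finite sw.
rewrite (fsbigTE (fset_set [set v | exists2 i, 0 < w i & Phi i = v])); last first.
  move=> v; rewrite in_fset_set // => /negP vE; apply/eqP; apply: contra_notT vE.
  by rewrite weight_point_neq0 => /asboolP wv; rewrite inE.
rewrite -mulr_suml; apply: (mulIf (lt0r_neq0 W)); rewrite mul1r mulfVK ?lt0r_neq0 //.
rewrite (exchange_big_dep predT) //= [RHS](bigID (fun i => 0 < w i)) /=.
rewrite [X in _ = _ + X]big1 ?addr0; last first.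
  by move=> i /negP wi; apply/eqP; rewrite eq_le w0 andbT leNgt; apply/negP.
rewrite (bigID (fun i => 0 < w i)) /= [X in _ + X]big1 ?addr0; last first.
  move=> i /negP wi; have -> : w i = 0.
    by apply/eqP; rewrite eq_le w0 andbT leNgt; apply/negP.
  by rewrite big1.
apply: eq_bigr => i wi.
rewrite -big_filter (_ : [seq _ <- _ | _] = [:: Phi i]) ?big_seq1 //.
rewrite (eq_filter (a2 := pred1 (Phi i))); last by move=> v; rewrite /= eq_sym.
rewrite filter_pred1_uniq ?fset_uniq // in_fset_set // inE; by exists i.
Qed.

End Static.

(** The usual way here to write down a map into a realization: once the vertices of positive weight
    span a simplex at each point, normalisation does the rest. *)
Lemma weight_map (X : topologicalType) (D : set X) (I : finType) (Phi : I -> K)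
    (w : I -> X -> R) (x0 : realization R K) :
  (forall i x, D x -> 0 <= w i x) ->
  (forall x, D x -> simplex [set v | exists2 i, 0 < w i x & Phi i = v]) ->
  (forall i, {within D, continuous w i}) ->
  exists F : X -> realization R K, {within D, continuous F} /\
    forall x, D x -> val (F x) = weight_point Phi (w^~ x) :> (K -> R).
Proof.
move=> w0 sw cw.
pose F x : realization R K := if pselect (D x) is left Dx
  then exist (fun f : K -> R => f \in @barycentric R K) _
    (mem_set (weight_barycentric (fun i => w0 i x Dx) (sw x Dx))) else x0.
have FE x : D x -> val (F x) = weight_point Phi (w^~ x) :> (K -> R).
  by rewrite /F; case: pselect.
exists F; split => //.
apply: (@continuous_finite_support_within _ _ _ D F [fset Phi i | i in I]%fset).
  move=> x Dx v; rewrite /supp /= FE // weight_point_neq0 //; last 2 first.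
  - by move=> i; exact: (w0 i x Dx).
  - exact: (sw x Dx).
  by move=> /asboolP[i _ <-]; apply/imfsetP; exists i.
move=> v; apply: (@subspace_eq_continuous _ _ _
   (fun x => (\sum_(i | Phi i == v) w i x) / \sum_i w i x)).
  by move=> x /set_mem Dx; apply/esym; have /(congr1 (@^~ v)) := FE x Dx.
apply/subspace_continuousP => x Dx.
have W : \sum_i w i x != 0.
  by apply/lt0r_neq0/(weight_sum_gt0 (Phi := Phi)) => [i|]; [exact: (w0 i x Dx)|exact: (sw x Dx)].
have num (P : pred I) : (fun y => \sum_(i | P i) w i y) @ within D (nbhs x) -->
    \sum_(i | P i) w i x.
  have /subspace_continuousP/(_ x Dx) // :=
    @continuous_sumr R (subspace D) _ (index_enum I) P (fun i => w i) (fun i _ => cw i).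
apply: cvgM; first exact: num.
by apply: cvgV => //; exact: num.
Qed.

Lemma weight_map_supp (I : finType) (Phi : I -> K) (w : I -> R)
    (x : realization R K) v :
  (forall i, 0 <= w i) ->
  simplex [set v | exists2 i, 0 < w i & Phi i = v] ->
  val x = weight_point Phi w :> (K -> R) ->
  supp x v <-> exists2 i, 0 < w i & Phi i = v.
Proof.
move=> w0 sw xE; rewrite /supp /= xE weight_point_neq0 //.
by split => /asboolP.
Qed.

(** On a finite subcomplex [F] goes from a compact space to a Hausdorff one, hence is closed. The
    last hypothesis puts the preimage of each simplex inside such a subcomplex. *)
Lemma inverse_continuous (L : simplicial_complex)
    (F : realization R L -> realization R K) (G : realization R K -> realization R L) :
  continuous F -> cancel F G -> cancel G F ->
  (forall s : set K, simplex s -> exists A : {fset L},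
     forall x, in_simplex s (F x) -> supp x `<=` [set` A]) ->
  continuous G.
Proof.
move=> cF FK GK fin; apply/continuousP => U oU.
apply: open_simplexwise => s ss; have [A AP] := fin s ss.
pose B := [set x : realization R L | supp x `<=` [set` A]] `&` ~` U.
have cB : compact B.
  apply: compact_closedI; first exact: finite_support_compact.
  by rewrite closedC.
have clF : closed (F @` B).
  apply: compact_closed; first exact: realization_hausdorff.
  by apply: continuous_compact => //; exact: continuous_subspaceT.
apply/open_subspaceP; exists (~` (F @` B)); first by rewrite openC.
apply/seteqP; split => y [yV sy]; split => //.
  apply: contrapT => nU; apply: yV; exists (G y) => //; split => //.
  by apply: AP; rewrite GK.
by move=> [z [_ zU] zy]; apply: zU; rewrite -(FK z) zy.
Qed.

End WeightedPoints.

(** Uniform continuity without a metric: it is applied to a product, with [F] and [G] measuring how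
    far apart the two components are. The minimum of [F] on the compact set where [G] is at least
    [eta] serves as [e]. *)
Lemma compact_modulus (R : realType) (X : topologicalType) (Q : set X)
    (F G : X -> R) (eta : R) : compact Q ->
  {within Q, continuous F} -> {within Q, continuous G} ->
  (forall x, Q x -> F x <= 0 -> G x < eta) ->
  exists2 e : R, 0 < e & forall x, Q x -> F x < e -> G x < eta.
Proof.
move=> cQ cF cG FG; pose Q' := Q `&` G @^-1` [set t | eta <= t].
have cQ' : compact Q'.
  have cl : closed [set t : R | eta <= t] by exact: closed_ge.
  have /continuous_closedP/(_ _ cl)/closed_subspaceP[V cV VE] := cG.
  by rewrite /Q' setIC -VE setIC; exact: compact_closedI.
have [Q'0|Q'0] := pselect (Q' !=set0); last first.
  exists 1 => // x Qx _; rewrite ltNge; apply/negP => Gx.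
  by case: Q'0; exists x.
have cF' : {within Q', continuous F}.
  by apply: continuous_subspaceW cF => x [].
have [c /set_mem[Qc Gc] cmin] := compact_EVT_min Q'0 cQ' cF'.
exists (F c) => [|x Qx Fx].
  by rewrite ltNge; apply/negP => /(FG _ Qc); rewrite ltNge Gc.
rewrite ltNge; apply/negP => Gx.
by have := cmin x (mem_set (conj Qx Gx)); rewrite leNgt Fx.
Qed.

Lemma pred_connected_retract (R : realType) r (Y Y' : topologicalType)
    (a : Y -> Y') (b : Y' -> Y) :
  continuous a -> continuous b -> cancel b a ->
  pred_connected R r Y -> pred_connected R r Y'.
Proof.
move=> ca cb ba [[y _] cY]; split; first by exists (a y).
move=> i ir f cf.
have /(_ _)[] // := cY i ir (b \o f) _.
  exact: within_comp.
move=> h ch hf; exists (a \o h).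
  exact: within_comp.
by move=> x xS /=; rewrite hf //= ba.
Qed.

(** * Affine extension of simplicial maps *)

Section SimplicialMaps.
Variables (R : realType) (K L : simplicial_complex) (phi : K -> L).
Hypothesis sphi : forall s, simplex s -> simplex (phi @` s).

Lemma push_subproof (x : realization R K) :
  (fun w => \sum_(v \in [set: K]) val x v * (phi v == w)%:R)
    \in @barycentric R L.
Proof.
pose A := fset_set (supp x).
have fx := supp_finite x.
have xA : supp x `<=` [set` A] by rewrite fset_setK.
apply/mem_set; split => [w||].
- by apply: fsumr_ge0 => v _; rewrite mulr_ge0 // coord_ge0.
- rewrite (_ : mkset _ = phi @` supp x); first exact/sphi/supp_simplex.
  apply/seteqP; split => w /=.
    rewrite (fsum_support _ xA) psumr_neq0; last first.
      by move=> v _; rewrite mulr_ge0 // coord_ge0.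
    move=> /hasP[v]; rewrite in_fset_set // inE => xv.
    by case: eqP => [<- _|_]; [exists v|rewrite mulr0 ltxx].
  move=> [v xv <-]; rewrite (fsum_support _ xA) gt_eqF //.
  rewrite (big_fsetD1 v) /=; last by rewrite in_fset_set ?inE.
  rewrite eqxx mulr1 ltr_pwDl ?coord_gt0 // sumr_ge0 // => u _.
  by rewrite mulr_ge0 // coord_ge0.
- rewrite (fsbigTE (phi @` A)%fset); last first.
    move=> w wA; rewrite (fsum_support _ xA) big_seq big1 // => v vA.
    case: eqP => [vw|_]; last by rewrite mulr0.
    by move: wA; rewrite -vw in_imfset.
  under eq_bigr do rewrite (fsum_support _ xA).
  rewrite exchange_big /= -[RHS](sum_coord xA) big_seq [RHS]big_seq.
  apply: eq_bigr => v vA; rewrite -mulr_sumr (big_fsetD1 (phi v)) ?in_imfset //=.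
  rewrite eqxx [X in _ + X]big_seq [X in _ + X]big1 ?addr0 ?mulr1 // => w.
  by rewrite !inE eq_sym => /andP[/negbTE->].
Qed.

Definition push (x : realization R K) : realization R L :=
  exist (fun f : L -> R => f \in @barycentric R L) _ (push_subproof x).

Lemma push_cont : continuous push.
Proof.
apply: continuous_simplexwise => s ss.
have fs := simplex_finite ss.
apply: (@continuous_finite_support_within _ _ _ _ _ (phi @` fset_set s)%fset).
  move=> x sx w; rewrite /supp /= (@fsum_support _ _ (fset_set s)); last first.
    by rewrite fset_setK.
  rewrite psumr_neq0; last by move=> v _; rewrite mulr_ge0 // coord_ge0.
  move=> /hasP[v vs]; case: eqP => [<- _|_]; last by rewrite mulr0 ltxx.
  by rewrite in_imfset.
by move=> w; apply: continuous_subspaceT; exact: linear_cont.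
Qed.

Lemma push_supp x : supp (push x) = phi @` supp x.
Proof.
have fx := supp_finite x.
have xA : supp x `<=` [set` fset_set (supp x)] by rewrite fset_setK.
apply/seteqP; split => w /=.
  rewrite /supp/= (fsum_support _ xA) psumr_neq0; last first.
    by move=> v _; rewrite mulr_ge0 // coord_ge0.
  move=> /hasP[v]; rewrite in_fset_set // inE => xv.
  by case: eqP => [<- _|_]; [exists v|rewrite mulr0 ltxx].
move=> [v xv <-]; rewrite /supp/= (fsum_support _ xA) gt_eqF //.
rewrite (big_fsetD1 v) /=; last by rewrite in_fset_set ?inE.
rewrite eqxx mulr1 ltr_pwDl ?coord_gt0 // sumr_ge0 // => u _.
by rewrite mulr_ge0 // coord_ge0.
Qed.

End SimplicialMaps.

Lemma push_inverse (R : realType) (K L : simplicial_complex) (phi : K -> L)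
    (psi : L -> K) (sphi : forall s, simplex s -> simplex (phi @` s))
    (spsi : forall s, simplex s -> simplex (psi @` s)) :
  cancel phi psi -> cancel psi phi ->
  cancel (@push R _ _ phi sphi) (push spsi).
Proof.
move=> phiK psiK x; apply: realization_eq => v /=.
have E w : \sum_(u \in [set: K]) val x u * (phi u == w)%:R = val x (psi w).
  rewrite (fsbigTE [fset psi w]%fset) ?big_seq_fset1 ?psiK ?eqxx ?mulr1 //.
  move=> u; rewrite inE => uw; case: eqP => [puw|]; last by rewrite mulr0.
  by move: uw; rewrite -puw phiK eqxx.
rewrite (fsbigTE [fset phi v]%fset) ?big_seq_fset1 ?E ?phiK ?eqxx ?mulr1 //.
move=> w; rewrite inE => wv; case: eqP => [pvw|]; last by rewrite mulr0.
by move: wv; rewrite -pvw psiK eqxx.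
Qed.

(** * Maps out of cell complexes *)

Lemma within_preimage_compact (X Y : topologicalType) (S : set X) (f : X -> Y)
    (C : set Y) :
  {within S, continuous f} -> compact S -> closed C -> compact (S `&` f @^-1` C).
Proof.
move=> cf cS clC.
have /continuous_closedP/(_ C clC)/closed_subspaceP[V cV VE] := cf.
by rewrite setIC -VE setIC; exact: compact_closedI.
Qed.

Lemma bigcup_compact (X : topologicalType) (I : Type) (A : set I)
    (F : I -> set X) :
  finite_set A -> (forall i, A i -> compact (F i)) -> compact (\bigcup_(i in A) F i).
Proof.
elim/Pchoice: I => I in A F *.
move=> fA cF; rewrite -(fset_setK fA) bigcup_fset big_seq.
by apply: bigsetU_compact => i; rewrite in_fset_set // inE; exact: cF.
Qed.

(** * Equivariant extension over free cells, abstract so as to cover disks of CW complexes and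
    simplices of joins *)

Section CellularExtension.
Variables (gT : finGroupType) (E : gspace gT) (cell : Type) (dim : cell -> nat).
Variables (B : cell -> topologicalType) (D O : forall c, set (B c)).
Variable m : forall c, B c -> E.
Arguments D {c}.
Arguments O {c}.
Arguments m {c}.
Hypothesis hE : hausdorff_space E.
Hypothesis hB : forall c, hausdorff_space (B c).
Hypothesis cD : forall c, compact (@D c).
Hypothesis cS : forall c, compact (@D c `\` O).
Hypothesis cm : forall c, {within D, continuous (@m c)}.
Hypothesis cover : forall x, exists g (p : {c & B c}),
  O (projT2 p) /\ x = gs_act E g (m (projT2 p)).
Hypothesis cell_inj : forall g c y g' c' y', @O c y -> @O c' y' ->
  gs_act E g (m y) = gs_act E g' (m y') ->
  g = g' /\ existT B c y = existT B c' y'.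
Hypothesis boundary : forall c, exists2 F : set (gT * cell), finite_set F &
  (forall p, F p -> (dim p.2 < dim c)%N) /\
  @m c @` (D `\` O) `<=` \bigcup_(p in F) gs_act E p.1 @` (m @` @D p.2).

(** The boundary of a cell is covered by finitely many lower cells, so the part of [A] in them has a
    compact, hence closed, image [C], and the set in question is a preimage of [C]. *)
Lemma cell_sphere_compact (A : set E) n :
  (forall g c, (dim c < n)%N ->
     compact (@D c `&` [set x | A (gs_act E g (m x))])) ->
  forall g c, (dim c <= n)%N ->
     compact ((@D c `\` O) `&` [set x | A (gs_act E g (m x))]).
Proof.
move=> cA g c cn; have [F fF [Fdim Fsub]] := boundary c.
pose C := \bigcup_(p in F) gs_act E (g * p.1)%g @`
  (m @` (@D p.2 `&` [set x | A (gs_act E (g * p.1)%g (m x))])).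
have cC : compact C.
  apply: bigcup_compact => // p Fp; apply: continuous_compact.
    by apply: continuous_subspaceT; exact: gs_continuous.
  apply: continuous_compact.
    by apply: continuous_subspaceW (@cm p.2) => x [].
  by apply: cA; exact: leq_trans (Fdim _ Fp) cn.
have -> : (@D c `\` O) `&` [set x | A (gs_act E g (m x))] =
    (@D c `\` O) `&` (gs_act E g \o m) @^-1` C.
  apply/seteqP; split => x [Sx Ax]; split => //.
    have [p Fp [_ [y Dy <-] yx]] : (\bigcup_(p in F) gs_act E p.1 @` (m @` @D p.2)) (m x).
      by apply: Fsub; exists x.
    exists p => //; exists (m y); last by rewrite lactM yx.
    by exists y => //; split => //=; rewrite lactM yx.
  by case: Ax => p Fp [_ [y [_ Ay] <-] /= E1]; rewrite -E1.
apply: within_preimage_compact => //; last exact: compact_closed.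
apply: within_comp; last exact: gs_continuous.
by apply: continuous_subspaceW (@cm c) => x [].
Qed.

Variables (Y : gspace gT) (r : nat).
Hypothesis dim_le : forall c, (dim c <= r)%N.
Hypothesis weak : forall A : set E,
  (forall g c, compact (@D c `&` [set x | A (gs_act E g (m x))])) -> closed A.
Hypothesis Y_neq0 : [set: Y] !=set0.
Hypothesis extension : forall c (f : B c -> Y),
  {within D `\` O, continuous f} ->
  exists2 h : B c -> Y, {within D, continuous h} & {in D `\` O, h =1 f}.

(** Induction on the dimension. Since the cells are free and partition [E], a function is made
    equivariant by prescribing it on one cell of each orbit; the map of stage [n + 1] changes that
    of stage [n] only on the orbits of open [n]-cells. *)
Lemma cellular_extension : equivariant_map E Y.
Proof.
have [y0 _] := Y_neq0.
have /choice[dec decP] x : exists q : gT * {c & B c},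
    O (projT2 q.2) /\ x = gs_act E q.1 (m (projT2 q.2)).
  by have [g [p xp]] := cover x; exists (g, p).
have dec_uniq g c (y : B c) : O y -> dec (gs_act E g (m y)) = (g, existT B c y).
  move=> Oy; have [Oz] := decP (gs_act E g (m y)).
  case: (dec _) Oz => h [c' z] /= Oz /cell_inj[] // -> <-.
  by [].
have decM h x : dec (gs_act E h x) = ((h * (dec x).1)%g, (dec x).2).
  have [Oy {1}->] := decP x; case: (dec x) Oy => g [c y] /= Oy.
  by rewrite -lactM dec_uniq.
(* One bound for two cases: at most [dim c] inside the open cell, and one less on its boundary. *)
have dec_dim n : forall c, (dim c <= n)%N -> forall y : B c, D y ->
    (dim (projT1 (dec (m y)).2) <= dim c - (y \notin O))%N.
  elim/ltn_ind: n => n IH c cn y Dy.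
  have [/set_mem Oy|nOy] := boolP (y \in O).
    by rewrite -(lact1 (gs_act E) (m y)) dec_uniq // subn0.
  have [F _ [Fdim Fsub]] := boundary c.
  have [p Fp [_ [z Dz <-] zy]] : (\bigcup_(p in F) gs_act E p.1 @` (m @` @D p.2)) (m y).
    by apply: Fsub; exists y => //; split => // /mem_set; exact/negP.
  rewrite -zy decM /=.
  have pc := Fdim _ Fp.
  have := IH (dim p.2) (leq_trans pc cn) p.2 (leqnn _) z Dz.
  by move: pc; clear; case: (z \notin O) => /=; lia.
suff [phi [phiM cphi]] : exists phi : E -> Y,
    (forall g x, phi (gs_act E g x) = gs_act Y g (phi x)) /\
    forall c, (dim c < r.+1)%N -> {within D, continuous (phi \o @m c)}.
  exists phi; split => //; apply/continuous_closedP => C cC; apply: weak => g c.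
  have -> : @D c `&` [set x | (phi @^-1` C) (gs_act E g (m x))] =
      D `&` (gs_act Y g \o (phi \o m)) @^-1` C.
    by apply/seteqP; split => x [Dx] /=; rewrite phiM.
  apply: within_preimage_compact => //; apply: within_comp; last exact: gs_continuous.
  by apply: cphi; rewrite ltnS.
elim: r.+1 => [|n [phi [phiM cphi]]].
  (* Any equivariant function will start the induction, as no cell has negative dimension. *)
  exists (fun x => gs_act Y (dec x).1 y0); split => // g x.
  by rewrite decM lactM.
have ext c : exists h : B c -> Y, dim c = n -> {within D, continuous h} /\
    {in D `\` O, h =1 phi \o m}.
  have [cn|cn] := eqVneq (dim c) n; last first.
    by exists (phi \o m) => /eqP; rewrite (negbTE cn).
  have [|h ch hE'] := @extension c (phi \o m); last by exists h.
  apply/continuous_closedP => C cC; apply/closed_subspaceP.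
  exists ((@D c `\` O) `&` [set x | (phi @^-1` C) (gs_act E 1%g (m x))]).
    apply: compact_closed => //; apply: (@cell_sphere_compact _ n); last by rewrite cn.
    move=> g c' c'n.
    have -> : @D c' `&` [set x | (phi @^-1` C) (gs_act E g (m x))] =
        D `&` (gs_act Y g \o (phi \o m)) @^-1` C.
      by apply/seteqP; split => x [Dx] /=; rewrite phiM.
    by apply: within_preimage_compact => //; apply: within_comp;
      [exact: cphi|exact: gs_continuous].
  apply/seteqP; split => x; first by move=> [[Sx]] /=; rewrite lact1.
  by move=> [Cx Sx]; split => //; split => //=; rewrite lact1.
pose h c := projT1 (cid (ext c)).
have hP c : dim c = n -> {within D, continuous (h c)} /\ {in D `\` O, h c =1 phi \o m}.
  by rewrite /h; case: cid.
pose H (p : {c & B c}) := h (projT1 p) (projT2 p).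
pose psi x := if dim (projT1 (dec x).2) == n then gs_act Y (dec x).1 (H (dec x).2)
  else phi x.
exists psi; split => [g x|c].
  by rewrite /psi decM /=; case: ifP => _; rewrite ?lactM ?phiM.
rewrite ltnS leq_eqVlt => /orP[/eqP cn|cn].
  have [ch hphi] := hP c cn; apply: (subspace_eq_continuous _ ch) => y /set_mem Dy /=.
  change (h c y = psi (m y)).
  have [/set_mem Oy|nOy] := boolP (y \in O).
    have E1 : dec (m y) = (1%g, existT B c y).
      by rewrite -{1}(lact1 (gs_act E) (m y)); exact: dec_uniq.
    by rewrite /psi E1 /= cn eqxx /H /= lact1.
  have dn := dec_dim _ c (leqnn _) y Dy.
  change (h c y = psi (m y)).
  rewrite hphi; last by apply/mem_set; split => // /mem_set; exact/negP.
  have [F _ [Fdim Fsub]] := boundary c.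
  have [p Fp _] : (\bigcup_(p in F) gs_act E p.1 @` (m @` @D p.2)) (m y).
    by apply: Fsub; exists y => //; split => // /mem_set; exact/negP.
  have := Fdim _ Fp; rewrite nOy /= in dn => pc.
  by rewrite /psi ltn_eqF //; move: dn pc; rewrite cn; lia.
apply: (subspace_eq_continuous _ (cphi c cn)) => y /set_mem Dy /=.
have dn := dec_dim _ c (leqnn _) y Dy.
change (phi (m y) = psi (m y)).
by rewrite /psi ltn_eqF // (leq_ltn_trans dn) // (leq_ltn_trans _ cn) // leq_subr.
Qed.

End CellularExtension.

(** * Euclidean disks and spheres *)

Section Disks.
Variables (R : realType) (n : nat).

Lemma sqnorm_cont : continuous (@sqnorm R n).
Proof.
apply: continuous_sumr => i _ x; under eq_fun do rewrite expr2.
by have H := @coord_continuous R 1 n ord0 i x; exact: (cvgM H H).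
Qed.

Lemma sqnorm_ge0 (x : 'rV[R]_n) : 0 <= sqnorm x.
Proof. by apply: sumr_ge0 => i _; exact: sqr_ge0. Qed.

Lemma sqnorm_coord (x : 'rV[R]_n) i : x ord0 i ^+ 2 <= sqnorm x.
Proof.
by rewrite /sqnorm (bigD1 i) //= lerDl sumr_ge0 // => j _; exact: sqr_ge0.
Qed.

Lemma disk_closed : closed (disk R n).
Proof.
have -> : disk R n = @sqnorm R n @^-1` [set t | t <= 1] by [].
by apply: preimage_closed => [x _|]; [exact: sqnorm_cont|exact: closed_le].
Qed.

Lemma sphere_closed : closed (sphere R n).
Proof.
have -> : sphere R n = @sqnorm R n @^-1` [set t | t = 1] by [].
by apply: preimage_closed => [x _|]; [exact: sqnorm_cont|exact: closed_eq].
Qed.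

Lemma disk_compact : compact (disk R n).
Proof.
apply: bounded_closed_compact; last exact: disk_closed.
exists 1; split => // M M1 x /= xD.
rewrite /Num.norm/= mx_normrE; apply: bigmax_le => [|[i j] _ /=].
  by rewrite ltW // (lt_trans ltr01).
rewrite (ord1 i) (le_trans _ (ltW M1)) // -(@ler_pXn2r _ 2) ?nnegrE //.
by rewrite expr1n real_normK ?num_real // (le_trans (sqnorm_coord _ _)).
Qed.

Lemma disk_sphere : disk R n `\` open_disk R n = sphere R n.
Proof.
apply/seteqP; split => x; rewrite /disk /open_disk /sphere /=.
  by move=> [x1 /negP]; rewrite -leNgt => x2; apply/eqP; rewrite eq_le x1.
by move=> ->; split => //; rewrite ltxx.
Qed.

Lemma sphere_compact : compact (sphere R n).
Proof.
have -> : sphere R n = disk R n `&` sphere R n.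
  by apply/esym/setIidr => x; rewrite /sphere /disk /= => ->.
apply: compact_closedI; [exact: disk_compact|exact: sphere_closed].
Qed.

Lemma disk_hausdorff : hausdorff_space 'rV[R]_n.
Proof. exact: norm_hausdorff. Qed.

End Disks.

Lemma sphere_extension (R : realType) (r n : nat) (Y : topologicalType)
    (f : 'rV[R]_n -> Y) : (n <= r)%N -> pred_connected R r Y ->
  {within sphere R n, continuous f} ->
  exists2 h : 'rV[R]_n -> Y, {within disk R n, continuous h} &
    {in sphere R n, h =1 f}.
Proof.
(* The sphere in dimension 0 is empty, so a constant map extends; this is where nonemptiness of [Y]
   enters. *)
case: n f => [|i] f ir [[y0 _] cY] cf; last exact: cY.
exists (fun=> y0) => [x|x]; first exact: cvg_cst.
by rewrite inE /sphere /sqnorm /= big_ord0 => /esym/eqP; rewrite oner_eq0.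
Qed.

Lemma gcw_to_connected (R : realType) (gT : finGroupType) (E Y : gspace gT)
    (S : free_gcw R E) (r : nat) :
  (forall c : cell S, (cell_dim c <= r)%N) -> pred_connected R r Y ->
  equivariant_map E Y.
Proof.
move=> Sr cY; have [Y0 _] := cY.
apply: (@cellular_extension gT E (cell S) (@cell_dim R gT E S)
  (fun c => 'rV[R]_(cell_dim c)) (fun c => disk R (cell_dim c))
  (fun c => open_disk R (cell_dim c)) (@cell_map R gT E S) _ _ _ _ _ _ _ _
  Y r Sr) => //.
- exact: (cell_hausdorff S).
- by move=> c; exact: disk_compact.
- by move=> c; rewrite disk_sphere; exact: sphere_compact.
- exact: cell_continuous.
- by move=> x; have [[g p] [pP _]] := cell_partition S x; exists g, p.
- move=> g c y g' c' y' Oy Oy' E1.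
  have [p [_ pu]] := cell_partition S (gs_act E g (cell_map y)).
  have P1 := pu (g, existT _ c y) (conj Oy erefl).
  have P2 := pu (g', existT _ c' y') (conj Oy' E1).
  have E2 := etrans (esym P1) P2.
  by split; [exact: (congr1 fst E2)|exact: (congr1 snd E2)].
- by move=> c; rewrite disk_sphere; exact: cell_boundary.
- move=> A cA; apply: (cell_weak (f := S)) => g c.
  by apply: compact_closed; [exact: disk_hausdorff|exact: cA].
- by move=> c f; rewrite disk_sphere => cf; apply: sphere_extension cY cf.
Qed.

(** * Colourings and Hom complexes *)

Section Colourings.

Lemma colorable_hom (G H : graph) (f : G -> H) s :
  graph_hom f -> colorable H s -> colorable G s.
Proof. by move=> hf [c hc]; exists (c \o f) => u v uv; exact/hc/hf. Qed.

Lemma colorable_leq (G : graph) s s' : (s <= s')%N -> colorable G s -> colorable G s'.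
Proof.
move=> ss' [c hc]; exists (fun v => widen_ord ss' (c v)) => u v uv E.
by apply: (hc u v uv); apply: val_inj; have := congr1 val E.
Qed.

Lemma chi_le (G : graph) s : colorable G s -> (chi G <= (s%:Z)%:E)%E.
Proof.
move=> cG; rewrite /chi; case: pselect => [h|[]]; last first.
  by exists s; exact/asboolP.
by case: ex_minnP => m _ /(_ s) ms; rewrite lee_fin lez_nat ms //; exact/asboolP.
Qed.

Lemma chi_geP (G : graph) s : (1 <= s)%N ->
  ((s%:Z)%:E <= chi G)%E <-> ~ colorable G s.-1.
Proof.
move=> s1; split => [sG cG|nG].
  have := le_trans sG (chi_le cG); rewrite lee_fin lez_nat.
  by case: s s1 {sG cG} => // s _; rewrite ltnn.
rewrite /chi; case: pselect => [h|]; last by rewrite leey.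
case: ex_minnP => m /asboolP cm _; rewrite lee_fin lez_nat leqNgt.
by apply/negP => ms; apply/nG/(colorable_leq _ cm); case: s s1 ms {nG}.
Qed.

Lemma chi_lt (G H : graph) : (chi G < chi H)%E ->
  exists2 s, colorable G s & ~ colorable H s.
Proof.
rewrite {1}/chi; case: pselect => [h|]; last by rewrite ltNge leey.
case: ex_minnP => m /asboolP cm _ mH; exists m => // /chi_le.
by rewrite leNgt mH.
Qed.

End Colourings.

Section HomPosetMaps.
Variables (R : realType) (gT : finGroupType) (T : graph) (to : graph_action gT T).
Variables (G H : graph).

Lemma order_map_simplex (d d' : Order.disp_t) (P : porderType d) (Q : porderType d')
    (phi : P -> Q) : (forall x y, (x <= y)%O -> (phi x <= phi y)%O) ->
  forall s, @order_simplex d P s -> @order_simplex d' Q (phi @` s).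
Proof.
move=> phile s [fs [x sx] cs]; split; first exact: finite_image.
  by exists (phi x); exists x.
by move=> _ _ [y sy <-] [z sz <-]; have [/phile|/phile] := cs y z sy sz; [left|right].
Qed.

Lemma hom_leP (f g : hom_poset T G) : (f <= g)%O <-> forall t, val f t `<=` val g t.
Proof. by split => [/asboolP|fg]; last exact/asboolP. Qed.

Variables (c : G -> H) (hc : graph_hom c).

Lemma hom_image_subproof (f : hom_poset T G) :
  (fun t => c @` val f t) \in @multihom T H.
Proof.
have [f0 fE] := set_valP f; apply/mem_set; split => [t|u v uv _ _ [x fx <-] [y fy <-]].
  by have [x fx] := f0 t; exists (c x); exists x.
exact/hc/(fE u v).
Qed.

Definition hom_image (f : hom_poset T G) : hom_poset T H :=
  exist (fun h : T -> set H => h \in @multihom T H) _ (hom_image_subproof f).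

Lemma hom_image_le f g : (f <= g)%O -> (hom_image f <= hom_image g)%O.
Proof. by move=> /asboolP fg; apply/asboolP => t; apply: image_subset; exact: fg. Qed.

Lemma equivariant_push (K L : gcomplex gT) (phi : K -> L)
    (sphi : forall s, simplex s -> simplex (phi @` s)) :
  (forall g v, phi (gc_act K g v) = gc_act L g (phi v)) ->
  @equivariant gT (realization_gspace R K) (realization_gspace R L) (push sphi).
Proof.
move=> phiM g x; apply: realization_eq => w /=.
rewrite (reindex_fsbigT (gc_act K g)); last first.
  by exists (gc_act K g^-1%g); [exact: gc_actK|exact: gc_actVK].
apply: eq_fsbigr => v _; rewrite gc_actK phiM.
by rewrite (_ : (_ == _) = (phi v == gc_act L g^-1%g w)) //;
  apply/eqP/eqP => [<-|->]; rewrite ?gc_actK ?gc_actVK.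
Qed.

Lemma hom_equivariant_map :
  equivariant_map (realization_gspace R (hom_gcomplex to G))
                  (realization_gspace R (hom_gcomplex to H)).
Proof.
have S := order_map_simplex hom_image_le.
exists (@push R (hom_gcomplex to G) (hom_gcomplex to H) hom_image S).
split; first exact: push_cont.
apply: equivariant_push => g f; apply: val_inj; exact/funext.
Qed.

End HomPosetMaps.

Section EasyImplications.
Variables (R : realType) (gT : finGroupType) (T : graph) (to : graph_action gT T).
Variables (r s : nat) (E : gspace gT).
Hypothesis s1 : (1 <= s)%N.

Lemma statement_ii_iii : statement_ii R to E s -> statement_iii R to E s.
Proof.
move=> ii G [f [cf ef]]; apply/chi_geP => // -[c hc]; apply: ii.
have [h [ch eh]] := @hom_equivariant_map R gT T to _ _ c hc.
exists (h \o f); split; last by move=> g x /=; rewrite ef eh.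
by move=> x; apply: continuous_comp; [exact: cf|exact: ch].
Qed.

Lemma statement_iii_iv : is_E R r E -> statement_iii R to E s -> statement_iv R T r s.
Proof.
move=> [_ [S [Sr _]]] iii G cG; apply: iii.
exact: (gcw_to_connected (S := S) Sr).
Qed.

End EasyImplications.

(** * Subdivisions along integral points *)

Lemma fset_max (T : choiceType) (A : {fset T}) (le : T -> T -> Prop) :
  (forall x y z, le x y -> le y z -> le x z) ->
  (forall x y, x \in A -> y \in A -> le x y \/ le y x) ->
  (exists x, x \in A) -> exists2 m, m \in A & forall x, x \in A -> le x m.
Proof.
move=> trans total [x0 x0A].
have : forall s : seq T, {subset s <= A} -> s != [::] ->
    exists2 m, m \in s & forall x, x \in s -> le x m.
  elim=> // x s IH sA _; have [->|s0] := eqVneq s [::].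
    exists x; rewrite ?mem_head // => y; rewrite inE => /eqP->.
    by have [] := total x x (sA _ (mem_head _ _)) (sA _ (mem_head _ _)).
  have [||m ms mmax] := IH; [by move=> y ys; apply: sA; rewrite inE ys orbT|by []|].
  have mA : m \in A by apply: sA; rewrite inE ms orbT.
  have [xm|mx] := total x m (sA _ (mem_head _ _)) mA.
    exists m; first by rewrite inE ms orbT.
    by move=> y; rewrite inE => /orP[/eqP->//|/mmax].
  exists x; first exact: mem_head.
  move=> y; rewrite inE => /orP[/eqP->|/mmax ym]; last exact: trans ym mx.
  by have [] := total x x (sA _ (mem_head _ _)) (sA _ (mem_head _ _)).
move=> /(_ (enum_fset A)) []; first by [].
  by have : x0 \in enum_fset A by []; case: (enum_fset A).
by move=> m mA mmax; exists m.
Qed.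

Section NatFunctions.
Variable K : choiceType.
Implicit Types n : K -> nat.

Definition nsupp n : set K := [set v | n v != 0%N].

(** The oriented edges of the Freudenthal (or Kuhn) triangulation of the integral lattice: [n'] is
    another corner of the unit cube whose least corner is [n]. *)
Definition near_above (n n' : K -> nat) := forall v, (n v <= n' v <= (n v).+1)%N.

Lemma near_above_max (n n' : K -> nat) : near_above n n' \/ near_above n' n ->
  (forall v, n v <= n' v)%N -> near_above n n'.
Proof. by case=> // nn' le v; rewrite le /=; have /andP[] := nn' v; lia. Qed.

Lemma finite_nat_functions (s : set K) M : finite_set s ->
  finite_set [set n : K -> nat | nsupp n `<=` s /\ forall v, (n v <= M)%N].
Proof.
move=> fs; pose A := fset_set s.
pose f (h : {ffun A -> 'I_M.+1}) v : nat := if insub v is Some u then h u else 0%N.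
apply: (@sub_finite_set _ _ (range f)); last exact: finite_image.
move=> n [ns nM]; exists [ffun u : A => inord (n (val u))] => //.
apply/funext => v; rewrite /f; case: insubP => [u vA uv|vA].
  by rewrite ffunE inordK ?uv // ltnS nM.
by apply/esym/eqP; apply: contraNT vA => nv; rewrite in_fset_set // inE; exact: ns.
Qed.

End NatFunctions.

Section ShiftedFunctions.
Variables (gT : finGroupType) (K : gcomplex gT).

Definition shift g (n : K -> nat) : K -> nat := fun v => n (gc_act K g^-1%g v).

Lemma nsupp_shift g n : nsupp (shift g n) = gc_act K g @` nsupp n.
Proof.
apply/seteqP; split=> [v nv|_ [v nv <-]]; last by rewrite /nsupp /shift /= gc_actK.
by exists (gc_act K g^-1%g v) => //; rewrite gc_actVK.
Qed.

Lemma shift1 n : shift 1%g n = n.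
Proof. by apply/funext => v; rewrite /shift invg1 lact1. Qed.

Lemma shiftM g h n : shift (g * h)%g n = shift g (shift h n).
Proof. by apply/funext => v; rewrite /shift invMg lactM. Qed.

End ShiftedFunctions.

Section GridComplex.
Variables (gT : finGroupType) (K : gcomplex gT) (M : nat).

(* Points of the cone over [K] of sup norm [M] with integral coordinates; [M = 1]
   gives the barycentric subdivision, a vertex being the indicator function of
   a simplex. *)
Definition grid_points : set (K -> nat) := [set n | [/\ simplex (nsupp n),
  forall v, (n v <= M)%N & exists v, n v = M]].

Definition grid_vertex : Type := set_type grid_points.

HB.instance Definition _ := Choice.copy grid_vertex (set_type grid_points).

(** Pairwise nearness is enough: it already makes the set a chain inside one unit cube. *)
Definition grid_simplex : set (set grid_vertex) := [set s | [/\ finite_set s,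
  s !=set0 & forall x y, s x -> s y ->
    near_above (val x) (val y) \/ near_above (val y) (val x)]].

Lemma grid_simplex_finite s : grid_simplex s -> finite_set s.
Proof. by case. Qed.

Lemma grid_simplex_neq0 s : grid_simplex s -> s !=set0.
Proof. by case. Qed.

Lemma grid_simplex_vertex v : grid_simplex [set v].
Proof.
split; [exact: finite_set1|by exists v|].
by move=> x y -> ->; left => w; rewrite leqnn leqnSn.
Qed.

Lemma grid_simplex_face s t :
  grid_simplex s -> t `<=` s -> t !=set0 -> grid_simplex t.
Proof.
move=> [fs _ cs] ts t0; split=> //; first exact: sub_finite_set fs.
by move=> x y /ts sx /ts sy; exact: cs.
Qed.

Definition grid_complex : simplicial_complex := SimplicialComplex
  grid_simplex_finite grid_simplex_neq0 grid_simplex_vertex grid_simplex_face.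

Lemma grid_act_subproof g (n : grid_vertex) : shift g (val n) \in grid_points.
Proof.
have [sn nM [v nv]] := set_valP n; apply/mem_set; split.
- by rewrite nsupp_shift; exact: gc_simplex.
- by move=> w; exact: nM.
- by exists (gc_act K g v); rewrite /shift gc_actK.
Qed.

Definition grid_act g (n : grid_complex) : grid_complex :=
  exist (fun f : K -> nat => f \in grid_points) _ (grid_act_subproof g n).

Lemma grid_act1 n : grid_act 1%g n = n.
Proof. by apply: val_inj; rewrite /= shift1. Qed.

Lemma grid_actM g h n : grid_act (g * h)%g n = grid_act g (grid_act h n).
Proof. by apply: val_inj; rewrite /= shiftM. Qed.

Lemma grid_act_simplex g (s : set grid_complex) :
  simplex s -> simplex (grid_act g @` s).
Proof.
move=> [fs [x sx] cs]; split; first exact: finite_image.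
  by exists (grid_act g x); exists x.
move=> _ _ [y sy <-] [z sz <-]; have [yz|zy] := cs y z sy sz.
  by left => v; exact: yz.
by right => v; exact: zy.
Qed.

Definition grid : gcomplex gT := @GComplex gT grid_complex
  (LeftAction grid_act1 grid_actM) grid_act_simplex.

Lemma grid_chain_max (s : set grid) : simplex s ->
  exists2 m, s m & forall x, s x -> near_above (val x) (val m).
Proof.
move=> [fs [x0 sx0] cs].
have [|||m] := @fset_max _ (fset_set s)
    (fun x y : grid => forall v, (val x v <= val y v)%N).
- by move=> x y z xy yz v; exact: leq_trans (xy v) (yz v).
- move=> x y; rewrite !in_fset_set // !inE => sx sy.
  by have [xy|yx] := cs x y sx sy; [left|right] => v; [have /andP[]:= xy v|have /andP[]:= yx v].
- by exists x0; rewrite in_fset_set ?inE.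
rewrite in_fset_set // inE => sm mmax; exists m => // x sx.
by apply: near_above_max (cs _ _ sx sm) _; apply: mmax; rewrite in_fset_set ?inE.
Qed.

Lemma grid_chain_min (s : set grid) : simplex s ->
  exists2 m, s m & forall x, s x -> near_above (val m) (val x).
Proof.
move=> [fs [x0 sx0] cs].
have [|||m] := @fset_max _ (fset_set s)
    (fun y x : grid => forall v, (val x v <= val y v)%N).
- by move=> x y z yx zy v; exact: leq_trans (zy v) (yx v).
- move=> x y; rewrite !in_fset_set // !inE => sx sy.
  by have [xy|yx] := cs x y sx sy; [right|left] => v; [have /andP[]:= xy v|have /andP[]:= yx v].
- by exists x0; rewrite in_fset_set ?inE.
rewrite in_fset_set // inE => sm mmax; exists m => // x sx.
by apply: near_above_max (cs _ _ sm sx) _; apply: mmax; rewrite in_fset_set ?inE.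
Qed.

End GridComplex.

Lemma weight_point_sum (R : realType) (K : simplicial_complex) (I : finType)
    (Phi : I -> K) (w : I -> R) (c : K -> R) :
  \sum_(v \in [set: K]) weight_point Phi w v * c v =
  (\sum_i w i * c (Phi i)) / \sum_i w i.
Proof.
rewrite (fsbigTE [fset Phi i | i in I]%fset); last first.
  move=> v vA; rewrite /weight_point big_pred0 ?mul0r // => i.
  by apply: contraNF vA => /eqP<-; apply/imfsetP; exists i.
rewrite /weight_point; under eq_bigr do rewrite mulrAC.
rewrite -mulr_suml; congr (_ / _).
under eq_bigr do rewrite mulr_suml.
rewrite (exchange_big_dep predT) //=; apply: eq_bigr => i _.
rewrite -big_filter (_ : [seq _ <- _ | _] = [:: Phi i]) ?big_seq1 //.
rewrite (eq_filter (a2 := pred1 (Phi i))); last by move=> v; rewrite /= eq_sym.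
by rewrite filter_pred1_uniq ?fset_uniq //; apply/imfsetP; exists i.
Qed.

Lemma big_option (R : nmodType) (I : finType) (F : option I -> R) :
  \sum_o F o = F None + \sum_i F (Some i).
Proof.
rewrite (bigD1 None) //=; congr (_ + _).
rewrite (reindex_omap Some id) /=; last by case.
by apply: eq_bigl => i; rewrite eqxx.
Qed.

(* A function with values in [0, 1) is a convex combination of indicator
   functions of a chain of sets: peel off the least positive value. *)
Lemma fractional_layers (R : realType) (K : choiceType) k (W : {fset K}) (phi : K -> R) :
  (#|` W| <= k)%N -> (forall v, 0 <= phi v < 1) ->
  (forall v, phi v != 0 -> v \in W) ->
  exists (I : finType) (w : I -> R) (b : I -> K -> nat),
  [/\ forall i, 0 <= w i, \sum_i w i = 1,
    forall v, \sum_i w i * (b i v)%:R = phi v,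
    forall i v, (b i v <= (phi v != 0)%R)%N &
    forall i j, (forall v, b i v <= b j v)%N \/ (forall v, b j v <= b i v)%N].
Proof.
elim: k W phi => [|k IH] W phi Wk phi01 phiW.
  have phi0 v : phi v = 0.
    apply/eqP; apply: contraTT isT => /phiW vW.
    by move: Wk; rewrite leqn0 cardfs_eq0 => /eqP W0; move: vW; rewrite W0 inE.
  exists unit, (fun=> 1), (fun _ _ => 0%N); split => //.
  - by rewrite big_const card_unit /= addr0.
  - by move=> v; rewrite big1 ?phi0 // => i _; rewrite mulr0.
  - by move=> i j; left.
have [[v0 v0P]|none] := pselect (exists v, phi v != 0); last first.
  apply: (IH fset0) => //; last by move=> v pv; case: none; exists v.
have fA : finite_set [set v | phi v != 0].
  by apply: (@sub_finite_set _ _ [set` W]) => // v; exact: phiW.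
have [|||vm] := @fset_max _ (fset_set [set v | phi v != 0]) (fun x y => phi y <= phi x).
- by move=> x y z xy yz; exact: le_trans yz xy.
- by move=> x y _ _; case: (leP (phi y) (phi x)) => [|/ltW]; [left|right].
- by exists v0; rewrite in_fset_set ?inE.
rewrite in_fset_set // inE /= => vm0 vmin'.
have vmin v : phi v != 0 -> phi vm <= phi v.
  by move=> pv; apply: vmin'; rewrite in_fset_set ?inE.
set m := phi vm in vm0 vmin.
have m01 : 0 < m < 1 by rewrite lt_neqAle eq_sym vm0 phi01.
pose phi' v := (phi v - m * (phi v != 0)%:R) / (1 - m).
have m1 : 0 < 1 - m by lra.
have phi'0 v : phi' v != 0 -> phi v != 0.
  by apply: contra => /eqP pv; rewrite /phi' pv eqxx mulr0 subr0 mul0r.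
have [|v|v pv|I [w [b [w0 w1 wb bphi bchain]]]] := IH (W `\ vm)%fset phi'.
- by have := cardfsD1 vm W; rewrite phiW // => E; move: Wk; rewrite E.
- have /andP[p0 p1] := phi01 v; rewrite /phi'.
  case: (eqVneq (phi v) 0) => [->|pv] /=.
    by rewrite mulr0 subr0 mul0r lexx ltr01.
  rewrite mulr1; apply/andP; split.
    by apply: divr_ge0; [rewrite subr_ge0 vmin|exact: ltW].
  by rewrite ltr_pdivrMr // mul1r ltrD2r.
- rewrite in_fsetD1 phiW ?phi'0 // andbT; apply: contra pv => /eqP->.
  by rewrite /phi' vm0 mulr1 subrr mul0r.
have le01 v : ((phi' v != 0)%R <= (phi v != 0)%R)%N.
  by have := @phi'0 v; case: (phi' v != 0) => // ->.
exists (option I), (fun o => if o is Some i then (1 - m) * w i else m),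
  (fun o v => if o is Some i then b i v else (phi v != 0) : nat); split.
- by move=> [i|]; [rewrite mulr_ge0 // ltW|rewrite ltW //; case/andP: m01].
- by rewrite big_option /= -mulr_sumr w1 mulr1 addrC subrK.
- move=> v; rewrite big_option /=; under eq_bigr do rewrite -mulrA.
  rewrite -mulr_sumr wb /phi' [X in _ + X]mulrC divfK ?(gt_eqF m1) //.
  by rewrite addrC subrK.
- by move=> [i|] v //=; exact: leq_trans (bphi i v) (le01 v).
- move=> [i|] [j|]; last by left.
  + exact: bchain.
  + by left=> v; exact: leq_trans (bphi i v) (le01 v).
  + by right=> v; exact: leq_trans (bphi j v) (le01 v).
Qed.

(** * The grid complex as a subdivision, through radial projection *)

Section GridRealization.
Variables (R : realType) (gT : finGroupType) (K : gcomplex gT) (M : nat).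
Hypothesis M0 : (0 < M)%N.
Local Notation grid := (grid K M).
Implicit Types (x : realization R grid).

Definition grid_point x : K -> R :=
  fun v => \sum_(n \in [set: grid]) val x n * (val n v)%:R.

Definition grid_size (n : grid) : R := \sum_(v \in [set: K]) ((val n v)%:R : R).

(** The coordinate sum of [grid_point x], written as a linear function of the barycentric
    coordinates so that [linear_cont] applies. *)
Definition grid_mass x : R := \sum_(n \in [set: grid]) val x n * grid_size n.

Let supp_fset x : supp x `<=` [set` fset_set (supp x)].
Proof. by rewrite fset_setK //; exact: supp_finite. Qed.

Let in_supp x n : n \in fset_set (supp x) -> supp x n.
Proof. by rewrite in_fset_set; [rewrite inE|exact: supp_finite]. Qed.

Let nat_fsum (n : K -> nat) (V : {fset K}) : nsupp n `<=` [set` V] ->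
  \sum_(v \in [set: K]) ((n v)%:R : R) = \sum_(v <- V) (n v)%:R.
Proof.
move=> nV; apply: fsbigTE => v vV; apply/eqP; rewrite pnatr_eq0.
by apply: contraNT vV => nv; exact: nV.
Qed.

Lemma grid_point_bounds x (n : grid) v : supp x n ->
  (forall m : grid, supp x m -> near_above (val n) (val m)) ->
  (val n v)%:R <= grid_point x v < (val n v).+1%:R.
Proof.
move=> xn nmin; rewrite /grid_point (fsum_support _ (@supp_fset x)).
have S := sum_coord (@supp_fset x).
have xn' : n \in fset_set (supp x) by rewrite in_fset_set ?inE //; exact: supp_finite.
apply/andP; split.
  rewrite -[leLHS]mul1r -[X in X * _ <= _]S mulr_suml big_seq [leRHS]big_seq.
  apply: ler_sum => m /in_supp xm; apply: ler_wpM2l; [exact: coord_ge0|rewrite ler_nat].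
  by have /andP[] := nmin m xm v.
rewrite -[ltRHS]mul1r -[X in _ < X * _]S mulr_suml !(big_fsetD1 n xn') /=.
apply: ltr_leD; first by rewrite ltr_pM2l ?coord_gt0 // ltr_nat.
rewrite big_seq [leRHS]big_seq; apply: ler_sum => m.
rewrite in_fsetD1 => /andP[_ /in_supp xm]; apply: ler_wpM2l; [exact: (coord_ge0 x m)|rewrite ler_nat].
by have /andP[] := nmin m xm v.
Qed.

Lemma grid_point_le x v : grid_point x v <= M%:R.
Proof.
rewrite /grid_point (fsum_support _ (@supp_fset x)).
rewrite -[leRHS]mul1r -[X in _ <= X * _](sum_coord (@supp_fset x)) mulr_suml.
apply: ler_sum => m _; apply: ler_wpM2l; [exact: coord_ge0|rewrite ler_nat].
by have [_ nM _] := set_valP m; exact: nM.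
Qed.

(** Where the least vertex of the support reaches [M], so do all the others. *)
Lemma grid_point_max x : exists v, grid_point x v = M%:R.
Proof.
have [n xn nmin] := grid_chain_min (supp_simplex x).
have [_ _ [v nv]] := set_valP n; exists v; apply/eqP.
have := grid_point_bounds v xn nmin; rewrite nv => /andP[h _].
by rewrite eq_le grid_point_le.
Qed.

Lemma grid_pointE x v : (grid_point x v != 0) =
  `[< exists2 n, supp x n & val n v != 0%N >].
Proof.
rewrite /grid_point (fsum_support _ (@supp_fset x)) psumr_neq0; last first.
  by move=> n _; rewrite mulr_ge0 ?coord_ge0.
apply/hasP/asboolP => [[n /in_supp xn /= h]|[n xn nv]].
  exists n => //; apply: contraTneq h => ->; by rewrite mulr0 ltxx.
exists n; first by rewrite in_fset_set ?inE //; exact: supp_finite.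
by rewrite /= mulr_gt0 ?coord_gt0 // ltr0n lt0n.
Qed.

Lemma grid_point_supp x (n : grid) : supp x n ->
  (forall m : grid, supp x m -> near_above (val m) (val n)) ->
  [set v | grid_point x v != 0] = nsupp (val n).
Proof.
move=> xn nmax; apply/seteqP; split => v /=; rewrite grid_pointE; last first.
  by move=> nv; apply/asboolP; exists n.
move=> /asboolP[m xm mv]; have /andP[h _] := nmax m xm v.
by rewrite /nsupp /= -lt0n (leq_trans _ h) // lt0n.
Qed.

Lemma grid_massE x (V : {fset K}) :
  [set v | grid_point x v != 0] `<=` [set` V] ->
  grid_mass x = \sum_(v <- V) grid_point x v.
Proof.
move=> xV; rewrite /grid_mass /grid_point (fsum_support _ (@supp_fset x)).
under [RHS]eq_bigr do rewrite (fsum_support _ (@supp_fset x)).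
rewrite exchange_big /= big_seq [RHS]big_seq; apply: eq_bigr => n /in_supp xn.
rewrite -mulr_sumr; congr (_ * _); apply: nat_fsum => v nv; apply: xV => /=.
by rewrite grid_pointE; apply/asboolP; exists n.
Qed.

Lemma grid_mass_ge x : M%:R <= grid_mass x.
Proof.
have [v vM] := grid_point_max x.
have [n xn nmax] := grid_chain_max (supp_simplex x).
have [sn _ _] := set_valP n; have fn := simplex_finite sn.
have sE := grid_point_supp xn nmax.
rewrite (@grid_massE x (fset_set (nsupp (val n)))); last by rewrite sE fset_setK.
have vA : v \in fset_set (nsupp (val n)).
  by rewrite in_fset_set // inE -sE /= vM pnatr_eq0 -lt0n.
rewrite (big_fsetD1 v vA) /= vM lerDl sumr_ge0 // => w _.
by apply: fsumr_ge0 => m _; rewrite mulr_ge0 ?coord_ge0.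
Qed.

Lemma grid_mass_gt0 x : 0 < grid_mass x.
Proof. by apply: lt_le_trans (grid_mass_ge x); rewrite ltr0n. Qed.

Lemma grid_down_subproof x :
  (fun v => grid_point x v / grid_mass x) \in @barycentric R K.
Proof.
have [n xn nmax] := grid_chain_max (supp_simplex x).
have [sn _ _] := set_valP n; have fn := simplex_finite sn.
have sE := grid_point_supp xn nmax; have Q := grid_mass_gt0 x.
apply/mem_set; split => [v||].
- rewrite divr_ge0 ?(ltW Q) //.
  by apply: fsumr_ge0 => m _; rewrite mulr_ge0 ?coord_ge0.
- rewrite (_ : mkset _ = nsupp (val n)) // -sE; apply/seteqP.
  by split => v /=; rewrite mulf_eq0 invr_eq0 (gt_eqF Q) orbF.
- rewrite (fsbigTE (fset_set (nsupp (val n)))).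
    by rewrite -mulr_suml -grid_massE ?divff ?gt_eqF // sE fset_setK.
  move=> v vn; rewrite (_ : grid_point x v = 0) ?mul0r //.
  apply/eqP; apply: contraNT vn => h; rewrite in_fset_set // inE -sE; exact: h.
Qed.

(** Radial projection, inside the cone, from sup norm [M] to coordinate sum 1. *)
Definition grid_down x : realization R K :=
  exist (fun f : K -> R => f \in @barycentric R K) _ (grid_down_subproof x).

Lemma grid_downE x v : val (grid_down x) v = grid_point x v / grid_mass x.
Proof. by []. Qed.

Lemma grid_down_supp x (n : grid) : supp x n -> nsupp (val n) `<=` supp (grid_down x).
Proof.
move=> xn v nv; rewrite /supp /= mulf_neq0 ?invr_eq0 ?(gt_eqF (grid_mass_gt0 x)) //.
by rewrite grid_pointE; apply/asboolP; exists n.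
Qed.

Lemma grid_down_cont : continuous grid_down.
Proof.
apply: continuous_simplexwise => s ss.
have [n1 sn1 nmax] := grid_chain_max ss.
have [sn _ _] := set_valP n1; have fn := simplex_finite sn.
apply: (@continuous_finite_support_within _ _ _ _ _ (fset_set (nsupp (val n1)))).
  move=> x sx v; rewrite fset_setK // /supp /= mulf_eq0 invr_eq0 (gt_eqF (grid_mass_gt0 x)) orbF.
  rewrite grid_pointE => /asboolP[n /sx /nmax nn1 nv].
  by have /andP[h _] := nn1 v; rewrite /nsupp /= -lt0n (leq_trans _ h) // lt0n.
move=> v; apply: continuous_subspaceT => x.
have cp : continuous (fun y => grid_point y v) by exact: linear_cont.
have cm : continuous grid_mass by exact: linear_cont.
exact: (cvgM (cp x) (cvgV (lt0r_neq0 (grid_mass_gt0 x)) (cm x))).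
Qed.

(** Write [q] for the common point. Every vertex of either support is the integral part of [q + u]
    for some [u] in [[0, 1)]; hence the two supports lie in one chain, and the members of a chain
    are affinely independent. *)
Lemma grid_point_inj x y : (forall v, grid_point x v = grid_point y v) -> x = y.
Proof.
move=> xy.
have level z (n : grid) : supp z n -> exists2 u : R, 0 <= u < 1 &
    forall v, (val n v)%:R <= grid_point z v + u < (val n v).+1%:R.
  move=> zn; have ss := supp_simplex z.
  have S := sum_coord (@supp_fset z).
  have zn' : n \in fset_set (supp z) by rewrite in_fset_set ?inE //; exact: supp_finite.
  pose below (m : grid) := `[< m <> n /\ near_above (val m) (val n) >].
  have nb : below n = false by apply/asboolP => -[].
  (* The shift is the total weight strictly below [n]: it lifts each of those vertices by one unit,
     to between [n] and [n + 1]. *)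
  exists (\sum_(m <- fset_set (supp z) | below m) val z m) => [|v].
    apply/andP; split; first by apply: sumr_ge0 => m _; exact: coord_ge0.
    rewrite -[ltRHS]S big_mkcond !(big_fsetD1 n zn') /= nb add0r.
    rewrite -[ltLHS]add0r ltr_leD ?coord_gt0 //; apply: ler_sum => m _.
    by case: ifP => _; [exact: lexx|exact: (coord_ge0 z m)].
  rewrite /grid_point (fsum_support _ (@supp_fset z)) [X in _ + X]big_mkcond -big_split /=.
  have Em (m : grid) : val z m * (val m v)%:R + (if below m then val z m else 0) =
      val z m * (val m v + below m)%:R.
    by rewrite natrD mulrDr; case: (below m); rewrite ?mulr1 ?mulr0.
  under eq_bigr do rewrite Em.
  have bm m : supp z m -> (val n v <= val m v + below m <= (val n v).+1)%N.
    move=> zm; rewrite /below; case: asboolP => [[mn mn']|mb].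
      by have := mn' v; lia.
    have [->|mn] := eqVneq m n; first by lia.
    have [_ _ cs] := ss; have [h|h] := cs m n zm zn; last by rewrite addn0; exact: h.
    by case: mb; split => //; apply/eqP.
  apply/andP; split.
    rewrite -[leLHS]mul1r -[X in X * _ <= _]S mulr_suml big_seq [leRHS]big_seq.
    apply: ler_sum => m /in_supp zm; apply: ler_wpM2l; [exact: coord_ge0|rewrite ler_nat].
    by have /andP[] := bm m zm.
  rewrite -[ltRHS]mul1r -[X in _ < X * _]S mulr_suml !(big_fsetD1 n zn') /=.
  apply: ltr_leD.
    rewrite ltr_pM2l ?coord_gt0 // ltr_nat.
    by rewrite nb addn0.
  rewrite big_seq [leRHS]big_seq; apply: ler_sum => m.
  rewrite in_fsetD1 => /andP[_ /in_supp zm]; apply: ler_wpM2l; [exact: (coord_ge0 z m)|rewrite ler_nat].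
  by have /andP[] := bm m zm.
have cross (n n' : grid) (z z' : realization R grid) :
    (forall v, grid_point z v = grid_point z' v) -> supp z n -> supp z' n' ->
    near_above (val n) (val n') \/ near_above (val n') (val n).
  move=> zz' zn zn'; have [u u01 uP] := level _ _ zn; have [u' u'01 uP'] := level _ _ zn'.
  have key (a b : nat) (q t t' : R) : 0 <= t < 1 -> 0 <= t' < 1 -> t <= t' ->
      a%:R <= q + t < a.+1%:R -> b%:R <= q + t' < b.+1%:R -> (a <= b <= a.+1)%N.
    move=> t01 t'01 tt' /andP[a1 a2] /andP[b1 b2].
    rewrite -ltnS -(ltr_nat R) (le_lt_trans a1) ?(le_lt_trans _ b2) ?lerD2l //=.
    rewrite -ltnS -(ltr_nat R) (le_lt_trans b1) // -natr1.
    by move: a2 t01 t'01 tt'; lra.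
  case: (leP u u') => uu; [left|right] => v.
    have H := uP' v; rewrite -zz' in H.
    exact: (key _ _ _ _ _ u01 u'01 uu (uP v) H).
  have H := uP v; rewrite zz' in H.
  exact: (key _ _ _ _ _ u'01 u01 (ltW uu) (uP' v) H).
pose D := (fset_set (supp x) `|` fset_set (supp y))%fset.
have DP n : n \in D -> supp x n \/ supp y n.
  by rewrite in_fsetU => /orP[/in_supp|/in_supp]; [left|right].
have xD : supp x `<=` [set` D].
  move=> n xn; rewrite /= in_fsetU; apply/orP; left; exact: (supp_fset xn).
have yD : supp y `<=` [set` D].
  move=> n yn; rewrite /= in_fsetU; apply/orP; right; exact: (supp_fset yn).
have chain n n' : n \in D -> n' \in D ->
    near_above (val n) (val n') \/ near_above (val n') (val n).
  by move=> /DP[] h /DP[] h'; apply: (cross _ _ _ _ _ h h') => v; rewrite ?xy.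
pose d n := val x n - val y n.
have d1 : \sum_(n <- D) d n = 0.
  by rewrite sumrB !sum_coord // subrr.
have dq v : \sum_(n <- D) d n * (val n v)%:R = 0.
  under eq_bigr do rewrite mulrBl.
  have := xy v; rewrite /grid_point (fsum_support _ xD) (fsum_support _ yD).
  by move=> E; rewrite sumrB E subrr.
apply: realization_eq => n; apply/eqP; rewrite -subr_eq0; apply/negP => /negP dn.
pose D' := [fset m in D | d m != 0]%fset.
have D'P m : (m \in D') = (m \in D) && (d m != 0) by rewrite !inE.
have dD (c : grid -> R) : \sum_(m <- D) d m * c m = \sum_(m <- D') d m * c m.
  apply/esym/big_fset_incl => [|m mD]; first by apply/fsubsetP => m; rewrite D'P => /andP[].
  by rewrite D'P mD /= => /negPn/eqP ->; rewrite mul0r.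
have mul1 (X : {fset grid}) : \sum_(m <- X) d m * 1 = \sum_(m <- X) d m.
  by apply: eq_bigr => m _; rewrite mulr1.
have d1' : \sum_(m <- D') d m = 0.
  rewrite -[RHS]d1.
  by rewrite -(mul1 D') -(mul1 D); apply/esym; exact: (dD (fun=> 1)).
have nD' : n \in D'.
  rewrite D'P dn andbT; apply: contraTT dn => nD.
  have x0 : val x n = 0 by apply: contraNeq nD => h; exact: xD.
  have y0 : val y n = 0 by apply: contraNeq nD => h; exact: yD.
  by rewrite /d x0 y0 subrr eqxx.
pose le (a b : grid) := forall v, (val a v <= val b v)%N.
have le_trans' a b c : le a b -> le b c -> le a c.
  by move=> ab bc v; exact: leq_trans (ab v) (bc v).
have le_total a b : a \in D -> b \in D -> le a b \/ le b a.
  by move=> aD bD; have [h|h] := chain a b aD bD; [left|right] => v; have /andP[] := h v.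
have [|||m] := @fset_max _ D' le.
- exact: le_trans'.
- by move=> a b; rewrite !D'P => /andP[aD _] /andP[bD _]; exact: le_total.
- by exists n.
move=> mD' mmax; have /andP[mD dm] : (m \in D) && (d m != 0) by rewrite -D'P.
have [D''0|/fset0Pn[m0 m0D]] := eqVneq (D' `\ m)%fset fset0.
  have := d1'; rewrite (big_fsetD1 m mD') /= D''0 big_seq_fset0 addr0 => dm0.
  by move: dm; rewrite dm0 eqxx.
have [|||m'] := @fset_max _ (D' `\ m)%fset le.
- exact: le_trans'.
- by move=> a b; rewrite !in_fsetD1 !D'P => /and3P[_ aD _] /and3P[_ bD _]; exact: le_total.
- by exists m0.
move=> m'D m'max; have : (m' != m) && (m' \in D') by rewrite -in_fsetD1.
move=> /andP[m'm m'D'].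
(* [m] and [m'] are the two largest vertices with nonzero coefficient. At a coordinate where they
   differ, all vertices but [m] take the value [val m v - 1], so the two linear relations force
   [d m = 0]. *)
have [v vP] : exists v, (val m' v < val m v)%N.
  apply: contrapT => nv; move: m'm => /negP; apply; apply/eqP/val_inj/funext => v.
  apply/eqP; rewrite eqn_leq mmax //= leqNgt; apply/negP => h; apply: nv.
  by exists v.
have natE : forall p q t : nat, (p <= q)%N -> (q < t)%N ->
    (p <= t <= p.+1)%N \/ (t <= p <= t.+1)%N -> t = p.+1.
  by clear; lia.
have mE a : a \in (D' `\ m)%fset -> (val m v = (val a v).+1)%N.
  move=> aD; apply: (natE _ _ _ (m'max a aD v) vP); move: aD.
  rewrite in_fsetD1 D'P => /and3P[_ aD _].
  by have [h|h] := chain a m aD mD; [left|right]; exact: h.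
have := dq v; rewrite dD (big_fsetD1 m mD') /=.
have := d1'; rewrite (big_fsetD1 m mD') /= => E1.
have -> : \sum_(a <- (D' `\ m)%fset) d a * (val a v)%:R =
    ((val m v)%:R - 1) * \sum_(a <- (D' `\ m)%fset) d a.
  rewrite mulr_sumr big_seq [RHS]big_seq; apply: eq_bigr => a /mE ->.
  by rewrite -natr1 addrK mulrC.
move: E1; set S := \sum_(a <- _) _ => E1 E2; move: dm; apply/negP/negPn/eqP.
by move: E1 E2; rewrite /=; set t := d m; nra.
Qed.

Lemma grid_down_inj : injective grid_down.
Proof.
move=> x y xy; apply: grid_point_inj.
have E v : grid_point x v * grid_mass y = grid_point y v * grid_mass x.
  have := congr1 (fun z => val z v) xy; rewrite !grid_downE => /eqP.
  by rewrite eqr_div ?(lt0r_neq0 (grid_mass_gt0 _)) // => /eqP.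
have M0' : 0 < M%:R :> R by rewrite ltr0n.
(* Compare at a coordinate where [a] reaches its maximum [M]. *)
have le_mass (a b : realization R grid) :
    (forall v, grid_point a v * grid_mass b = grid_point b v * grid_mass a) ->
    grid_mass b <= grid_mass a.
  move=> ab; have [v av] := grid_point_max a; rewrite -(ler_pM2l M0') -av ab.
  by apply: ler_wpM2r; [exact/ltW/grid_mass_gt0|rewrite av grid_point_le].
have EQ : grid_mass x = grid_mass y.
  by apply/eqP; rewrite eq_le !le_mass.
by move=> v; have := E v; rewrite EQ => /mulIf; apply; rewrite gt_eqF ?grid_mass_gt0.
Qed.

Lemma grid_down_surj z : exists x, grid_down x = z.
Proof.
have sz := supp_simplex z; have fz := supp_finite z.
have [|||vm] := @fset_max _ (fset_set (supp z)) (fun a b => val z a <= val z b).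
- by move=> a b c; exact: le_trans.
- by move=> a b _ _; case: (leP (val z a) (val z b)) => [|/ltW]; [left|right].
- by have [v zv] := simplex_neq0 sz; exists v; rewrite in_fset_set ?inE.
rewrite in_fset_set // inE => zvm vmax'; have mx := coord_gt0 zvm.
have vmax v : val z v <= val z vm.
  have [/eqP->|zv] := boolP (val z v == 0); first exact: coord_ge0.
  by apply: vmax'; rewrite in_fset_set ?inE.
(* [q] is the multiple of [z] of sup norm [M]. Its integral part, plus the layers of its fractional
   part, gives the vertices of the preimage. *)
pose c := M%:R / val z vm; have c0 : 0 < c by rewrite divr_gt0 // ltr0n.
pose q v := c * val z v.
have q0 v : 0 <= q v by rewrite mulr_ge0 ?coord_ge0 // ltW.
have qM v : q v <= M%:R.
  by rewrite /q /c mulrAC ler_pdivrMr //; apply: ler_wpM2l; [exact: ler0n|exact: vmax].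
have qvm : q vm = M%:R by rewrite /q /c divfK // gt_eqF.
pose fl v := Num.truncn (q v).
have flP v : (fl v)%:R <= q v < (fl v).+1%:R by exact: truncn_itv.
pose phi v := q v - (fl v)%:R.
have q_nz v : q v != 0 -> supp z v by apply: contra => /eqP zv; rewrite /q zv mulr0.
have fl_nz v : fl v != 0%N -> supp z v.
  move=> fv; apply: q_nz; rewrite gt_eqF //; have /andP[h _] := flP v.
  by apply: lt_le_trans h; rewrite ltr0n lt0n.
have phi_nz v : phi v != 0 -> supp z v.
  move=> pv; apply: q_nz; apply: contra pv => /eqP qv; rewrite /phi.
  have /andP[h _] := flP v; rewrite qv in h *.
  by rewrite sub0r oppr_eq0 eq_le h ler0n.
have phi01 v : 0 <= phi v < 1.
  by have := flP v; rewrite /phi -natr1; lra.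
have [|I [w [b [w0 w1 wb bphi bchain]]]] :=
    @fractional_layers R K _ (fset_set (supp z)) phi (leqnn _) phi01.
  by move=> v /phi_nz zv; rewrite in_fset_set ?inE.
pose n i v := (fl v + b i v)%N.
have flM v : (fl v + (phi v != 0%R) <= M)%N.
  have /andP[h1 h2] := flP v; have := qM v; case: eqP => [_|/eqP pv] /= qv.
    by rewrite addn0 -(ler_nat R) (le_trans h1).
  rewrite addn1 -(ltr_nat R) (lt_le_trans _ qv) // lt_neqAle h1 andbT.
  by apply: contra pv => /eqP E; rewrite /phi -E subrr.
have nP i : n i \in @grid_points gT K M.
  apply/mem_set; split => [|v|].
  - apply: (simplex_face sz) => [v|].
      rewrite /nsupp /= /n addn_eq0 negb_and => /orP[/fl_nz //|bv].
      apply: phi_nz; have := bphi i v; case: eqP => //= _.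
      by move: bv; rewrite -lt0n; lia.
    exists vm; rewrite /nsupp /= /n; have /andP[_ h] := flP vm.
    by move: h; rewrite qvm ltr_nat; lia.
  - by apply: leq_trans (flM v); rewrite /n leq_add2l.
  - exists vm; have /andP[h1 h2] := flP vm.
    have fM : fl vm = M.
      by apply/eqP; rewrite eqn_leq -(ler_nat R) -qvm h1 -ltnS -(ltr_nat R) -qvm.
    have := bphi i vm; rewrite /n {1}/phi qvm fM subrr eqxx /=; lia.
pose N i : grid := exist (fun f : K -> nat => f \in @grid_points gT K M) _ (nP i).
have sw : simplex [set v | exists2 i, 0 < w i & N i = v].
  split.
  - apply: (@sub_finite_set _ _ (range N)); last exact: finite_image.
    by move=> v [i _ <-]; exists i.
  - have : \sum_i w i != 0 by rewrite w1 oner_neq0.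
    by rewrite psumr_neq0 // => /hasP[i _ wi]; exists (N i), i.
  - move=> _ _ [i _ <-] [j _ <-].
    have bb (i' : I) v : (b i' v <= 1)%N by apply: leq_trans (bphi i' v) _; case: (_ != _).
    have [h|h] := bchain i j; [left|right] => v; rewrite /= /n;
      have := h v; have := bb i v; have := bb j v; lia.
pose x : realization R grid := exist (fun f : grid -> R => f \in barycentric (K := grid)) _
  (mem_set (weight_barycentric w0 sw)).
have xq v : grid_point x v = q v.
  rewrite /grid_point (weight_point_sum N w (fun m : grid => (val m v)%:R)) w1 divr1.
  under eq_bigr do rewrite /= /n natrD mulrDr.
  by rewrite big_split /= -mulr_suml w1 mul1r wb /phi addrC subrK.
exists x; apply: realization_eq => v; rewrite grid_downE xq /q.
suff -> : grid_mass x = c by rewrite mulrAC divff ?mul1r // gt_eqF.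
have zV : supp z `<=` [set` fset_set (supp z)] by rewrite fset_setK.
rewrite (@grid_massE x (fset_set (supp z))).
  by under eq_bigr do rewrite xq; rewrite -mulr_sumr (sum_coord zV) mulr1.
by move=> u; rewrite /= xq => /q_nz; exact: zV.
Qed.

Lemma grid_down_equivariant :
  @equivariant gT (realization_gspace R grid) (realization_gspace R K) grid_down.
Proof.
move=> g x; apply: realization_eq => v.
have pE w : grid_point (realize_act g x) w = grid_point x (gc_act K g^-1%g w).
  rewrite /grid_point (reindex_fsbigT (gc_act grid g)); last first.
    by exists (gc_act grid g^-1%g); [exact: gc_actK|exact: gc_actVK].
  apply: eq_fsbigr => n _; have E := congr1 (val x) (gc_actK (K := grid) g n).
  exact: (congr1 (fun t : R => t * (val n (gc_act K g^-1%g w))%:R) E).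
suff mE : grid_mass (realize_act g x) = grid_mass x.
  by rewrite /= -/(grid_point _ _) pE mE.
rewrite /grid_mass (reindex_fsbigT (gc_act grid g)); last first.
  by exists (gc_act grid g^-1%g); [exact: gc_actK|exact: gc_actVK].
apply: eq_fsbigr => n _; have E := congr1 (val x) (gc_actK (K := grid) g n).
rewrite (_ : grid_size (gc_act grid g n) = grid_size n).
  exact: (congr1 (fun t : R => t * grid_size n) E).
rewrite /grid_size (reindex_fsbigT (gc_act K g)); last first.
  by exists (gc_act K g^-1%g); [exact: gc_actK|exact: gc_actVK].
by apply: eq_fsbigr => u _; rewrite /= /shift gc_actK.
Qed.

(** Only finitely many grid vertices are supported in a given simplex, which is what
    [inverse_continuous] asks for. *)
Lemma grid_homeomorphism : exists h : realization R K -> realization R grid,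
  [/\ continuous h, cancel grid_down h & cancel h grid_down].
Proof.
have /choice[h hK] := grid_down_surj.
have dK : cancel grid_down h by move=> x; apply: grid_down_inj; rewrite hK.
exists h; split => //; apply: (inverse_continuous grid_down_cont) => // s ss.
have fA : finite_set [set n : grid | nsupp (val n) `<=` s].
  have F := finite_nat_functions M (simplex_finite ss).
  have inj : {in [set n : grid | nsupp (val n) `<=` s] &, injective val}.
    by move=> a b _ _; exact: val_inj.
  rewrite -(eq_finite_set (inj_card_eq inj)).
  apply: sub_finite_set F => _ [n ns <-]; split => // v.
  by have [_ nM _] := set_valP n; exact: nM.
exists (fset_set [set n : grid | nsupp (val n) `<=` s]) => x xs n xn.
rewrite fset_setK // => v nv; apply: xs; exact: grid_down_supp xn _ nv.
Qed.

Lemma grid_triangulates (E : gspace gT) :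
  triangulates R K E -> triangulates R grid E.
Proof.
move=> [f [h [cf ch fK hK ef]]]; have [h' [ch' dK h'K]] := grid_homeomorphism.
exists (f \o grid_down), (h' \o h); split.
- by move=> x; apply: continuous_comp; [exact: grid_down_cont|exact: cf].
- by move=> x; apply: continuous_comp; [exact: ch|exact: ch'].
- by move=> x /=; rewrite fK dK.
- by move=> x /=; rewrite h'K hK.
- by move=> g x /=; rewrite grid_down_equivariant ef.
Qed.

End GridRealization.

(** * Contiguous maps *)

Lemma within_comp_maps (X Y Z : topologicalType) (A : set X) (D : set Y)
    (phi : X -> Y) (h : Y -> Z) :
  {within A, continuous phi} -> (forall x, A x -> D (phi x)) ->
  {within D, continuous h} -> {within A, continuous (h \o phi)}.
Proof.
move=> /subspace_continuousP cphi AD /subspace_continuousP ch.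
apply/subspace_continuousP => x Ax W nW.
have := ch _ (AD _ Ax) W nW => /(cphi _ Ax).
rewrite /nbhs /= /within /=; apply: filterS => y H Ay.
by apply: H => //; exact: AD.
Qed.

Section HomotopyExtension.
Variables (R : realType) (n : nat) (Y : topologicalType).

Definition extends_to_disk (f : 'rV[R]_n -> Y) :=
  exists2 h : 'rV[R]_n -> Y, {within disk R n, continuous h} &
    {in sphere R n, h =1 f}.

Definition cylinder : set ('rV[R]_n * R) :=
  [set z | sphere R n z.1 /\ 0 <= z.2 <= 1].

Let nrm (x : 'rV[R]_n) := Num.sqrt (sqnorm x).

Let nrm_cont : continuous nrm.
Proof.
by move=> x; apply: continuous_comp; [exact: sqnorm_cont|exact: sqrt_continuous].
Qed.

Let sqnormZ (a : R) (x : 'rV[R]_n) : sqnorm (a *: x) = a ^+ 2 * sqnorm x.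
Proof.
by rewrite /sqnorm mulr_sumr; apply: eq_bigr => i _; rewrite mxE exprMn.
Qed.

Let nrm2 x : nrm x ^+ 2 = sqnorm x.
Proof. by rewrite sqr_sqrtr // sqnorm_ge0. Qed.

Let diskE x : disk R n x = (nrm x <= 1).
Proof.
rewrite /disk /mkset -nrm2 -[1 in LHS](expr1n _ 2) ler_pXn2r ?nnegrE //.
by rewrite sqrtr_ge0.
Qed.

(** The extension at time 1 is shrunk to the disk of radius 1/2, and the shell around it carries the
    homotopy, time running from 1 down to 0 outwards. *)
Lemma homotopy_extension (H : 'rV[R]_n * R -> Y) :
  {within cylinder, continuous H} ->
  extends_to_disk (fun x => H (x, 1)) -> extends_to_disk (fun x => H (x, 0)).
Proof.
move=> cH [h ch hH].
pose phi (x : 'rV[R]_n) := ((nrm x)^-1 *: x, 2 - 2 * nrm x).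
pose A := [set x : 'rV[R]_n | nrm x <= 2^-1].
pose B := [set x : 'rV[R]_n | 2^-1 <= nrm x <= 1].
pose F x := if nrm x <= 2^-1 then h (2 *: x) else H (phi x).
have cA : closed A.
  have -> : A = nrm @^-1` [set t | t <= 2^-1] by [].
  by apply: preimage_closed => [x _|]; [exact: nrm_cont|exact: closed_le].
have cB : closed B.
  have -> : B = nrm @^-1` [set t | 2^-1 <= t] `&` nrm @^-1` [set t | t <= 1].
    by apply/seteqP; split => x /=; rewrite /B /mkset; [move=> /andP[]|move=> [-> ->]].
  by apply: closedI; apply: preimage_closed => [x _|];
    [exact: nrm_cont|exact: closed_ge|exact: nrm_cont|exact: closed_le].
have phiB x : B x -> cylinder (phi x).
  move=> /andP[x1 x2]; have x0 : 0 < nrm x by apply: lt_le_trans x1; rewrite invr_gt0.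
  split; last by rewrite /=; lra.
  by rewrite /phi /sphere /= sqnormZ -nrm2 exprVn mulVf // sqrf_eq0 gt_eqF.
have cFA : {within A, continuous F}.
  apply: (@subspace_eq_continuous _ _ _ (h \o (fun x => 2 *: x))).
    move=> x /set_mem xA; change (h (2 *: x) = F x).
    by rewrite /F ifT.
  apply: within_comp_maps ch; last first.
    move=> x xA; rewrite /disk /= sqnormZ -nrm2.
    have := sqrtr_ge0 (sqnorm x); rewrite -/(nrm x) => x0.
    by move: xA; rewrite /A /=; nra.
  apply: continuous_subspaceT => x; exact: scaler_continuous.
have cFB : {within B, continuous F}.
  apply: (@subspace_eq_continuous _ _ _ (H \o phi)).
    move=> x /set_mem /andP[x1 x2]; change (H (phi x) = F x).
    rewrite /F; case: ifP => // x3.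
    have xE : nrm x = 2^-1 by apply/eqP; rewrite eq_le x3.
    rewrite hH; last first.
      by apply/mem_set; rewrite /sphere /= sqnormZ -nrm2 xE; field.
    have -> : phi x = (2 *: x, 1).
      by rewrite /phi xE invrK mulfV ?pnatr_eq0 //; congr (_, _); ring.
    by [].
  apply: within_comp_maps cH; last exact: phiB.
  apply/subspace_continuousP => x /andP[x1 _].
  have x0 : nrm x != 0 by rewrite gt_eqF // (lt_le_trans _ x1) // invr_gt0.
  have c0 : nrm y @[y --> x] --> nrm x by exact: nrm_cont.
  have c1 : (nrm y)^-1 *: y @[y --> x] --> (nrm x)^-1 *: x.
    have c3 : (nrm y)^-1 @[y --> x] --> (nrm x)^-1 by exact: (cvgV x0 c0).
    have c4 : y @[y --> x] --> x by exact: cvg_id.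
    exact: (cvgZ c3 c4).
  have c2 : 2 - 2 * nrm y @[y --> x] --> 2 - 2 * nrm x.
    exact: (cvgB (cvg_cst _) (cvgM (cvg_cst _) c0)).
  have cphi : phi @ x --> phi x by exact: (cvg_pair c1 c2).
  exact: cvg_within_filter cphi.
exists F.
  have -> : disk R n = A `|` B.
    apply/seteqP; split => x; rewrite diskE /A /B /=.
      by move=> x1; case: (leP (nrm x) 2^-1) => [|/ltW->]; [left|right].
    by case=> [x1|/andP[]//]; apply: le_trans x1 _; lra.
  exact: withinU_continuous.
move=> x /set_mem; rewrite /sphere /= => xS.
have x1 : nrm x = 1 by rewrite /nrm xS sqrtr1.
rewrite /F x1 (_ : 1 <= 2^-1 = false); last by apply/negbTE; rewrite -ltNge; lra.
by rewrite /phi x1 invr1 scale1r mulr1 subrr.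
Qed.

End HomotopyExtension.

Section Contiguity.
Variables (R : realType) (n : nat) (K : simplicial_complex).
Local Notation Y := (realization R K).
Variables f g : 'rV[R]_n -> Y.
Hypothesis cf : {within sphere R n, continuous f}.
Hypothesis cg : {within sphere R n, continuous g}.
Hypothesis sfg : forall x, sphere R n x -> simplex (supp (f x) `|` supp (g x)).

(** The straight-line homotopy from [f] to [g] stays in the common simplices; compactness of the
    sphere confines it to finitely many vertices, where continuity is coordinatewise. *)
Lemma contiguous_extension : extends_to_disk g -> extends_to_disk f.
Proof.
have [Af AfP] := compact_finite_support (continuous_compact cf (@sphere_compact R n)).
have [Ag AgP] := compact_finite_support (continuous_compact cg (@sphere_compact R n)).
pose A := (Af `|` Ag)%fset.
have fA x : sphere R n x -> supp (f x) `<=` [set` A].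
  move=> Sx v vf; rewrite /= in_fsetU; apply/orP; left.
  by apply: (AfP (f x)) => //; exists x.
have gA x : sphere R n x -> supp (g x) `<=` [set` A].
  move=> Sx v vg; rewrite /= in_fsetU; apply/orP; right.
  by apply: (AgP (g x)) => //; exists x.
pose q (z : 'rV[R]_n * R) v : R := (1 - z.2) * val (f z.1) v + z.2 * val (g z.1) v.
have q_nz z v : q z v != 0 -> supp (f z.1) v \/ supp (g z.1) v.
  move=> qz; have [fz|fz] := eqVneq (val (f z.1) v) 0; last by left.
  have [gz|gz] := eqVneq (val (g z.1) v) 0; last by right.
  by move: qz; rewrite /q fz gz !mulr0 addr0 eqxx.
have qb z : cylinder z -> barycentric (q z).
  move=> [Sz /andP[z0 z1]].
  have E : \sum_(v \in [set: K]) q z v = 1.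
    rewrite (fsbigTE A) => [|v vA]; last first.
      apply/eqP; apply: contraNT vA => /q_nz[]; [exact: fA|exact: gA].
    by rewrite big_split /= -!mulr_sumr !sum_coord; [ring|exact: gA|exact: fA].
  split => //.
    by move=> v; rewrite addr_ge0 // mulr_ge0 ?coord_ge0 // subr_ge0.
  apply: (simplex_face (sfg Sz)); first by move=> v /q_nz.
  have : \sum_(v \in [set: K]) q z v != 0 by rewrite E oner_neq0.
  by move=> /(@fsbigN1 R 0 _ unit K setT (fun=> q z) tt) [v _]; exists v.
pose H z : Y := if pselect (barycentric (q z)) is left h
  then exist (fun u : K -> R => u \in @barycentric R K) _ (mem_set h) else f z.1.
have HE z v : cylinder z -> val (H z) v = q z v.
  by move=> /qb qz; rewrite /H; case: pselect.
have cH : {within @cylinder R n, continuous H}.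
  apply: (@continuous_finite_support_within _ _ _ _ _ A) => [z Cz v|v].
    by rewrite /supp /= HE // => /q_nz[]; [apply: fA|apply: gA]; case: Cz.
  apply: (@subspace_eq_continuous _ _ _ (fun z => q z v)).
    by move=> z /set_mem Cz; apply/esym; exact: HE.
  have c1 (u : 'rV[R]_n -> Y) : {within sphere R n, continuous u} ->
      {within @cylinder R n, continuous (fun z => val (u z.1) v : R)}.
    move=> cu; apply: (@within_comp_maps _ _ _ _ (sphere R n) fst (fun x => val (u x) v : R)).
    - by apply: continuous_subspaceT => z; exact: cvg_fst.
    - by move=> z [].
    - exact: (@within_comp _ _ _ _ u (fun y => val y v : R) cu (@coord_cont R K v)).
  have c2 : {within @cylinder R n, continuous (fun z : 'rV[R]_n * R => z.2)}.
    by apply: continuous_subspaceT => z; exact: cvg_snd.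
  move=> z; apply: cvgD; apply: cvgM.
  - by apply: cvgB; [exact: cvg_cst|exact: c2].
  - exact: (c1 f cf z).
  - exact: c2.
  - exact: (c1 g cg z).
have H0 x : sphere R n x -> H (x, 0) = f x.
  move=> Sx; apply: realization_eq => v; rewrite HE; last by split; rewrite //= lexx ler01.
  by rewrite /q /= subr0 mul1r mul0r addr0.
have H1 x : sphere R n x -> H (x, 1) = g x.
  move=> Sx; apply: realization_eq => v; rewrite HE; last by split; rewrite //= lexx ler01.
  by rewrite /q /= subrr mul1r mul0r add0r.
move=> [h ch hg]; have [|h' ch' hf] := homotopy_extension cH.
  by exists h => // x xS; rewrite hg // H1 //; exact/set_mem.
by exists h' => // x xS; rewrite hf // H0 //; exact/set_mem.
Qed.

End Contiguity.

Lemma vertex_point (R : realType) (K : simplicial_complex) (v : K) :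
  exists x : realization R K, supp x = [set v].
Proof.
have sw : simplex [set u | exists2 i : unit, 0 < (1 : R) & v = u].
  rewrite (_ : mkset _ = [set v]); first exact: simplex_vertex.
  by apply/seteqP; split => u /=; [case|move=> ->; exists tt].
pose w (_ : unit) : R := 1; have w0 i : 0 <= w i by exact: ler01.
exists (exist (fun f : K -> R => f \in @barycentric R K) _
  (mem_set (weight_barycentric (Phi := fun=> v) w0 sw))).
apply/seteqP; split => u; rewrite /supp /= (weight_point_neq0 w0 sw).
  by move=> /asboolP[].
by move=> ->; apply/asboolP; exists tt => //; exact: ltr01.
Qed.

(* Weights nonzero exactly on the sets [B] of indices whose values all exceed
   all the values outside [B]; such sets form a chain. *)
Section UnionMap.
Variables (R : realType) (X : topologicalType) (D : set X) (J : finType).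
Variables (T G : graph) (U : J -> T -> set G) (rho : J -> X -> R).
Hypothesis rho_ge0 : forall j x, D x -> 0 <= rho j x.
Hypothesis rho_cont : forall j, {within D, continuous rho j}.
Hypothesis rho_pos : forall x, D x -> exists j, 0 < rho j x.
Hypothesis U_neq0 : forall x j t, D x -> 0 < rho j x -> U j t !=set0.
Hypothesis U_adj : forall x j j', D x -> 0 < rho j x -> 0 < rho j' x ->
  forall u v, adj u v -> forall a b, U j u a -> U j' v b -> adj a b.

Let UB (B : {set J}) t : set G := \bigcup_(j in [set` B]) U j t.

(** The Boolean factor is there for the empty set, for which both products are empty and equal to
    1. *)
Let weight (B : {set J}) x : R := (B != finset.set0)%:R *
  ((\prod_(j in B) rho j x) *
   \prod_(p : J * J | (p.1 \in B) && (p.2 \notin B)) Num.max (rho p.1 x - rho p.2 x) 0).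

Definition upper_level (B : {set J}) x := [/\ B != finset.set0,
  forall j, j \in B -> 0 < rho j x &
  forall j l, j \in B -> l \notin B -> rho l x < rho j x].

Let weight_ge0 B x : D x -> 0 <= weight B x.
Proof.
move=> Dx; rewrite mulr_ge0 ?ler0n // mulr_ge0 //.
  by apply: prodr_ge0 => j _; exact: rho_ge0.
by apply: prodr_ge0 => p _; rewrite le_max lexx orbT.
Qed.

Let weight_gt0 B x : D x -> (0 < weight B x) <-> upper_level B x.
Proof.
move=> Dx; split.
  rewrite lt0r weight_ge0 // andbT !mulf_eq0 !negb_or pnatr_eq0 eqb0 negbK.
  move=> /and3P[B0 /prodf_neq0 p1 /prodf_neq0 p2]; split => // [j jB|j l jB lB].
    by rewrite lt0r rho_ge0 // p1.
  have := p2 (j, l); rewrite /= jB lB /= => /(_ isT).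
  by rewrite maxEle subr_le0; case: (leP (rho j x) (rho l x)) => //; rewrite eqxx.
move=> [B0 p1 p2]; rewrite /weight B0 mul1r mulr_gt0 //.
  by apply: prodr_gt0 => j; exact: p1.
apply: prodr_gt0 => p /andP[pB pnB].
by rewrite lt_max subr_gt0 p2.
Qed.

Let weight_cont B : {within D, continuous weight B}.
Proof.
have c1 : {within D, continuous (fun x => \prod_(j in B) rho j x)}.
  by apply: (@continuous_prodr R (subspace D)) => j _; exact: rho_cont.
have c2 : {within D, continuous (fun x =>
    \prod_(p : J * J | (p.1 \in B) && (p.2 \notin B)) Num.max (rho p.1 x - rho p.2 x) 0)}.
  apply: (@continuous_prodr R (subspace D)) => p _ x.
  apply: (@continuous_max R (subspace D) (fun x => rho p.1 x - rho p.2 x) (fun=> 0)).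
    by apply: cvgB; exact: rho_cont.
  exact: cvg_cst.
by move=> x; apply: cvgM; [exact: cvg_cst|apply: cvgM; [exact: c1|exact: c2]].
Qed.

Lemma upper_level_chain B B' x : upper_level B x -> upper_level B' x ->
  B \subset B' \/ B' \subset B.
Proof.
move=> [_ _ lB] [_ _ lB']; case: (boolP (B \subset B')) => [|/subsetPn[j jB jB']]; first by left.
right; apply/fintype.subsetP => l lB''; apply/negPn/negP => lnB.
by have := lt_trans (lB _ _ jB lnB) (lB' _ _ lB'' jB'); rewrite ltxx.
Qed.

(** Gluing for Hom complexes: local multihomomorphisms [U j], mutually compatible wherever their
    weights are positive together, are combined into their unions over upper levels, which are
    nested and so form a simplex. *)
Lemma union_map (x0 : realization R (hom_complex T G)) :
  exists F : X -> realization R (hom_complex T G), {within D, continuous F} /\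
    forall x, D x -> forall S, supp (F x) S ->
      exists2 B : {set J}, upper_level B x &
        forall t, val S t = \bigcup_(j in [set` B]) U j t.
Proof.
have [S0 _] := simplex_neq0 (supp_simplex x0).
pose Phi (B : {set J}) : hom_complex T G :=
  if pselect (multihom (UB B)) is left h
  then exist (fun f : T -> set G => f \in @multihom T G) _ (mem_set h) else S0.
have UBm B x : D x -> upper_level B x -> multihom (UB B).
  move=> Dx [/set0Pn[j jB] p1 _]; split => [t|u v uv a b [i iB Ua] [l lB Ub]].
    by have [a Ua] := U_neq0 t Dx (p1 _ jB); exists a, j.
  exact: (U_adj Dx (p1 _ iB) (p1 _ lB) uv).
have PhiE B x : D x -> upper_level B x -> val (Phi B) = UB B.
  by move=> Dx /(UBm _ _ Dx) h; rewrite /Phi; case: pselect.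
have sw x : D x -> simplex [set v | exists2 B, 0 < weight B x & Phi B = v].
  move=> Dx; split.
  - apply: (@sub_finite_set _ _ (range Phi)); last exact: finite_image.
    by move=> v [B _ <-]; exists B.
  - pose P := finset.finset (fun j => 0 < rho j x).
    exists (Phi P), P => //.
    apply/weight_gt0 => //; split.
    + by have [j pj] := rho_pos Dx; apply/set0Pn; exists j; rewrite finset.in_set.
    + by move=> j; rewrite finset.in_set.
    + move=> j l; rewrite !finset.in_set -leNgt => pj pl; exact: le_lt_trans pj.
  - move=> _ _ [B /weight_gt0-/(_ Dx) uB <-] [B' /weight_gt0-/(_ Dx) uB' <-].
    by case: (upper_level_chain uB uB') => /fintype.subsetP BB; [left|right];
      apply/hom_leP => t; rewrite (PhiE _ _ Dx uB) (PhiE _ _ Dx uB') => a [j jB Ua];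
      exists j => //; exact: BB.
have [F [cF FE]] := weight_map x0 (fun B x => @weight_ge0 B x) sw weight_cont.
exists F; split => // x Dx S.
move=> /(weight_map_supp _ (fun B => weight_ge0 B Dx) (sw x Dx) (FE x Dx)).
by move=> [B /weight_gt0-/(_ Dx) uB <-]; exists B => // t; rewrite (PhiE _ _ Dx uB).
Qed.

End UnionMap.

(** * Connectivity of the Hom complex of a cone *)

Lemma pair_cst_cont (X Y : topologicalType) (s : Y) : continuous (fun x : X => (x, s)).
Proof.
move=> x; have a1 : (fun y : X => y) @ x --> x by exact: cvg_id.
have a2 : (fun _ : X => s) @ x --> s by exact: cvg_cst.
exact: (cvg_pair a1 a2).
Qed.

(** * Rounding real points to lattice points by tent functions *)

Section Tent.
Variable R : realType.

Definition tent (s : R) : R := Num.max (1 - `|s|) 0.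

Lemma tent_ge0 s : 0 <= tent s.
Proof. by rewrite /tent le_max lexx orbT. Qed.

Lemma tent_gt0 s : (0 < tent s) = (`|s| < 1).
Proof. by rewrite /tent lt_max ltxx orbF subr_gt0. Qed.

Lemma tent_cont (X : topologicalType) (D : set X) (u : X -> R) :
  {within D, continuous u} -> {within D, continuous (fun x => tent (u x))}.
Proof.
move=> cu x.
apply: (@continuous_max R (subspace D) (fun x => 1 - `|u x|) (fun=> 0)).
  by apply: cvgB; [exact: cvg_cst|apply: cvg_norm; exact: cu].
exact: cvg_cst.
Qed.

Lemma nat_near (a b : nat) (q : R) : `|a%:R - q| < 1 -> `|b%:R - q| < 1 ->
  (a <= b.+1)%N.
Proof.
rewrite !ltr_norml => /andP[a1 a2] /andP[b1 b2].
by rewrite -ltnS -(ltr_nat R) -!natr1; lra.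
Qed.

Lemma nat_near0 (a : nat) : `|a%:R - 0 : R| < 1 -> a = 0%N.
Proof. by rewrite subr0 ger0_norm ?ler0n // (ltr_nat R a 1) ltnS leqn0 => /eqP. Qed.

Lemma trunc_near (q : R) : 0 <= q -> `|(Num.truncn q)%:R - q| < 1.
Proof.
move=> /truncn_itv /andP[q1 q2]; rewrite ltr_norml.
by move: q2; rewrite -natr1; lra.
Qed.

Section Box.
Variables (K : choiceType) (V : {fset K}) (M : nat).
Local Notation box := {ffun V -> 'I_M.+1}.

Definition box_fun (y : box) (v : K) : nat := if insub v is Some u then y u else 0%N.

(** Spreads a real point over the lattice points less than one unit away in each coordinate; any two
    of these differ by at most one in each coordinate. *)
Definition box_weight (y : box) (q : K -> R) : R :=
  \prod_(v : V) tent ((y v)%:R - q (val v)).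

Lemma box_weight_ge0 y q : 0 <= box_weight y q.
Proof. by apply: prodr_ge0 => v _; exact: tent_ge0. Qed.

Lemma box_weight_near y q v : 0 < box_weight y q ->
  (forall u, u \notin V -> q u = 0) -> `|(box_fun y v)%:R - q v| < 1.
Proof.
move=> yq q0; rewrite /box_fun; case: insubP => [u uV <-|vV]; last first.
  by rewrite (q0 v vV) subrr normr0 ltr01.
rewrite -tent_gt0 lt_neqAle tent_ge0 andbT eq_sym.
by have /prodf_neq0/(_ u isT) : box_weight y q != 0 by rewrite gt_eqF.
Qed.

Lemma box_weight_ex q : (forall v, 0 <= q v <= M%:R) -> exists y, 0 < box_weight y q.
Proof.
move=> qM; exists [ffun v : V => inord (Num.truncn (q (val v)))].
apply: prodr_gt0 => v _; have /andP[q0 q1] := qM (val v).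
rewrite ffunE inordK ?tent_gt0 ?trunc_near // ltnS -(ler_nat R).
by apply: le_trans q1; have /andP[] := truncn_itv q0.
Qed.

Lemma box_weight_cont (X : topologicalType) (D : set X) y (q : X -> K -> R) :
  (forall v, {within D, continuous (q^~ v)}) ->
  {within D, continuous (fun x => box_weight y (q x))}.
Proof.
move=> cq; apply: (@continuous_prodr R (subspace D)) => v _.
by apply: tent_cont => x; apply: cvgB; [exact: cvg_cst|exact: cq].
Qed.

End Box.
End Tent.

Section ConeGraph.
Variables (K : simplicial_complex) (m : nat).

Definition cone_points : set (K -> nat) :=
  [set n | simplex (nsupp n) /\ exists v, (m <= n v)%N].

Definition cone_vertex : Type := set_type cone_points.

Definition cone_adj (x y : cone_vertex) :=
  forall v, (val x v <= (val y v).+1)%N /\ (val y v <= (val x v).+1)%N.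

Lemma cone_adj_sym x y : cone_adj x y -> cone_adj y x.
Proof. by move=> xy v; have [? ?] := xy v. Qed.

(* The integral points of norm at least [m] of the cone over [K]; unlike a
   one-skeleton, all its sufficiently small balls are contractible. *)
Definition cone_graph := Graph cone_adj_sym.

Lemma cone_vertex_ex (n : K -> nat) (s : set K) : (0 < m)%N -> simplex s ->
  nsupp n `<=` s -> (exists v, (m <= n v)%N) -> exists z : cone_graph, val z = n.
Proof.
move=> m0 ss ns [v vm].
have nP : n \in cone_points.
  apply/mem_set; split; last by exists v.
  apply: (simplex_face ss ns); exists v; rewrite /nsupp /= -lt0n.
  exact: leq_trans vm.
by exists (exist (fun f : K -> nat => f \in cone_points) _ nP).
Qed.

End ConeGraph.

(** * Multihomomorphisms into the cone graph, deformed to points of the complex *)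

Section ConeHom.
Variables (R : realType) (K : simplicial_complex) (m : nat) (T : graph) (t0 : T).
Local Notation Z := (cone_graph K m).
Local Notation P := (hom_poset T Z).
Hypothesis m0 : (0 < m)%N.
Hypothesis small : forall (S : P) t (x y : Z), val S t x -> val S t0 y ->
  forall v, (val x v < val y v + m)%N /\ (val y v < val x v + m)%N.

Lemma hom_adj (S S' : P) u v (x x' : Z) : (S <= S')%O \/ (S' <= S)%O -> adj u v ->
  val S u x -> val S' v x' -> adj x x'.
Proof.
move=> SS' uv; have [_ SE] := set_valP S; have [_ SE'] := set_valP S'.
case: SS' => /hom_leP le Sx Sx'; first exact: (SE' u v uv x x' (le _ _ Sx)).
exact: (SE u v uv x x' Sx (le _ _ Sx')).
Qed.

(** The apex of [S'] is a coordinate at which some point of [S' t0] is at least [m]; by [small], no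
    point belonging to a comparable multihomomorphism can vanish there. *)
Lemma apex_exists : exists apex : P -> K, forall S S' : P,
  (S <= S')%O \/ (S' <= S)%O -> forall t (x : Z), val S t x -> (0 < val x (apex S'))%N.
Proof.
have /choice[c cP] (S : P) : exists v, exists2 y : Z, val S t0 y & (m <= val y v)%N.
  have [/(_ t0)[y Sy] _] := set_valP S; have [_ [v yv]] := set_valP y.
  by exists v, y.
exists c => S S' SS' t x Sx; have [y Sy yv] := cP S'.
have [S2 S2x S2y] : exists2 S2 : P, val S2 t x & val S2 t0 y.
  case: SS' => /hom_leP le; first by exists S' => //; exact: le.
  by exists S => //; exact: le.
by have [_ h] := small S2x S2y (c S'); rewrite -(ltn_add2r m) (leq_ltn_trans yv).
Qed.

(** The sets [val S t] may be infinite, but all their points are within [m] of a single finitely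
    supported one. *)
Lemma multihom_bound (S : P) : exists C, forall t (x : Z), val S t x ->
  forall v, (val x v <= C)%N.
Proof.
have [/(_ t0)[y Sy] _] := set_valP S; have [sy _] := set_valP y.
have fy := simplex_finite sy.
exists (\max_(v <- fset_set (nsupp (val y))) val y v + m)%N => t x Sx v.
have [h _] := small Sx Sy v; apply/ltnW/(leq_trans h); rewrite leq_add2r.
have [->//|yv] := eqVneq (val y v) 0%N.
apply: (@leq_bigmax_seq _ _ predT (val y)) => //.
by rewrite in_fset_set // inE.
Qed.

(** The apex map is simplicial, so a sphere in the Hom complex yields a sphere in [|K|], which
    bounds a disk. A large multiple of that disk, rounded to lattice points, is a disk [G] of
    multihomomorphisms constant on [T]. The original sphere is deformed to the boundary of [G] by
    raising coordinates and then cutting them down. *)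
Lemma hom_cone_connected r : pred_connected R r (realization R K) ->
  pred_connected R r (realization R (hom_complex T Z)).
Proof.
move=> cK; have [[z0 _] eK] := cK.
have [v0 _] := simplex_neq0 (supp_simplex z0).
have base : exists S : P, True.
  have [||z _] := @cone_vertex_ex K m (fun v => if v == v0 then m else 0%N) [set v0] m0 (simplex_vertex v0).
  - by move=> v; rewrite /nsupp /=; case: (eqVneq v v0) => [->|].
  - by exists v0; rewrite eqxx.
  have zP : (fun _ : T => [set z]) \in @multihom T Z.
    apply/mem_set; split => [t|u v _ x y -> -> w]; first by exists z.
    by rewrite leqnSn.
  by exists (exist (fun f : T -> set Z => f \in @multihom T Z) _ zP).
have [S0 _] := base; have [X0 _] := @vertex_point R (hom_complex T Z) S0.
split; first by exists X0.
move=> i ir f cf; set n := i.+1 in f cf *.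
have [apex apexP] := apex_exists.
have apex_simplex (s : set (hom_complex T Z)) : simplex s -> simplex (apex @` s).
  move=> [fs [S1 sS1] cs].
  have [|||S sS Smax] := @fset_max _ (fset_set s) (fun S S' : P => (S <= S')%O).
  - by move=> a b c; exact: le_trans.
  - by move=> a b; rewrite !in_fset_set // !inE => sa sb; exact: cs.
  - by exists S1; rewrite in_fset_set ?inE.
  have [/(_ t0)[x Sx] _] := set_valP S; have [sx _] := set_valP x.
  apply: (simplex_face sx); last by exists (apex S1), S1.
  move=> _ [S' sS' <-]; rewrite /nsupp /= -lt0n.
  apply: (apexP S S' _ t0 x Sx); right; apply: Smax.
  by rewrite in_fset_set ?inE.
pose p := push apex_simplex \o f.
have cp : {within sphere R n, continuous p}.
  by apply: within_comp cf _; exact: push_cont.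
have [h ch hp] := eK i ir p cp.
have [PS PSP] := compact_finite_support (continuous_compact cf (@sphere_compact R n)).
have [V VP] := compact_finite_support (continuous_compact ch (@disk_compact R n)).
have sd x : sphere R n x -> disk R n x by rewrite /sphere /disk /= => ->.
have fPS x : sphere R n x -> supp (f x) `<=` [set` PS].
  by move=> Sx; apply: PSP; exists x.
have hV x v : disk R n x -> v \notin V -> val (h x) v = 0.
  move=> Dx; apply: contraNeq => hv; apply: (VP (h x)) => //; by exists x.
have hpE x : sphere R n x -> p x = h x by move=> Sx; rewrite hp //; exact/mem_set.
(* Some barycentric coordinate of [h x] is at least [1 / #|V|]. Multiplied by [M] it is at least
   [m + 1], and a lattice value less than one unit away still exceeds [m]. *)
pose M := (m.+1 * #|` V|)%N.
have big x : disk R n x -> exists2 v, v \in V & m.+1%:R <= M%:R * val (h x) v.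
  move=> Dx; apply: contrapT => none.
  have lt1 (v : V) : M%:R * val (h x) (val v) < m.+1%:R.
    by rewrite ltNge; apply/negP => h1; apply: none; exists (val v) => //; exact: valP.
  have : \sum_(v <- V) M%:R * val (h x) v = M%:R.
    rewrite -mulr_sumr sum_coord ?mulr1 //.
    by apply: VP; exists x.
  have V0 : (0 < #|` V|)%N.
    rewrite cardfs_gt0; apply/fset0Pn; have [v hv] := simplex_neq0 (supp_simplex (h x)).
    by exists v; apply: (VP (h x)) => //; exists x.
  rewrite big_seq_fsetE /= => E.
  have : \sum_(v : V) M%:R * val (h x) (val v) < \sum_(v : V) (m.+1%:R : R).
    have /fset0Pn[v vV] : V != fset0 by rewrite -cardfs_gt0.
    apply: ltr_sum => [|u _]; last exact: lt1.
    by apply/hasP; exists [` vV]%fset; rewrite ?mem_index_enum.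
  by rewrite E sumr_const -cardfE -mulrnA ltxx.
have [C CP] : exists C, forall S : P, S \in PS -> forall t (x : Z), val S t x ->
    forall v, (val x v <= C)%N.
  have /choice[b bP] := multihom_bound.
  exists (\max_(S <- PS) b S)%N => S SPS t x Sx v.
  by apply: leq_trans (bP S t x Sx v) _; exact: (@leq_bigmax_seq _ _ predT b).
pose box := {ffun V -> 'I_M.+1}.
pose J := (PS * box * 'I_C.+2)%type.
(* With [y] the box point and [e] the cap, the formula is [max y (min x e)]: it gives [x] when
   [y = 0] and [e] is large, [max x y] when [e] is large, and [y] when [e = 0]. *)
pose U (j : J) t : set Z := [set z : Z | exists2 x : Z, val (val j.1.1) t x &
  forall v, val z v = minn (maxn (val x v) (box_fun j.1.2 v)) (maxn (box_fun j.1.2 v) j.2)].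
pose U' (y : box) (t : T) : set Z := [set z : Z | val z = box_fun y].
(* In the first half of the time [y] grows to the full multiple [M] while the cap stays above [C];
   in the second half the cap descends to 0. At each moment one of [x] and [y] thus guarantees a
   coordinate of at least [m]. *)
pose k (s : R) : R := M%:R * Num.min 1 (2 * s).
pose c (s : R) : R := C.+1%:R * Num.min 1 (2 - 2 * s).
have kM s : 0 <= s <= 1 -> 0 <= k s <= M%:R.
  move=> s01; rewrite /k mulr_ge0 ?ler0n //=; last by rewrite le_min; lra.
  by rewrite -[leRHS]mulr1 ler_wpM2l ?ler0n // ge_min lexx.
have cC s : 0 <= s <= 1 -> 0 <= c s <= C.+1%:R.
  move=> s01; rewrite /c mulr_ge0 ?ler0n //=; last by rewrite le_min; lra.
  by rewrite -[leRHS]mulr1 ler_wpM2l ?ler0n // ge_min lexx.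
pose q (z : 'rV[R]_n * R) v := k z.2 * val (p z.1) v.
pose rho (j : J) (z : 'rV[R]_n * R) : R :=
  val (f z.1) (val j.1.1) * (box_weight j.1.2 (q z) * tent (j.2%:R - c z.2)).
pose rho' (y : box) x : R := box_weight y (fun v => M%:R * val (h x) v).
have qM z : cylinder z -> forall v, 0 <= q z v <= M%:R.
  move=> [_ /kM/andP[k0 k1]] v; rewrite /q mulr_ge0 ?coord_ge0 //=.
  by rewrite -[leRHS]mulr1; apply: ler_pM => //; [exact: (coord_ge0 (p z.1) v)|exact: (coord_le1 (p z.1) v)].
have q_out z : cylinder z -> forall v, v \notin V -> q z v = 0.
  by move=> [Sz _] v vV; rewrite /q hpE // hV ?mulr0 //; exact: sd.
have h_out x : disk R n x -> forall v, v \notin V -> M%:R * val (h x) v = 0.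
  by move=> Dx v vV; rewrite hV // mulr0.
have rho_pos j z : 0 < rho j z -> [/\ supp (f z.1) (val j.1.1),
    0 < box_weight j.1.2 (q z) & `|j.2%:R - c z.2| < 1].
  move=> jz; have : rho j z != 0 by rewrite gt_eqF.
  rewrite /rho !mulf_eq0 !negb_or => /and3P[h1 h2 h3]; split => //.
    by rewrite lt0r h2 box_weight_ge0.
  by rewrite -tent_gt0 lt0r h3 tent_ge0.
have p_supp x v : supp (p x) v -> exists2 S, supp (f x) S & apex S = v.
  by rewrite /p /= push_supp => -[S]; exists S.
have f_chain x S S' : supp (f x) S -> supp (f x) S' -> (S <= S')%O \/ (S' <= S)%O.
  by have [_ _] := supp_simplex (f x); apply.
(* A nonzero coordinate of the box point is the apex of a member of the chain, where [x] is
   positive; so the moved point is supported in the simplex of [x]. *)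
have box_supp z j t (x : Z) v : cylinder z -> 0 < rho j z ->
    val (val j.1.1) t x -> box_fun j.1.2 v != 0%N -> val x v != 0%N.
  move=> Cz /rho_pos[fS yq _] Sx yv.
  have := box_weight_near v yq (q_out _ Cz).
  have [/eqP|pv _] := boolP (val (p z.1) v == 0).
    by rewrite /q => ->; rewrite mulr0 => /nat_near0 yv0; rewrite yv0 in yv.
  by have [S fS' <-] := p_supp _ _ pv; rewrite -lt0n; apply: apexP Sx; exact: f_chain fS'.
have U_neq0 z j t : cylinder z -> 0 < rho j z -> U j t !=set0.
  move=> Cz jz; have [fS yq ec] := rho_pos _ _ jz.
  have [/(_ t)[x Sx] _] := set_valP (val j.1.1); have [sx [vx xvx]] := set_valP x.
  have [v vn||z' z'E] := @cone_vertex_ex K m (fun v => minn (maxn (val x v)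
    (box_fun j.1.2 v)) (maxn (box_fun j.1.2 v) j.2)) (nsupp (val x)) m0 sx; last first.
  - by exists z', x => // v; rewrite z'E.
  - have [Sz z01] := Cz; case: (leP z.2 2^-1) => z2.
      exists vx; have -> : (j.2 : nat) = C.+1.
        have cE : c z.2 = C.+1%:R by rewrite /c min_l ?mulr1 //; lra.
        apply/eqP; rewrite eqn_leq -ltnS ltn_ord /= -ltnS.
        by rewrite -(ltr_nat R); move: ec; rewrite cE ltr_norml -!natr1; lra.
      have := CP _ (valP j.1.1) t x Sx vx.
      move: xvx; generalize (val x vx) (box_fun j.1.2 vx) => a b; clear; lia.
    have [v vV hv] := big z.1 (sd _ Sz); exists v.
    have kE : k z.2 = M%:R by rewrite /k min_l ?mulr1 //; lra.
    have := box_weight_near v yq (q_out _ Cz).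
    rewrite /q kE hpE // ltr_norml => /andP[h1 _].
    have : (m < box_fun j.1.2 v)%N by rewrite -(ltr_nat R); move: hv h1; rewrite -natr1; lra.
    by generalize (val x v) (box_fun j.1.2 v) => a b; clear; lia.
  - move: vn; rewrite /nsupp /= => vn; apply: contraT => /negPn xv0.
    have y0 : box_fun j.1.2 v = 0%N.
      by apply/eqP; apply: contraTT xv0 => yv; exact: (box_supp z j t).
    by move: vn; rewrite (eqP xv0) y0 maxn0 min0n.
have U_adj z j j' : cylinder z -> 0 < rho j z -> 0 < rho j' z ->
    forall u v, adj u v -> forall a b, U j u a -> U j' v b -> adj a b.
  move=> Cz jz j'z u v uv a b [x Sx ax] [x' Sx' bx'] w.
  have [fS yq ec] := rho_pos _ _ jz; have [fS' yq' ec'] := rho_pos _ _ j'z.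
  have xx' := hom_adj (f_chain _ _ _ fS fS') uv Sx Sx' w.
  have y1 := box_weight_near w yq (q_out _ Cz).
  have y2 := box_weight_near w yq' (q_out _ Cz).
  have := nat_near y1 y2; have := nat_near y2 y1.
  have := nat_near ec ec'; have := nat_near ec' ec.
  rewrite ax bx'; move: xx'; clear.
  generalize (val x w) (val x' w) (box_fun j.1.2 w) (box_fun j'.1.2 w) (j.2 : nat) (j'.2 : nat).
  by move=> *; lia.
have rho_ge0 j z : 0 <= rho j z.
  by rewrite mulr_ge0 ?coord_ge0 // mulr_ge0 ?box_weight_ge0 ?tent_ge0.
have sub1 (u : 'rV[R]_n -> R) : {within sphere R n, continuous u} ->
    {within @cylinder R n, continuous (fun z => u z.1)}.
  move=> cu; apply: (@within_comp_maps _ _ _ _ (sphere R n) fst u) => //.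
    by apply: continuous_subspaceT => z; exact: cvg_fst.
  by move=> z [].
have sub2 (u : R -> R) : continuous u ->
    {within @cylinder R n, continuous (fun z : 'rV[R]_n * R => u z.2)}.
  move=> cu; apply: continuous_subspaceT => z.
  by apply: continuous_comp; [exact: cvg_snd|exact: cu].
have ck : continuous k.
  move=> s; apply: cvgM; first exact: cvg_cst.
  apply: (@continuous_min R R (fun=> 1) (fun s => 2 * s)); first exact: cvg_cst.
  by apply: cvgM; [exact: cvg_cst|exact: cvg_id].
have cc : continuous c.
  move=> s; apply: cvgM; first exact: cvg_cst.
  apply: (@continuous_min R R (fun=> 1) (fun s => 2 - 2 * s)); first exact: cvg_cst.
  by apply: cvgB; [exact: cvg_cst|apply: cvgM; [exact: cvg_cst|exact: cvg_id]].
have ccoord (L : simplicial_complex) (u : 'rV[R]_n -> realization R L) D v :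
    {within D, continuous u} -> {within D, continuous (fun x => val (u x) v : R)}.
  move=> cu; exact: (@within_comp _ _ _ _ u (fun y => val y v : R) cu (@coord_cont R L v)).
have rho_cont j : {within @cylinder R n, continuous rho j}.
  have c1 := sub1 _ (ccoord _ f _ (val j.1.1) cf).
  have c2 : {within @cylinder R n, continuous (fun z => box_weight j.1.2 (q z))}.
    apply: box_weight_cont => v z; apply: cvgM; first exact: (sub2 k ck z).
    exact: (sub1 _ (ccoord _ p _ v cp) z).
  have c3 : {within @cylinder R n, continuous (fun z => tent (j.2%:R - c z.2))}.
    by apply: tent_cont => z; apply: cvgB; [exact: cvg_cst|exact: (sub2 c cc z)].
  by move=> z; apply: cvgM; [exact: c1|apply: cvgM; [exact: c2|exact: c3]].
have rho_ex z : cylinder z -> exists j, 0 < rho j z.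
  move=> Cz; have [Sz z01] := Cz; have [S fS] := simplex_neq0 (supp_simplex (f z.1)).
  have [y yq] := box_weight_ex V (qM z Cz).
  have /andP[c0 c1] := cC _ z01.
  have eC : (Num.truncn (c z.2) < C.+2)%N.
    rewrite ltnS -(ler_nat R) (le_trans _ c1) //.
    by have /andP[] := truncn_itv c0.
  exists ([` fPS _ Sz _ fS]%fset, y, Ordinal eC); rewrite /rho /=.
  by rewrite mulr_gt0 ?coord_gt0 // mulr_gt0 // tent_gt0 trunc_near.
have [F [cF FP]] := union_map (fun j z _ => rho_ge0 j z) rho_cont rho_ex U_neq0 U_adj X0.
have U'_neq0 x y (t : T) : disk R n x -> 0 < rho' y x -> U' y t !=set0.
  move=> Dx yq; have hx := supp_simplex (h x).
  have [||z zE] := @cone_vertex_ex K m (box_fun y) (supp (h x)) m0 hx.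
  - move=> v yv; have := box_weight_near v yq (h_out _ Dx).
    have [/eqP->|//] := boolP (val (h x) v == 0).
    by rewrite mulr0 => /nat_near0 yv0; rewrite /nsupp /= yv0 in yv.
  - have [v vV hv] := big x Dx; exists v.
    have := box_weight_near v yq (h_out _ Dx).
    rewrite ltr_norml => /andP[h1 _].
    by apply: ltnW; rewrite -(ltr_nat R); move: hv h1; rewrite -natr1; lra.
  - by exists z.
have U'_adj x y y' : disk R n x -> 0 < rho' y x -> 0 < rho' y' x ->
    forall u v : T, adj u v -> forall a b, U' y u a -> U' y' v b -> adj a b.
  move=> Dx yq yq' u v _ a b aE bE w; rewrite aE bE.
  have y1 := box_weight_near w yq (h_out _ Dx).
  have y2 := box_weight_near w yq' (h_out _ Dx).
  by split; [exact: nat_near y1 y2|exact: nat_near y2 y1].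
have rho'_cont y : {within disk R n, continuous rho' y}.
  apply: box_weight_cont => v x; apply: cvgM; first exact: cvg_cst.
  exact: (ccoord _ h _ v ch x).
have rho'_ex x : disk R n x -> exists y, 0 < rho' y x.
  move=> Dx; apply: box_weight_ex => v; rewrite mulr_ge0 ?coord_ge0 ?ler0n //=.
  by rewrite -[leRHS]mulr1 ler_wpM2l ?ler0n // coord_le1.
have [G [cG GP]] := union_map (fun y x _ => @box_weight_ge0 _ _ _ _ y _)
  rho'_cont rho'_ex U'_neq0 U'_adj X0.
have k0 : k 0 = 0 by rewrite /k mulr0 min_r ?ler01 ?mulr0.
have c0 : c 0 = C.+1%:R by rewrite /c mulr0 subr0 min_l ?mulr1 // ler1n.
have k1 : k 1 = M%:R by rewrite /k mulr1 min_l ?mulr1 // ler1n.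
have c1 : c 1 = 0 by rewrite /c mulr1 subrr min_r ?ler01 ?mulr0.
have cyl x (s : R) : sphere R n x -> 0 <= s <= 1 -> cylinder (x, s) by [].
have s0 : 0 <= (0 : R) <= 1 by rewrite lexx ler01.
have s1 : 0 <= (1 : R) <= 1 by rewrite lexx ler01.
have cFs (s : R) : 0 <= s <= 1 -> {within sphere R n, continuous (fun x => F (x, s))}.
  move=> s01; apply: (@within_comp_maps _ _ _ _ (@cylinder R n) (fun x => (x, s)) F) => //.
  apply: continuous_subspaceT.
  exact: pair_cst_cont.
(* At time 0 each [U j] is the multihomomorphism it comes from, and a union over a chain is its
   largest member. *)
have start x : sphere R n x -> supp (F (x, 0)) `<=` supp (f x).
  move=> Sx S /(FP _ (cyl _ _ Sx s0))[B [/set0Pn[j0 j0B] Bpos _] SB].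
  have UE j t : j \in B -> U j t = val (val j.1.1) t.
    move=> /Bpos jz; have [_ yq ec] := rho_pos _ _ jz.
    have y0 v : box_fun j.1.2 v = 0%N.
      have := box_weight_near v yq (q_out _ (cyl _ _ Sx s0)).
      by rewrite /q /= k0 mul0r => /nat_near0.
    have eC : (C < j.2)%N.
      by rewrite -(ltr_nat R); move: ec; rewrite /= c0 ltr_norml -natr1; lra.
    apply/seteqP; split => [z [y Sy zE]|z Sz].
      suff -> : z = y by [].
      apply: val_inj; apply/funext => v; rewrite zE y0 maxn0 max0n.
      by apply/minn_idPl/(leq_trans (CP _ (valP j.1.1) t y Sy v))/ltnW.
    exists z => // v; rewrite y0 maxn0 max0n; apply/esym/minn_idPl.
    by apply/(leq_trans (CP _ (valP j.1.1) t z Sz v))/ltnW.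
  have [|||S' /imfsetP[j' /= j'B ->] S'max] := @fset_max _ [fset val j.1.1 | j in B]%fset
      (fun S S' : P => (S <= S')%O).
  - by move=> a b d; exact: le_trans.
  - move=> _ _ /imfsetP[a /= aB ->] /imfsetP[b /= bB ->].
    have [fa _ _] := rho_pos _ _ (Bpos _ aB); have [fb _ _] := rho_pos _ _ (Bpos _ bB).
    exact: f_chain fa fb.
  - by exists (val j0.1.1); apply/imfsetP; exists j0.
  have -> : S = val j'.1.1.
    apply: val_inj; apply/funext => t; rewrite SB; apply/seteqP; split => [z [j jB]|z Sz].
      rewrite UE //; apply: (hom_leP _ _).1; apply: S'max.
      by apply/imfsetP; exists j.
    by exists j' => //; rewrite UE.
  by have [] := rho_pos _ _ (Bpos _ j'B).
apply: (contiguous_extension cf (cFs 0 s0)).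
  move=> x Sx; rewrite (_ : _ `|` _ = supp (f x)); first exact: supp_simplex.
  by apply/seteqP; split => [S [//|]|S]; [exact: start|left].
apply: homotopy_extension cF _.
have cG' : {within sphere R n, continuous G}.
  by apply: continuous_subspaceW cG => x; exact: sd.
apply: (contiguous_extension (cFs 1 s1) cG'); last by exists G.
move=> x Sx; have Cx := cyl x 1 Sx s1.
have qE : q (x, 1) = (fun v => M%:R * val (h x) v).
  by apply/funext => v; rewrite /q k1 -(hpE _ Sx).
(* The weights of [F] are products, so comparing two indices that differ only in the box compares
   the weights of [G]. Hence either all boxes of [B] lie in [B'], or all boxes of [B'] occur in
   [B]. *)
have cross S S' : supp (F (x, 1)) S -> supp (G x) S' -> (S <= S')%O \/ (S' <= S)%O.
  move=> /(FP _ Cx)[B [_ Bpos Bup] SB] /(GP _ (sd _ Sx))[B' [_ _ Bup'] SB'].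
  have UE j t : j \in B -> U j t = U' j.1.2 t.
    move=> /Bpos jz; have [_ yq ec] := rho_pos _ _ jz.
    have e0 : (j.2 : nat) = 0%N by apply: (@nat_near0 R); rewrite -c1.
    have [/(_ t)[y Sy] _] := set_valP (val j.1.1).
    apply/seteqP; split => [z [w _ zE]|z zE].
      by apply/funext => v; rewrite zE e0 maxn0; apply/minn_idPr; exact: leq_maxr.
    exists y => // v; rewrite zE e0 maxn0; apply/esym/minn_idPr; exact: leq_maxr.
  have [BB'|] := pselect (forall j, j \in B -> j.1.2 \in B').
    left; apply/hom_leP => t; rewrite SB SB' => z [j jB]; rewrite UE // => zj.
    by exists j.1.2 => //; exact: BB'.
  move=> /existsNP[j /not_implyP[jB /negP jB']]; right.
  apply/hom_leP => t; rewrite SB SB' => z [y' y'B' zy'].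
  pose j' : J := (j.1.1, y', j.2).
  have [j'B|j'B] := boolP (j' \in B); first by exists j' => //; rewrite UE.
  have := Bup _ _ jB j'B; rewrite /rho /= qE.
  have [fj _ tj] := rho_pos _ _ (Bpos _ jB).
  have tj0 : 0 < tent (j.2%:R - c 1) by rewrite tent_gt0.
  rewrite (ltr_pM2l (coord_gt0 fj)) (ltr_pM2r tj0) => h1.
  by have := lt_trans h1 (Bup' _ _ y'B' jB'); rewrite /rho' ltxx.
have sF := supp_simplex (F (x, 1)); have sG := supp_simplex (G x).
have [fF [SF SFP] cF1] := sF; have [fG _ cG1] := sG.
split; first by rewrite finite_setU.
  by exists SF; left.
move=> S S' [FS|GS] [FS'|GS'].
- exact: cF1.
- exact: cross.
- by have [] := cross _ _ FS' GS; [right|left].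
- exact: cG1.
Qed.

End ConeHom.

(** * Free actions and vertex critical graphs *)

Section FreeActions.
Variable gT : finGroupType.

Definition free_action (V : Type) (a : left_action gT V) :=
  forall g v, a g v = v -> g = 1%g.

Lemma left_actionK (V : Type) (a : left_action gT V) g : cancel (a g) (a g^-1%g).
Proof. by move=> v; rewrite -lactM mulVg lact1. Qed.

Lemma free_action_inj (V : Type) (a : left_action gT V) g h v :
  free_action a -> a g v = a h v -> g = h.
Proof.
move=> fa gh; apply/esym/eqP; rewrite eq_mulVg1; apply/eqP/(fa _ v).
by rewrite lactM gh left_actionK.
Qed.

(** Choose on one representative of each orbit and translate; freeness makes the translating element
    unique. *)
Lemma equivariant_choice (V W : Type) (a : left_action gT V) (b : left_action gT W)
    (P : V -> W -> Prop) :
  free_action a -> (forall g v w, P v w -> P (a g v) (b g w)) ->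
  (forall v, exists w, P v w) ->
  exists2 f : V -> W, (forall g v, f (a g v) = b g (f v)) & forall v, P v (f v).
Proof.
move=> fa Pinv /choice[w wP].
pose orbit v : set V := [set u | exists g, u = a g v].
have orbit_neq0 v : exists u, orbit v u by exists v, 1%g; rewrite lact1.
have orbitM g v : orbit (a g v) = orbit v.
  apply/seteqP; split => _ [h ->]; first by exists (h * g)%g; rewrite lactM.
  by exists (h * g^-1)%g; rewrite lactM left_actionK.
(* The representative is picked from the orbit as a set, so that it is the same for all points of
   the orbit. *)
pose pick (A : set V) (h : exists u, A u) := projT1 (cid h).
have pick_eq A B (h : exists u, A u) (h' : exists u, B u) : A = B -> pick A h = pick B h'.
  by move=> AB; subst B; rewrite (Prop_irrelevance h h').
pose rho v := pick _ (orbit_neq0 v).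
have rhoM g v : rho (a g v) = rho v by apply: pick_eq; exact: orbitM.
have /choice[gamma gammaP] v : exists g, v = a g (rho v).
  have [g E] : orbit v (rho v) by rewrite /rho /pick; case: cid.
  by exists g^-1%g; rewrite E left_actionK.
have gammaM g v : gamma (a g v) = (g * gamma v)%g.
  apply: (free_action_inj (v := rho v) fa); rewrite lactM -gammaP -(rhoM g v).
  by rewrite -gammaP.
exists (fun v => b (gamma v) (w (rho v))) => [g v|v].
  by rewrite gammaM rhoM lactM.
by rewrite {1}(gammaP v); apply: Pinv; exact: wP.
Qed.

Lemma gcw_free (R : realType) (E : gspace gT) (S : free_gcw R E) :
  free_action (gs_act E).
Proof.
move=> g x gx; have [[h p] [[Op xE] pu]] := cell_partition S x.
have := pu ((g * h)%g, p); rewrite /= lactM -xE gx => /(_ (conj Op erefl)) E1.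
by have /(mulIg h) : (1 * h = g * h)%g by rewrite mul1g; exact: (congr1 fst E1).
Qed.

Lemma triangulates_free (R : realType) (X : gcomplex gT) (E : gspace gT) :
  triangulates R X E -> free_action (gs_act E) ->
  free_action (gs_act (realization_gspace R X)).
Proof.
move=> [f [h [_ _ fK _ ef]]] fE g x gx; apply: (fE g (f x)).
by rewrite -ef gx.
Qed.

End FreeActions.

Section GridFree.
Variables (R : realType) (gT : finGroupType) (X : gcomplex gT) (M : nat).
Hypothesis M0 : (0 < M)%N.
Hypothesis freeX : free_action (gs_act (realization_gspace R X)).

(** Since [h] has finite order, iterating the inequality returns to the starting point. *)
Lemma shift_le_eq (n : X -> nat) h : (forall v, n v <= n (gc_act X h v))%N ->
  forall v, n (gc_act X h v) = n v.
Proof.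
move=> le v; apply/eqP; rewrite eqn_leq le andbT.
have it k u : (n u <= n (gc_act X (h ^+ k)%g u))%N.
  elim: k => [|k IH]; first by rewrite expg0 lact1.
  by apply: leq_trans IH _; rewrite expgS lactM le.
have := it #[h]%g.-1 (gc_act X h v); rewrite -lactM -expgSr prednK ?order_gt0 //.
by rewrite expg_order lact1.
Qed.

Lemma grid_vertex_free (n : grid X M) g : gc_act (grid X M) g n = n -> g = 1%g.
Proof.
move=> gn; have [x xn] := @vertex_point R (grid X M) n.
apply: (freeX (v := grid_down M0 x)); rewrite -grid_down_equivariant.
congr grid_down; apply: realization_eq => v.
change (val x (gc_act (grid X M) g^-1%g v) = val x v).
have x0 w : w != n -> val x w = 0.
  by apply: contraNeq => xw; have : supp x w by []; rewrite xn => ->.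
have [->|vn] := eqVneq v n.
  by rewrite -{1}gn (gc_actK (K := grid X M) g n).
rewrite (x0 v vn) x0 //; apply: contra vn => /eqP E.
by rewrite -(gc_actVK (K := grid X M) g v) E gn.
Qed.

(** In a simplex one of [n] and [g n] dominates the other, and domination along an element of finite
    order is equality; so [g] fixes [n]. This is what replacing a triangulation by its barycentric
    subdivision achieves. *)
Lemma grid_regular (n : grid X M) g (s : set (grid X M)) : simplex s -> s n ->
  s (gc_act (grid X M) g n) -> g = 1%g.
Proof.
move=> [_ _ cs] sn sgn; apply: (@grid_vertex_free n); apply: val_inj.
apply/funext => v; change (shift g (val n) v = val n v).
have [h|h] := cs _ _ sn sgn.
  by apply: (@shift_le_eq (val n) g^-1%g) => u; have /andP[] := h u.
have /(@shift_le_eq (val n))/(_ (gc_act X g^-1%g v)) : forall u, (val n u <= val n (gc_act X g u))%N.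
  by move=> u; have /andP[] := h (gc_act X g u); rewrite /= /shift gc_actK.
by rewrite gc_actVK /shift.
Qed.

End GridFree.

(** * The group moves the points of the cone graph far away *)

Section ConeAction.
Variables (gT : finGroupType) (K : gcomplex gT) (m : nat).
Local Notation Z := (cone_graph K m).

Lemma cone_act_subproof g (z : Z) : shift g (val z) \in @cone_points K m.
Proof.
have [sz [v zv]] := set_valP z; apply/mem_set; split.
  by rewrite nsupp_shift; exact: gc_simplex.
by exists (gc_act K g v); rewrite /shift gc_actK.
Qed.

Definition cone_act g (z : Z) : Z :=
  exist (fun f : K -> nat => f \in @cone_points K m) _ (cone_act_subproof g z).

Lemma cone_act1 z : cone_act 1%g z = z.
Proof. by apply: val_inj; rewrite /= shift1. Qed.

Lemma cone_actM g h z : cone_act (g * h)%g z = cone_act g (cone_act h z).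
Proof. by apply: val_inj; rewrite /= shiftM. Qed.

Definition cone_action : left_action gT Z := LeftAction cone_act1 cone_actM.

Lemma cone_act_adj g (x y : Z) : adj x y -> adj (cone_action g x) (cone_action g y).
Proof. by move=> xy v; exact: (xy (gc_act K g^-1%g v)). Qed.

Hypothesis m0 : (0 < m)%N.
Hypothesis regular : forall n g (s : set K), simplex s -> s n -> s (gc_act K g n) -> g = 1%g.

(** At a coordinate where [z] is at least [m], nearness makes the translate positive, so the simplex
    supporting [z] contains two vertices of one orbit. *)
Lemma cone_act_far g (z : Z) :
  (forall v, val z v < val (cone_action g z) v + m)%N -> g = 1%g.
Proof.
move=> near; have [sz [v zv]] := set_valP z.
have gzv : (0 < val z (gc_act K g^-1%g v))%N.
  by have := leq_ltn_trans zv (near v); rewrite -{1}[m]add0n ltn_add2r.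
apply: (regular (n := gc_act K g^-1%g v) sz); first by rewrite /nsupp /= -lt0n.
by rewrite gc_actVK /nsupp /= -lt0n (leq_trans m0).
Qed.

Lemma cone_act_free : free_action cone_action.
Proof.
by move=> g z gz; apply: (@cone_act_far _ z) => v; rewrite gz -addn1 leq_add2l.
Qed.

End ConeAction.

Section Walks.

Fixpoint walk (G : graph) (k : nat) (u v : G) : Prop :=
  if k is k'.+1 then exists2 w, adj u w & walk k' w v else u = v.

Lemma walk_rcons (G : graph) k (u v w : G) : walk k u v -> adj v w -> walk k.+1 u w.
Proof.
elim: k u => [|k IH] u /=; first by move=> -> uw; exists w.
by move=> [u' uu' u'v] vw; exists u' => //; exact: IH.
Qed.

(** Length zero is excluded since two elements of the same [S u] need not coincide. *)
Lemma multihom_walk (T G : graph) (S : T -> set G) k (u v : T) a b : multihom S ->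
  walk k.+1 u v -> S u a -> S v b -> walk k.+1 a b.
Proof.
move=> [S0 SE]; elim: k u a => [|k IH] u a.
  by move=> [w uw <-] Sa Sb; exists b => //; exact: (SE u w uw).
move=> [w uw wv] Sa Sb; have [c Sc] := S0 w.
by exists c; [exact: (SE u w uw)|exact: IH wv Sc Sb].
Qed.

Lemma cone_walk (K : simplicial_complex) m k (x y : cone_graph K m) : walk k x y ->
  forall v, (val x v <= val y v + k)%N /\ (val y v <= val x v + k)%N.
Proof.
elim: k x => [|k IH] x; first by move=> -> v; rewrite addn0.
move=> [z xz /IH zy] v; have [] := xz v; have [] := zy v.
by generalize (val x v) (val y v) (val z v); clear; lia.
Qed.

End Walks.

Lemma finite_iter_return (T : Type) (g : T -> T) (t : T) : finite_set [set: T] ->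
  injective g -> exists k, iter k.+1 g t = t.
Proof.
move=> fT ginj; apply: contrapT => nret.
have it_inj : {in [set: nat] &, injective (fun k => iter k g t)}.
  move=> i j _ _; wlog ij : i j / (i <= j)%N.
    by move=> W; case: (leqP i j) => [/W|/ltnW/W h /esym /h].
  move: ij => /subnK <-; case: (j - i)%N => [//|k]; rewrite addnC iterD => E.
  by exfalso; apply: nret; exists k; elim: i E => [//|i IH] /= /ginj.
apply: infinite_nat; rewrite -(eq_finite_set (inj_card_eq it_inj)).
exact: sub_finite_set fT.
Qed.

(** * Endomorphisms and connectedness of vertex critical graphs *)

Section VertexCritical.
Variable T : graph.
Hypothesis fT : finite_set [set: T].
Hypothesis critical : vertex_critical T.

(** An endomorphism missing [v] would colour [T] with as few colours as [T] without [v]. *)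
Lemma critical_endo_surj (f : T -> T) : graph_hom f -> forall v, exists u, f u = v.
Proof.
move=> hf v; apply: contrapT => nv.
have [s cs ncs] := chi_lt (critical v); apply: ncs.
have fv u : f u <> v by move=> E; apply: nv; exists u.
apply: (@colorable_hom T (delete_vertex v) (fun u => exist _ (f u) (fv u))) cs.
by move=> a b /hf.
Qed.

(** A surjection of a finite set is bijective, and a common power of [f] fixes both [u] and [v]; the
    power just before it is a homomorphism that undoes [f] on them. *)
Lemma critical_endo_auto (f : T -> T) : graph_hom f ->
  bijective f /\ forall u v, adj (f u) (f v) <-> adj u v.
Proof.
move=> hf; have sf := critical_endo_surj hf; have /choice[g fg] := sf.
have ginj : injective g by move=> u v /(congr1 f); rewrite !fg.
have gret t : exists k, iter k.+1 g t = t by exact: finite_iter_return.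
have gf : cancel f g.
  by move=> t; have [k <-] := gret t; rewrite iterS fg.
have fret t : exists k, iter k.+1 f t = t.
  have [k kt] := gret t; exists k; rewrite -{1}kt.
  elim: k.+1 => [//|l IH]; by rewrite iterSr iterS fg.
split; first by exists g.
move=> u v; split; last exact: hf.
have hfk k a b : adj a b -> adj (iter k f a) (iter k f b).
  by elim: k => // k IH ab; rewrite !iterS; apply: hf; exact: IH.
have itM k t l : iter k f t = t -> iter (l * k) f t = t.
  by move=> kt; elim: l => [//|l IH]; rewrite mulSn addnC iterD kt.
have [k ku] := fret u; have [l lv] := fret v.
have uE : iter (l.+1 * k.+1) f u = u by exact: itM.
have vE : iter (l.+1 * k.+1) f v = v by rewrite mulnC; exact: itM.
have [N NE] : exists N, (l.+1 * k.+1 = N.+1)%N by exists (l.+1 * k.+1).-1; rewrite prednK // muln_gt0.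
move=> /(hfk N); rewrite -!iterSr -NE uE vE.
by [].
Qed.

(** Otherwise the component of [t0] misses [t] and the rest misses [t0], so each part is coloured
    with too few colours, and no edge joins the two. *)
Lemma critical_connected (t0 t : T) : exists k, walk k t0 t.
Proof.
apply: contrapT => nt.
pose A : set T := [set u | exists k, walk k t0 u].
have A0 : A t0 by exists 0%N.
have Aadj u v : adj u v -> A u -> A v.
  by move=> uv [k ku]; exists k.+1; exact: walk_rcons ku uv.
have [s1 [c1 h1] n1] := chi_lt (critical t); have [s2 [c2 h2] n2] := chi_lt (critical t0).
have col : colorable T (maxn s1 s2).
  have At u : A u -> u <> t by move=> Au E; apply: nt; rewrite -E.
  have nAt u : ~ A u -> u <> t0 by move=> nAu E; apply: nAu; rewrite E.
  pose c u : complete_graph (maxn s1 s2) := match pselect (A u) with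
    | left h => widen_ord (leq_maxl s1 s2) (c1 (exist _ u (At u h)))
    | right h => widen_ord (leq_maxr s1 s2) (c2 (exist _ u (nAt u h))) end.
  exists c => u v uv; rewrite /c.
  case: pselect => Au; case: pselect => Av.
  - move=> E; apply: (h1 (exist _ u (At u Au)) (exist _ v (At v Av)) uv).
    by apply: val_inj; have := congr1 val E.
  - by case: Av; exact: Aadj uv Au.
  - by case: Au; exact: Aadj (adj_sym uv) Av.
  - move=> E; apply: (h2 (exist _ u (nAt u Au)) (exist _ v (nAt v Av)) uv).
    by apply: val_inj; have := congr1 val E.
by move: col; rewrite /maxn; case: ifP.
Qed.

End VertexCritical.

(** * The graph [T x_Gamma Z] *)

Section TensorClasses.
Variables (gT : finGroupType) (T : graph) (to : graph_action gT T).
Variables (Z : graph) (za : left_action gT Z).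
Hypothesis za_adj : forall g x y, adj x y -> adj (za g x) (za g y).
Local Notation G := (@tensor_over gT T to Z za).
Implicit Types (p q : T * Z) (C D : G).

(** The left action on the product whose orbits are the classes of [tensor_over]. *)
Definition diag_act g p : T * Z := (to p.1 g^-1%g, za g p.2).

Lemma diag_act1 p : diag_act 1%g p = p.
Proof. by rewrite /diag_act invg1 ract1 lact1; case: p. Qed.

Lemma diag_actM g h p : diag_act (g * h)%g p = diag_act g (diag_act h p).
Proof. by rewrite /diag_act /= invMg ractM lactM. Qed.

Lemma tensor_identP p q : @tensor_ident gT T to Z za p q <-> exists g, q = diag_act g p.
Proof.
split=> [[t [g [z [-> ->]]]]|[g ->]].
  by exists g; rewrite /diag_act /= -ractM mulgV ract1.
exists (to p.1 g^-1%g), g, p.2; split => //.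
by rewrite -ractM mulVg ract1; case: p.
Qed.

Definition tensor_class p : G := exist
  (fun A : set (T * Z) => A \in @tensor_vertices gT T to Z za)
  (@tensor_ident gT T to Z za p) (mem_set (ex_intro _ p erefl)).

Lemma in_tensor_class p q : val (tensor_class p) q <-> exists g, q = diag_act g p.
Proof. exact: tensor_identP. Qed.

Lemma tensor_class_act g p : tensor_class (diag_act g p) = tensor_class p.
Proof.
apply: val_inj; apply/seteqP; split => q /in_tensor_class[h ->]; apply/in_tensor_class.
  by exists (h * g)%g; rewrite diag_actM.
by exists (h * g^-1)%g; rewrite -diag_actM mulgKV.
Qed.

Lemma tensor_class_of C p : val C p -> C = tensor_class p.
Proof.
have [q E] := set_valP C; have -> : C = tensor_class q by exact: val_inj.
by move=> /in_tensor_class[g ->]; rewrite tensor_class_act.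
Qed.

Lemma tensor_class_self p : val (tensor_class p) p.
Proof. by apply/in_tensor_class; exists 1%g; rewrite diag_act1. Qed.

Lemma tensor_rep C : exists p, val C p.
Proof.
have [q E] := set_valP C; have -> : C = tensor_class q by exact: val_inj.
by exists q; exact: tensor_class_self.
Qed.

Lemma tensor_orbit C p q : val C p -> val C q -> exists g, q = diag_act g p.
Proof. by move=> /tensor_class_of -> /in_tensor_class. Qed.

Lemma tensor_orbit_in C g p : val C p -> val C (diag_act g p).
Proof. by move=> /tensor_class_of ->; apply/in_tensor_class; exists g. Qed.

(** As in a covering, an edge lifts from any chosen representative: translate the pair of
    representatives that witnesses it. *)
Lemma tensor_adj_lift C D p : adj C D -> val C p ->
  exists q, [/\ val D q, adj p.1 q.1 & adj p.2 q.2].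
Proof.
move=> [p' [q' [Cp' Dq' a1 a2]]] Cp; have [g ->] := tensor_orbit Cp' Cp.
exists (diag_act g q'); split; [exact: tensor_orbit_in| |exact: za_adj].
exact: ract_adj.
Qed.

Lemma tensor_walk_lift k C D p : walk k C D -> val C p ->
  exists2 q, val D q & walk k p.2 q.2.
Proof.
elim: k C p => [|k IH] C p; first by move=> <- Cp; exists p.
move=> [C' CC' C'D] Cp; have [p' [C'p' _ pp']] := tensor_adj_lift CC' Cp.
by have [q Dq pq] := IH _ _ C'D C'p'; exists q => //; exists p'.2.
Qed.

End TensorClasses.

Lemma tensor_map (gT : finGroupType) (T : graph) (to : graph_action gT T)
    (Z Z' : graph) (za : left_action gT Z) (za' : left_action gT Z') (psi : Z -> Z') :
  graph_hom psi -> (forall g z, psi (za g z) = za' g (psi z)) ->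
  exists f : @tensor_over gT T to Z za -> @tensor_over gT T to Z' za', graph_hom f.
Proof.
move=> hpsi psiM; have /choice[rep repP] := @tensor_rep gT T to Z za.
pose f C := tensor_class to za' ((rep C).1, psi (rep C).2).
have fE C p : val C p -> val (f C) (p.1, psi p.2).
  move=> Cp; have [g ->] := tensor_orbit (repP C) Cp.
  apply/in_tensor_class; exists g; by rewrite /diag_act /= psiM.
exists f => C D [p [q [Cp Dq pq1 pq2]]].
exists (p.1, psi p.2), (q.1, psi q.2); split; [exact: fE|exact: fE|by []|exact: hpsi].
Qed.

(** * Lifting multihomomorphisms from the quotient to the cone graph *)

Section TensorHom.
Variables (gT : finGroupType) (T : graph) (to : graph_action gT T).
Variables (K : gcomplex gT) (m N : nat).
Local Notation Z := (cone_graph K m).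
Local Notation za := (cone_action K m).
Local Notation G := (@tensor_over gT T to Z za).
Hypothesis fT : finite_set [set: T].
Hypothesis critical : vertex_critical T.
Hypothesis Aut : is_Aut to.
Hypothesis regular : forall n g (s : set K), simplex s -> s n -> s (gc_act K g n) -> g = 1%g.
Variable t0 : T.
Hypothesis walks : forall t : T, exists2 k, (k < N)%N & walk k.+1 t0 t.
Hypothesis Nm : (N.*2.+1 < m)%N.

Let m0 : (0 < m)%N. Proof. exact: leq_ltn_trans Nm. Qed.

Definition close k (x y : Z) := forall v,
  (val x v <= val y v + k)%N /\ (val y v <= val x v + k)%N.

Lemma close_sym k x y : close k x y -> close k y x.
Proof. by move=> xy v; have [] := xy v. Qed.

Lemma close_trans k l j x y z : close k x y -> close l y z -> (k + l <= j)%N -> close j x z.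
Proof.
move=> xy yz kl v; have [] := xy v; have [] := yz v; move: kl.
by generalize (val x v) (val y v) (val z v); clear; lia.
Qed.

Lemma close_act k g x y : close k x y -> close k (za g x) (za g y).
Proof. by move=> xy v; exact: (xy (gc_act K g^-1%g v)). Qed.

Lemma close_adj x y : adj x y -> close 1 x y.
Proof. by move=> xy v; have [] := xy v; rewrite !addn1. Qed.

Lemma close_walk k l x y : (k <= l)%N -> walk k x y -> close l x y.
Proof.
move=> kl /cone_walk xy v; have [] := xy v; move: kl.
by generalize (val x v) (val y v); clear; lia.
Qed.

(** The constant: two representatives to be identified are each within [N] of a common point, and
    lifting an edge costs one more. *)
Lemma close_free g x : close N.*2.+1 x (za g x) -> g = 1%g.
Proof.
move=> xgx; apply: (cone_act_far m0 regular (z := x)) => v.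
by have [h _] := xgx v; apply: leq_ltn_trans h _; rewrite ltn_add2l.
Qed.

Lemma multihom_close (S : T -> set Z) t x y : multihom S -> S t x -> S t0 y -> close N y x.
Proof.
move=> mS Sx Sy; have [k kN tk] := walks t.
exact: close_walk kN (multihom_walk mS tk Sy Sx).
Qed.

Definition hom_lower (S : hom_poset T Z) (t : T) : set G :=
  [set C | exists2 z, val S t z & C = tensor_class to za (t, z)].

Lemma hom_lower_subproof (S : hom_poset T Z) : hom_lower S \in @multihom T G.
Proof.
have [S0 SE] := set_valP S; apply/mem_set; split.
  by move=> t; have [z Sz] := S0 t; exists (tensor_class to za (t, z)), z.
move=> u v uv _ _ [x Sx ->] [y Sy ->]; exists (u, x), (v, y).
by split => //=; [exact: tensor_class_self|exact: tensor_class_self|exact: (SE u v uv)].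
Qed.

Definition hom_down (S : hom_poset T Z) : hom_poset T G :=
  exist (fun f : T -> set G => f \in @multihom T G) _ (hom_lower_subproof S).

Lemma hom_down_le S S' : (S <= S')%O -> (hom_down S <= hom_down S')%O.
Proof.
move=> /hom_leP le; apply/hom_leP => t C [z Sz ->].
by exists z => //; exact: le.
Qed.

(** Each point of [S t] is carried into [S' t] by a group element fixing [t]. As [S] and [S'] spread
    by at most [N], it is the same element for all [t]; it then acts trivially on [T], hence is 1 by
    [Aut]. *)
Lemma hom_down_reflect S S' : (hom_down S <= hom_down S')%O -> (S <= S')%O.
Proof.
move=> /hom_leP le; have mS := set_valP S; have mS' := set_valP S'.
have key t z : val S t z -> exists g, [/\ to t g^-1%g = t & val S' t (za g z)].
  move=> Sz; have /le[z' S'z' E] : val (hom_down S) t (tensor_class to za (t, z)).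
    by exists z.
  have : val (tensor_class to za (t, z)) (t, z') by rewrite E; exact: tensor_class_self.
  by move=> /in_tensor_class[g [tg z'E]]; exists g; split; [exact/esym|rewrite -[za g z]z'E].
have [/(_ t0)[z0 Sz0] _] := mS.
have [g0 [_ S'gz0]] := key _ _ Sz0.
have stab t z : val S t z -> to t g0^-1%g = t /\ val S' t (za g0 z).
  move=> Sz; have [g [tg S'gz]] := key _ _ Sz.
  suff -> : g0 = g by [].
  have c1 := multihom_close mS Sz Sz0; have c2 := multihom_close mS' S'gz S'gz0.
  have c3 := close_act g^-1%g c2; rewrite -!lactM mulVg lact1 in c3.
  have /close_free/eqP : close N.*2.+1 z0 (za (g^-1 * g0)%g z0).
    by apply: close_trans c1 (close_sym c3) _; rewrite addnn.
  by rewrite -eq_mulVg1 => /eqP ->.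
have g01 : g0 = 1%g.
  have [||h [_ hu]] := Aut (a := id).
  - by exists id.
  - by [].
  - have E1 : h = 1%g by apply: hu => t; rewrite ract1.
    have E2 : h = g0^-1%g.
      apply: hu => t; have [/(_ t)[z Sz] _] := mS.
      by have [-> _] := stab _ _ Sz.
    by apply: invg_inj; rewrite invg1 -E2.
apply/hom_leP => t z Sz; have [_] := stab _ _ Sz.
by rewrite g01 lact1.
Qed.

(** Near a chosen representative over [t0], every class met by [F] has a representative, collected
    in [L]. The second coordinates in [L] give [S], up to the group element that corrects the first
    coordinates. *)
Lemma hom_down_surj (F : hom_poset T G) : exists S, hom_down S = F.
Proof.
have mF := set_valP F; have [F0 FE] := mF.
have [C0 FC0] := F0 t0; have [q0 C0q0] := tensor_rep C0.
pose L t : set (T * Z) := [set q | exists C, [/\ val F t C, val C q & close N q0.2 q.2]].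
have Lex t C : val F t C -> exists2 q, L t q & val C q.
  move=> FC; have [k kN tk] := walks t.
  have [q Cq q0q] := tensor_walk_lift (@cone_act_adj gT K m) (multihom_walk mF tk FC0 FC) C0q0.
  by exists q => //; exists C; split => //; exact: close_walk kN q0q.
have L0 t : exists q, L t q.
  by have [C FC] := F0 t; have [q Lq _] := Lex t C FC; exists q.
(* The lift [p] of the edge is within [N + 1] of [q0] and [q'] is within [N]; they share a class, so
   they coincide. *)
have LE t t' q q' : adj t t' -> L t q -> L t' q' -> adj q.1 q'.1 /\ adj q.2 q'.2.
  move=> tt' [C [FC Cq q0q]] [C' [FC' C'q' q0q']].
  have [p [C'p a1 a2]] := tensor_adj_lift (@cone_act_adj gT K m) (FE t t' tt' C C' FC FC') Cq.
  suff -> : q' = p by [].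
  have [g gE] := tensor_orbit C'p C'q'.
  suff g1 : g = 1%g by rewrite gE g1 diag_act1.
  apply: (@close_free g p.2).
  have c1 : close N.+1 p.2 q0.2.
    by apply: close_trans (close_sym (close_adj a2)) (close_sym q0q) _; rewrite add1n.
  have -> : za g p.2 = q'.2 by rewrite gE.
  by apply: close_trans c1 q0q' _; rewrite addSn addnn.
have /choice[sel selP] := L0.
have selhom (f : T -> T * Z) : (forall t, L t (f t)) -> graph_hom (fun t => (f t).1).
  by move=> fL u v uv; have [] := LE u v _ _ uv (fL u) (fL v).
have [abij aadj] := critical_endo_auto fT critical (selhom sel selP).
(* Changing the selection at [t] alone still gives an endomorphism; it is onto and agrees with the
   bijective old one off [t], so the value at [t] is forced. *)
have L1 t q : L t q -> q.1 = (sel t).1.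
  move=> Lq; pose f u := if pselect (u = t) then q else sel u.
  have fL u : L u (f u) by rewrite /f; case: pselect => [e|_] /=; [rewrite e|exact: selP].
  have ft : f t = q by rewrite /f; case: pselect.
  have fu u : u <> t -> f u = sel u by rewrite /f; case: pselect.
  have [u uE] := critical_endo_surj critical (selhom f fL) (sel t).1.
  have [ut|ut] := pselect (u = t); first by rewrite -uE ut ft.
  have [b' ab' _] := abij; rewrite fu // in uE; case: ut.
  by rewrite -[u]ab' /= uE ab'.
have [g [gE _]] := Aut abij aadj.
have SP : (fun t => [set z | exists2 q, L t q & z = za g q.2]) \in @multihom T Z.
  apply/mem_set; split; last first.
    move=> a b ab _ _ [p Lp ->] [p' Lp' ->].
    by apply: cone_act_adj; have [] := LE a b p p' ab Lp Lp'.
  move=> t'.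
  by have [p Lp] := L0 t'; exists (za g p.2), p.
have classE t q : L t q -> tensor_class to za (t, za g q.2) = tensor_class to za q.
  move=> Lq; rewrite -(tensor_class_act to za g q); congr tensor_class.
  by rewrite /diag_act (L1 _ _ Lq) gE -ractM mulgV ract1.
exists (exist (fun f : T -> set Z => f \in @multihom T Z) _ SP).
apply: val_inj; apply/funext => t; apply/seteqP; split => [C [_ [q Lq ->] ->]|C FC].
  rewrite classE //; have [D [FD Dq _]] := Lq.
  by rewrite -(tensor_class_of Dq).
have [q Lq Cq] := Lex t C FC; exists (za g q.2); first by exists q.
by rewrite classE // (tensor_class_of Cq).
Qed.

Lemma hom_tensor_connected (R : realType) r : pred_connected R r (realization R K) ->
  pred_connected R r (realization R (hom_complex T G)).
Proof.
move=> cK.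
have cZ : pred_connected R r (realization R (hom_complex T Z)).
  apply: (hom_cone_connected (t0 := t0) m0) cK => S t x y Sx Sy v.
  have Nm' : (N < m)%N by apply: leq_ltn_trans Nm; rewrite -addnn -addSn leq_addl.
  have [h1 h2] := multihom_close (set_valP S) Sx Sy v.
  by split; [apply: leq_ltn_trans h2 _|apply: leq_ltn_trans h1 _]; rewrite ltn_add2l.
have /choice[up upK] := hom_down_surj.
have downK : cancel hom_down up.
  by move=> S; apply/eqP; rewrite eq_le !(hom_down_reflect _) // upK.
have up_le F F' : (F <= F')%O -> (up F <= up F')%O.
  by move=> FF'; apply: hom_down_reflect; rewrite !upK.
have s1 := order_map_simplex hom_down_le; have s2 := order_map_simplex up_le.
apply: (pred_connected_retract _ _ _ cZ).
- exact: (@push_cont R (hom_complex T Z) (hom_complex T G) hom_down s1).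
- exact: (@push_cont R (hom_complex T G) (hom_complex T Z) up s2).
- exact: (@push_inverse R (hom_complex T G) (hom_complex T Z) up hom_down s2 s1 upK downK).
Qed.

End TensorHom.

(** * From (iv) to (i) *)

Section StatementIVtoI.
Variables (R : realType) (gT : finGroupType) (T : graph) (to : graph_action gT T).
Variables (r s : nat) (E : gspace gT).
Hypothesis fT : finite_set [set: T].
Hypothesis s1 : (1 <= s)%N.
Hypothesis isE : is_E R r E.
Hypothesis critical : vertex_critical T.
Hypothesis Aut : is_Aut to.

(** Being connected, [T] then has at most one vertex, and the Hom complex is a point. This case
    stands apart because [bounded_walks] starts from an edge. *)
Lemma edgeless_connected : (forall u v : T, ~ adj u v) ->
  pred_connected R r (realization R (hom_complex T T)).
Proof.
move=> noadj; have Tsub (u v : T) : u = v.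
  have [k] := critical_connected critical u v; case: k => [//|k [w uw _]].
  by case: (noadj u w).
have idP : (fun t : T => [set t]) \in @multihom T T.
  by apply/mem_set; split => [t|u v uv]; [exists t|case: (noadj u v)].
pose S0 : hom_poset T T := exist (fun f : T -> set T => f \in @multihom T T) _ idP.
have SE (S : hom_poset T T) : S = S0.
  apply: val_inj; apply/funext => t; have [/(_ t)[u Su] _] := set_valP S.
  by apply/seteqP; split => [w _|w _]; [exact: Tsub|rewrite (Tsub w u)].
have [x0 _] := @vertex_point R (hom_complex T T) S0.
have xE (x : realization R (hom_complex T T)) : x = x0.
  apply: realization_eq => S; rewrite (SE S).
  have one (y : realization R (hom_complex T T)) : val y S0 = 1 :> R.
    rewrite -(@sum_coord R (hom_complex T T) [fset (S0 : hom_complex T T)]%fset y) ?big_seq_fset1 //.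
    by move=> S' _; rewrite /= inE (SE S').
  by rewrite !one.
split; first by exists x0.
move=> i _ f _; exists (fun=> x0); first by move=> x; exact: cvg_cst.
by move=> x _; rewrite (xE (f x)).
Qed.

Lemma bounded_walks (t0 t1 : T) : adj t0 t1 ->
  exists N, forall t : T, exists2 k, (k < N)%N & walk k.+1 t0 t.
Proof.
move=> t01; have /choice[k kP] t : exists k, walk k.+1 t0 t.
  have [[|k] kt] := critical_connected critical t0 t; last by exists k.
  (* Walks of positive length are wanted, so the trivial one is replaced by an edge and back. *)
  by exists 1%N; rewrite -kt; exists t1 => //; exists t0 => //; exact: adj_sym.
have fk : finite_set (k @` [set: T]) by exact: finite_image.
exists (\max_(j <- fset_set (k @` [set: T])) j).+1 => t; exists (k t) => //.
rewrite ltnS; apply: (@leq_bigmax_seq _ _ predT id) => //.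
by rewrite in_fset_set // inE; exists t.
Qed.

Lemma statement_iv_i : statement_iv R T r s -> statement_i R to E s.
Proof.
move=> iv X tX; apply/chi_geP => // cX.
have [cE [S _]] := isE.
have freeX := triangulates_free tX (gcw_free S).
have tX' := grid_triangulates (isT : (0 < 1)%N) tX.
have [f' [h' [cf' ch' fK' hK' _]]] := tX'.
have cK : pred_connected R r (realization R (grid X 1)).
  exact: (pred_connected_retract ch' cf' fK').
have [[y0 _] _] := cK.
have [w0 _] := simplex_neq0 (supp_simplex (grid_down (isT : (0 < 1)%N) y0)).
have [[t0 [t1 t01]]|noedge] := pselect (exists t0 t1 : T, adj t0 t1); last first.
  have noadj u v : ~ @adj T u v by move=> uv; apply: noedge; exists u, v.
  have /chi_geP := iv T (edgeless_connected noadj); apply => //.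
  apply: (colorable_hom (f := fun t => tensor_class to (gc_act X : left_action gT (one_skeleton X)) (t, w0))) cX.
  by move=> u v /noadj.
have [N walks] := bounded_walks t01.
pose m := N.*2.+2.
have regular := grid_regular (M := 1) isT freeX.
have := iv _ (hom_tensor_connected fT critical Aut regular walks (ltnSn N.*2.+1) cK).
move=> /(chi_geP _ s1); apply.
have freeZ : free_action (cone_action (grid X 1) m).
  by apply: cone_act_free => //; exact: regular.
(* [z] goes to a vertex [w] of a simplex [n] of [X] at which [z] is high. Adjacent points are both
   positive at each other's choices, so the two simplices are nested and the chosen vertices span a
   simplex. *)
pose P (z : cone_graph (grid X 1) m) (w : one_skeleton X) :=
  exists2 n : grid X 1, (m <= val z n)%N & val n w != 0%N.
have [|z|psi psiM psiP] := @equivariant_choice gT (cone_graph (grid X 1) m) (one_skeleton X)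
    (cone_action (grid X 1) m) (gc_act X) P freeZ.
- move=> g z w [n zn nw]; exists (gc_act (grid X 1) g n).
    by rewrite /= /shift (gc_actK (K := grid X 1) g n).
  by rewrite /= /shift gc_actK.
- have [_ [n zn]] := set_valP z; have [sn _ _] := set_valP n.
  by have [w nw] := simplex_neq0 sn; exists w, n.
have hpsi : graph_hom psi.
  move=> z z' zz'; right; have [n zn nw] := psiP z; have [n' zn' nw'] := psiP z'.
  have [sz' _] := set_valP z'.
  have zn0 : nsupp (val z') n.
    have [h _] := zz' n; rewrite /nsupp /= -lt0n -ltnS; apply: leq_trans h.
    by apply: leq_trans zn; rewrite /m.
  have zn'0 : nsupp (val z') n' by rewrite /nsupp /= -lt0n (leq_trans _ zn').
  have [_ _ /(_ _ _ zn0 zn'0) cs] := sz'.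
  have sub (a b : grid X 1) : near_above (val a) (val b) -> nsupp (val a) `<=` nsupp (val b).
    move=> ab v av; have /andP[h _] := ab v; rewrite /nsupp /= -lt0n.
    by apply: leq_trans h; rewrite lt0n.
  case: cs => /sub le.
    have [sn' _ _] := set_valP n'; apply: (simplex_face sn'); last by exists (psi z); left.
    by move=> w [->|->] //; exact: le.
  have [sn _ _] := set_valP n; apply: (simplex_face sn); last by exists (psi z); left.
  by move=> w [->|->] //; exact: le.
by have [f hf] := tensor_map to hpsi psiM; exact: colorable_hom hf cX.
Qed.

End StatementIVtoI.

(** * Sperner's lemma *)

(** The elements that [h] moves cancel in pairs. *)
Lemma odd_involution_fix (T : finType) (h : T -> T) (A : {set T}) :
  involutive h -> {in A, forall x, h x \in A} ->
  odd #|A| = odd #|finset.finset (fun x => (x \in A) && (h x == x))|.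
Proof.
move=> hK; elim: {A}#|A| {-2}A (leqnn #|A|) => [|c IH] A Ac hA.
  have A0 : A = finset.set0 by apply/eqP; rewrite -cards_eq0 -leqn0.
  rewrite (_ : finset.finset _ = A) //; apply/setP => x.
  by rewrite finset.in_set A0 finset.in_set0.
have [[x /andP[xA hx]]|none] := pselect (exists x, (x \in A) && (h x != x)); last first.
  congr (odd _); apply: eq_card => x; rewrite finset.in_set.
  have [xA|//] := boolP (x \in A); apply/esym/eqP; apply: contrapT => hx.
  by apply: none; exists x; rewrite xA; apply/eqP.
pose A' := (A :\ x :\ h x)%SET.
have AE : #|A| = #|A'|.+2.
  by rewrite (cardsD1 x) xA (cardsD1 (h x) (A :\ x)) finset.in_setD1 hx hA.
rewrite AE /= negbK IH; last 2 first.
- by move: Ac; rewrite AE; lia.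
- move=> y; rewrite !finset.in_setD1 => /and3P[yhx yx yA]; rewrite hA // andbT.
  by rewrite (inj_eq (inv_inj hK)) yx (inv_eq hK) yhx.
congr (odd _); apply: eq_card => y; rewrite !finset.in_set /A' ?finset.in_setD1.
have [->|yx] := eqVneq y x; first by rewrite (negbTE hx) !andbF.
have [->|yhx] //= := eqVneq y (h x).
  by rewrite hK [x == _]eq_sym (negbTE hx) ?andbF ?eqxx.
by rewrite !finset.in_set1 yx yhx.
Qed.

(* When the values other than [t] are all attained, exactly one of them is attained
   twice, and the two points where it is are those that can be omitted. *)
Lemma even_almost_surjections m (l : 'I_m.+1 -> 'I_m.+1) (t : 'I_m.+1) :
  (forall j, l j != t) ->
  ~~ odd #|finset.finset (fun k => [forall d, (d != t) ==> [exists j, (j != k) && (l j == d)]])|.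
Proof.
move=> lt; set A := finset.finset _.
have [->|/set0Pn[k kA]] := eqVneq A finset.set0; first by rewrite cards0.
have kP d : d != t -> exists2 j, j != k & l j = d.
  move: kA; rewrite finset.in_set => /forallP/(_ d)/implyP h /h /existsP[j /andP[jk /eqP ld]].
  by exists j.
have l_inj : {in [pred j | j != k] &, injective l}.
  have e : #|[seq l j | j in [pred j | j != k]]| = #|[pred j : 'I_m.+1 | j != k]|.
    apply/eqP; rewrite eqn_leq; apply/andP; split.
      by rewrite (leq_trans (card_size _)) // size_image.
    have -> : #|[pred j : 'I_m.+1 | j != k]| = #|predC1 t|.
      by rewrite (eq_card (B := predC1 k)) ?cardC1.
    apply: subset_leq_card; apply/fintype.subsetP => d; rewrite inE => /kP[j jk <-].
    by apply/fintype.imageP; exists j.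
  by apply/image_injP; rewrite e.
have [k' k'k lk'] := kP (l k) (lt k).
suff -> : A = [set k; k']%SET by rewrite cards2 eq_sym k'k.
apply/setP => j; rewrite finset.in_set2; have [->|jk] := eqVneq j k; first by rewrite kA.
have [->|jk'] /= := eqVneq j k'.
  rewrite finset.in_set; apply/forallP => d; apply/implyP => /kP[i ik <-]; apply/existsP.
  have [->|ik'] := eqVneq i k'; first by exists k; rewrite eq_sym k'k lk' eqxx.
  by exists i; rewrite ik' eqxx.
apply/negbTE; rewrite finset.in_set negb_forall; apply/existsP; exists (l j).
rewrite negb_imply lt negb_exists; apply/forallP => i; apply/negP => /andP[ij /eqP lij].
have [ik|ik] := eqVneq i k.
  by move: lij; rewrite ik -lk' => /l_inj; rewrite !inE => /(_ k'k jk) E; rewrite E eqxx in jk'.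
by move/l_inj: lij; rewrite !inE => /(_ ik jk) E; rewrite E eqxx in ij.
Qed.

(** * Door counting in the Kuhn triangulation of a cube *)

Section KuhnTriangulation.
Variables (n M : nat) (F : 'I_n.+1 -> ('I_n.+1 -> nat) -> bool).
Local Notation coord := 'I_n.+1.
Local Notation top := (@ord_max n).
Hypothesis F0 : forall i y, y i = 0%N -> F i y = false.
Hypothesis FM : forall i y, y i = M.+1 -> F i y = true.
(** Prescribing the tests on one face leaves exactly one boundary door, known explicitly, in place
    of the usual induction on the dimension. *)
Hypothesis Ftop : forall i y, y top = M.+1 -> i != top -> F i y = (0 < y i)%N.

(** The first coordinate whose test fails, or [n + 1] if none does. A room showing all labels
    therefore sees both outcomes of every test. *)
Definition label (y : coord -> nat) : 'I_n.+2 :=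
  if [pick i : coord | ~~ F i y && [forall j : coord, (j < i)%N ==> F j y]] is Some i
  then widen_ord (leqnSn n.+1) i else ord_max.

Lemma labelP (y : coord -> nat) (i : coord) : label y = i :> nat ->
  F i y = false /\ forall j : coord, (j < i)%N -> F j y.
Proof.
rewrite /label; case: pickP => [i' /andP[/negbTE Fi' /forallP Fj]|_] /= E; last first.
  by have := ltn_ord i; rewrite -E ltnn.
have {E}-> : i = i' by exact/val_inj.
by split => // j; apply/implyP.
Qed.

Lemma label_max (y : coord -> nat) : label y = ord_max -> forall i, F i y.
Proof.
rewrite /label; case: pickP => [i' _ /(congr1 val) /= E|none _ i].
  by have := ltn_ord i'; rewrite E ltnn.
elim/ltn_ind: {i}(i : nat) {-2}i (erefl (i : nat)) => k IH i ik.
apply: contraT => Fi; have := none i; rewrite Fi /= => /negbT/negP[].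
by apply/forallP => j; apply/implyP => ji; apply: (IH j) => //; rewrite -ik.
Qed.

Lemma label_le (y : coord -> nat) (i : coord) : F i y = false -> (label y <= i)%N.
Proof.
move=> Fi; rewrite leqNgt; apply/negP => il.
have [ym|] := eqVneq (label y) ord_max; first by rewrite label_max in Fi.
move=> lm; have ln : (label y < n.+1)%N.
  by rewrite ltn_neqAle -ltnS ltn_ord andbT; apply: contra lm => /eqP E; apply/eqP/val_inj.
have [_ /(_ i il)] := labelP (i := Ordinal ln) erefl.
by rewrite Fi.
Qed.

Lemma label_eq (y : coord -> nat) (i : coord) : F i y = false ->
  (forall j : coord, (j < i)%N -> F j y) -> label y = i :> nat.
Proof.
move=> Fi Fj; apply/eqP; rewrite eqn_leq label_le //= leqNgt; apply/negP => li.
have ln : (label y < n.+1)%N by apply: ltn_trans li (ltn_ord i).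
have [h _] := labelP (i := Ordinal ln) erefl.
by rewrite Fj in h.
Qed.

(* The simplex with least vertex [x] whose edges successively follow the
   coordinate directions in the order of their ranks [s]. *)
Local Notation room := ({ffun coord -> 'I_M.+1} * {perm coord})%type.

Definition corner (a : room) (j : nat) : coord -> nat :=
  fun v => (a.1 v + (a.2 v < j)%N)%N.

Definition full (a : room) := forall d : 'I_n.+2, exists j : 'I_n.+2, label (corner a j) = d.

(** Label [v] cannot occur where [y v = M + 1]; dropping the label of [top] thus confines boundary
    doors to the prescribed face. *)
Let dropped : 'I_n.+2 := widen_ord (leqnSn n.+1) top.

Definition door (p : room * 'I_n.+2) : bool :=
  [forall d : 'I_n.+2, (d != dropped) ==>
     [exists j : 'I_n.+2, (j != p.2) && (label (corner p.1 j) == d)]].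

Definition rank_down : {perm coord} := perm (can_inj (@ord_predK n.+1)).

Definition rank_up : {perm coord} := perm (can_inj (@ordSK n.+1)).

Lemma rank_upK : (rank_up * rank_down = 1)%g.
Proof. by apply/permP => i; rewrite permM !permE ordSK. Qed.

Lemma rank_downK : (rank_down * rank_up = 1)%g.
Proof. by apply/permP => i; rewrite permM !permE ord_predK. Qed.

Lemma rank_downE (i : coord) : (rank_down i : nat) = if (i : nat) == 0%N then n else i.-1.
Proof.
rewrite permE /=; case: i => [[|i] ilt] /=; first by rewrite modn_small.
by rewrite modnDr modn_small // ltnW.
Qed.

Lemma rank_upE (i : coord) : (rank_up i : nat) = if (i : nat) == n then 0%N else i.+1.
Proof.
rewrite permE /=; have := ltn_ord i; rewrite ltnS leq_eqVlt.
case: eqP => [->|_] /=; first by rewrite modnn.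
by move=> h; rewrite modn_small.
Qed.

Definition bump_at (x : {ffun coord -> 'I_M.+1}) v (c : nat) : {ffun coord -> 'I_M.+1} :=
  [ffun u => if u == v then inord c else x u].

Lemma bump_at_same x v c : bump_at x v c v = inord c.
Proof. by rewrite ffunE eqxx. Qed.

(** Crosses the facet opposite corner [k]. Leaving out the first or last corner shifts the base
    point and rotates the order of directions; leaving out an inner corner swaps two consecutive
    directions. Facets on the boundary of the cube are fixed. *)
Definition pivot (p : room * 'I_n.+2) : room * 'I_n.+2 :=
  let: ((x, s), k) := p in
  if k == ord0 then
    let v := (s^-1)%g ord0 in
    if (x v < M)%N then ((bump_at x v (x v).+1, (s * rank_down)%g), ord_max) else p
  else if k == ord_max then
    let v := (s^-1)%g ord_max in
    if (0 < x v)%N then ((bump_at x v (x v).-1, (s * rank_up)%g), ord0) else p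
  else ((x, (s * tperm (inord k.-1) (inord k))%g), k).

Lemma perm_eqV (s : {perm coord}) v w : (v == (s^-1)%g w) = (s v == w).
Proof. by rewrite -(inj_eq (@perm_inj _ s)) permKV. Qed.

Lemma rank_down_top (s : {perm coord}) v :
  ((s * rank_down)%g v == ord_max) = (v == (s^-1)%g ord0).
Proof.
rewrite permM perm_eqV -!(inj_eq val_inj) /= rank_downE.
have := ltn_ord (s v); case: (nat_of_ord _) => [|k] //=; first by rewrite !eqxx.
by move=> h; apply/negbTE/eqP; lia.
Qed.

Lemma rank_up_bot (s : {perm coord}) v :
  ((s * rank_up)%g v == ord0) = (v == (s^-1)%g ord_max).
Proof.
by rewrite permM perm_eqV -!(inj_eq val_inj) /= rank_upE; case: (nat_of_ord (s v) == n).
Qed.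

Lemma pivotK : involutive pivot.
Proof.
case=> [[x s] k]; rewrite /pivot; case: ifP => [/eqP ->|k0].
  case: ifP => [xM|xM]; last by rewrite eqxx xM.
  set v := (s^-1)%g ord0.
  have -> : ((s * rank_down)^-1)%g ord_max = v.
    apply: (@perm_inj _ (s * rank_down)%g); rewrite permKV.
    by apply/esym/eqP; rewrite rank_down_top.
  have e : (inord (x v).+1 : 'I_M.+1) = (x v).+1 :> nat by rewrite inordK.
  rewrite bump_at_same e /= eqxx -mulgA rank_downK mulg1.
  congr (_, _, _); apply/ffunP => u; rewrite !ffunE; case: eqP => // ->.
  by rewrite inord_val.
case: ifP => [/eqP ->|kM].
  case: ifP => [x0|x0]; last by rewrite eqxx x0.
  set v := (s^-1)%g ord_max.
  have -> : ((s * rank_up)^-1)%g ord0 = v.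
    apply: (@perm_inj _ (s * rank_up)%g); rewrite permKV.
    by apply/esym/eqP; rewrite rank_up_bot.
  have xvM : ((x v).-1 < M)%N by have := ltn_ord (x v); move: x0; rewrite -/v; lia.
  have e : (inord (x v).-1 : 'I_M.+1) = (x v).-1 :> nat by rewrite inordK // ltnS ltnW.
  rewrite /= bump_at_same e xvM -mulgA rank_upK mulg1.
  congr (_, _, _); apply/ffunP => u; rewrite !ffunE; case: eqP => // ->.
  by rewrite ?e prednK // inord_val.
by rewrite /= k0 kM -mulgA tperm2 mulg1.
Qed.

Lemma pivot_corner p (j : 'I_n.+2) : j != p.2 ->
  exists2 j' : 'I_n.+2, j' != (pivot p).2 & corner (pivot p).1 j' = corner p.1 j.
Proof.
case: p => [[x s] k] /= jk; rewrite /pivot; case: ifP => [/eqP k0|k0].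
  case: ifP => [xM|_]; last by exists j.
  have j0 : (0 < j)%N by rewrite lt0n; move: jk; rewrite k0.
  have jlt := ltn_ord j.
  exists (inord j.-1).
    by rewrite -(inj_eq val_inj) /= inordK; lia.
  apply/funext => v; rewrite /corner /= inordK; last by lia.
  rewrite ffunE permM rank_downE perm_eqV -(inj_eq val_inj) /=.
  case: eqP => [sv|sv].
    have -> : v = (s^-1)%g ord0 by apply/eqP; rewrite perm_eqV; apply/eqP/val_inj.
    by rewrite inordK // permKV /=; move: xM j0 jlt; clear; lia.
  by move: sv j0; clear; lia.
case: ifP => [/eqP kM|kM].
  case: ifP => [x0|_]; last by exists j.
  have jM : (j < n.+1)%N.
    rewrite ltn_neqAle -ltnS ltn_ord andbT; apply: contra jk => /eqP jn.
    by rewrite kM; apply/eqP/val_inj.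
  exists (inord j.+1).
    by rewrite -(inj_eq val_inj) /= inordK.
  have h0 := ltn_ord (x ((s^-1)%g ord_max)).
  apply/funext => v; rewrite /corner /= inordK //.
  rewrite ffunE permM rank_upE perm_eqV -(inj_eq val_inj) /=.
  case: eqP => [sv|sv]; last by rewrite ltnS.
  have -> : v = (s^-1)%g ord_max by apply/eqP; rewrite perm_eqV; apply/eqP/val_inj.
  rewrite inordK; last by move: h0; clear; lia.
  by rewrite permKV /=; move: x0 jM h0; clear; lia.
exists j => //; apply/funext => v; rewrite /corner /= permM.
congr (_ + nat_of_bool _)%N.
have k1 : (0 < k)%N by rewrite lt0n; apply/negP => /eqP E; move/negP: k0; apply; apply/eqP/val_inj.
have k2 : (k < n.+1)%N.
  rewrite ltn_neqAle -ltnS ltn_ord andbT; apply/negP => /eqP E.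
  by move/negP: kM; apply; apply/eqP/val_inj.
have e1 : (inord k.-1 : coord) = k.-1 :> nat by rewrite inordK //; lia.
have e2 : (inord k : coord) = k :> nat by rewrite inordK.
have jk' : (j : nat) <> k by move=> E; move/negP: jk; apply; apply/eqP/val_inj.
case: tpermP => [sv|sv|//]; rewrite ?sv ?e1 ?e2; move: jk' k1; clear; lia.
Qed.

Lemma pivot_door p : door p -> door (pivot p).
Proof.
move=> /forallP dp; apply/forallP => d; apply/implyP => dd.
have /existsP[j /andP[jk /eqP lj]] := implyP (dp d) dd.
have [j' j'k cj] := pivot_corner jk.
by apply/existsP; exists j'; rewrite j'k cj lj eqxx.
Qed.

Let start_room : room := ([ffun v => if v == top then ord_max else ord0], rank_up).

Lemma start_door : door (start_room, ord0).
Proof.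
apply/forallP => d; apply/implyP => dd; apply/existsP.
have topc (j : 'I_n.+2) : (0 < j)%N -> corner start_room j top = M.+1.
  by move=> j0; rewrite /corner /= ffunE eqxx rank_upE eqxx j0 addn1.
have [->|dM] := eqVneq d ord_max.
  exists ord_max; rewrite /=; apply/eqP; apply: contrapT => lm.
  have ln : (label (corner start_room n.+1) < n.+1)%N.
    rewrite ltn_neqAle -ltnS ltn_ord andbT; apply/negP => /eqP E.
    by apply: lm; apply: val_inj.
  have [+ _] := labelP (i := Ordinal ln) erefl; set i := Ordinal ln.
  have [->|it] := eqVneq i top; first by rewrite FM // (topc ord_max).
  by rewrite (Ftop (topc ord_max _)) // /corner ltn_ord addn1.
have dn : (d < n)%N.
  move: dd dM; rewrite -!(inj_eq val_inj) /=; have := ltn_ord d; lia.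
have dlt : (d < n.+1)%N by lia.
exists (inord d.+1); rewrite -(inj_eq val_inj) /= inordK; last by lia.
rewrite /=; apply/eqP/val_inj; rewrite -[RHS]/(nat_of_ord (Ordinal dlt)).
have tc : corner start_room d.+1 top = M.+1.
  by rewrite /corner /= ffunE eqxx rank_upE /= eqxx addn1.
have cE (i : coord) : (i < n)%N -> corner start_room d.+1 i = (i < d)%N.
  move=> il; rewrite /corner /= ffunE -(inj_eq val_inj) /= rank_upE.
  by case: eqP => [E|_]; [rewrite E ltnn in il|rewrite ltnS add0n].
have nt (i : coord) : (i < n)%N -> i != top.
  by move=> il; rewrite -(inj_eq val_inj) /= neq_ltn il.
apply: label_eq => [|j jd]; first by apply: F0; rewrite cE //= ltnn.
have jn : (j < n)%N by apply: ltn_trans jd _.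
by rewrite Ftop ?nt // cE // jd.
Qed.

Lemma perm_le_eq (s t : {perm coord}) : (forall i, s i <= t i)%N -> s = t.
Proof.
move=> st; have E (u : {perm coord}) : (\sum_i (u i : nat) = \sum_(i < n.+1) i)%N.
  by rewrite [RHS](reindex_inj (@perm_inj _ u)).
have [_] := leqif_sum (fun (i : coord) (_ : true) => leqif_eq (st i)).
rewrite !E eqxx => /esym/forallP h; apply/permP => i; apply: val_inj.
by apply/eqP; have := h i.
Qed.

(** On a face [y v = 0] the label [n + 1] is missing, and on a face [y v = M + 1] the label [v] is;
    so [v = top], where the prescribed tests determine the room coordinate by coordinate. *)
Lemma boundary_door p : door p -> pivot p = p -> p = (start_room, ord0).
Proof.
case: p => [[x s] k] /forallP dp; rewrite /pivot.
have inner (d : coord) : d != top ->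
    exists2 j : 'I_n.+2, j != k & label (corner (x, s) j) = d :> nat.
  move=> dt; have dd : widen_ord (leqnSn n.+1) d != dropped.
    by rewrite -(inj_eq val_inj).
  have /existsP[j /andP[jk /eqP lj]] := implyP (dp _) dd.
  by exists j => //; rewrite lj.
case: ifP => [/eqP k0|k0].
  case: ifP => [_ [_ _ E]|xM _]; first by move: E; rewrite k0 => /(congr1 val).
  have jpos (j : 'I_n.+2) : j != k -> (0 < j)%N.
    by rewrite k0 -(inj_eq val_inj) /= lt0n.
  set v := (s^-1)%g ord0 in xM; have sv : s v = ord0 by rewrite permKV.
  have xv : x v = M :> nat by move: xM (ltn_ord (x v)); clear; lia.
  have cv (j : 'I_n.+2) : j != k -> corner (x, s) j v = M.+1.
    by move=> jk; rewrite /corner /= xv sv /= jpos // addn1.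
  have vt : v = top.
    apply: contrapT => /eqP vt; have [j jk lj] := inner v vt.
    by have [+ _] := labelP lj; rewrite FM // cv.
  rewrite vt in sv xv cv.
  have zero (i : coord) : i != top -> x i = ord0 /\
      forall i' : coord, (i' < i)%N -> (s i' < s i)%N.
    have fact (i0 : coord) : i0 != top -> x i0 = ord0 /\ exists2 j : 'I_n.+2,
        j != k & (j <= s i0)%N /\ forall i' : coord, (i' < i0)%N -> (0 < corner (x, s) j i')%N.
      move=> it; have [j jk lj] := inner i0 it; have [Fi Fj] := labelP lj.
      move: Fi; rewrite (Ftop (cv j jk)) // /corner /= => xi.
      split; first by apply: val_inj; move: xi; rewrite /=; clear; lia.
      exists j => //; split; first by move: xi; clear; lia.
      move=> i' ii; have := Fj i' ii; rewrite (Ftop (cv j jk)) //.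
      by apply: contraTneq ii => ->; rewrite -leqNgt -ltnS ltn_ord.
    move=> it; have [xi [j jk [js ji]]] := fact i it; split=> // i' ii.
    have it' : i' != top by apply: contraTneq ii => ->; rewrite -leqNgt -ltnS ltn_ord.
    have [xi' _] := fact i' it'; have := ji i' ii; rewrite /corner /= xi' /=.
    by move: js; clear; lia.
  have smono (c : nat) (i : coord) : i = c :> nat -> (c < n)%N -> (c < s i)%N.
    elim: c i => [|c IH] i ic cn; last first.
      have cl : (c < n.+1)%N by rewrite ltnW // ltnW.
      have ii : (Ordinal cl < i)%N by rewrite ic.
      have it : i != top by rewrite -(inj_eq val_inj) /= ic neq_ltn cn.
      by have := (zero i it).2 _ ii; have := IH (Ordinal cl) erefl (ltnW cn); lia.
    rewrite lt0n; apply/negP => /eqP si.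
    have /(@perm_inj _ s) E : s i = s top by rewrite sv; apply: val_inj.
    by move: cn; rewrite -ic E /= ltnn.
  have -> : s = rank_up.
    apply/esym/perm_le_eq => i; rewrite rank_upE; case: eqP => // ni.
    by apply: smono => //; have := ltn_ord i; lia.
  congr (_, _, _) => //; apply/ffunP => i; rewrite ffunE.
  have [->|it] := eqVneq i top; first exact: val_inj.
  by rewrite (zero i it).1.
case: ifP => [/eqP kM|kM].
  case: ifP => [_ [_ _ E]|xM _]; first by move: E; rewrite kM => /(congr1 val).
  set v := (s^-1)%g ord_max in xM; have sv : s v = ord_max by rewrite permKV.
  have dd : ord_max != dropped.
    by rewrite -(inj_eq val_inj) /= neq_ltn ltnSn orbT.
  have /existsP[j /andP[jk /eqP lj]] := implyP (dp _) dd.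
  have Fv : F v (corner (x, s) j).
    exact: label_max lj v.
  move: Fv; rewrite F0 // /corner /= sv /=.
  have jn : (j <= n)%N.
    rewrite -ltnS ltn_neqAle -ltnS ltn_ord andbT; move: jk.
    by rewrite kM -(inj_eq val_inj).
  by move: jn xM; clear; lia.
case=> /(congr1 (fun t => (s^-1 * t)%g)); rewrite mulKg mulVg => t1.
have k1 : (0 < k)%N by rewrite lt0n; apply/negP => /eqP E; move/negP: k0; apply; apply/eqP/val_inj.
have k2 : (k < n.+1)%N.
  rewrite ltn_neqAle -ltnS ltn_ord andbT; apply/negP => /eqP E.
  by move/negP: kM; apply; apply/eqP/val_inj.
have := tpermL (inord k.-1 : coord) (inord k); rewrite t1 perm1 => /(congr1 val).
by rewrite /= !inordK //; move: k1 k2; clear; lia.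
Qed.

(** Crossing is an involution on doors with one fixed point, so their number is odd; a room that is
    not full has an even number of them. *)
Lemma full_room : exists a, full a.
Proof.
apply: contrapT => none; pose A : {set room * 'I_n.+2} := finset.finset door.
have oA : odd #|A|.
  rewrite (odd_involution_fix pivotK (A := A)); last first.
    by move=> p; rewrite !finset.in_set; exact: pivot_door.
  rewrite (eq_card (B := [set (start_room, ord0 : 'I_n.+2)]%SET)) ?cards1 // => p.
  rewrite finset.in_set1 !finset.in_set; apply/idP/eqP => [/andP[dp /eqP pp]|->].
    exact: boundary_door.
  apply/andP; split; first exact: start_door.
  have tE : ((rank_up^-1)%g ord0 : coord) = top.
    apply/esym/eqP; rewrite perm_eqV; apply/eqP/val_inj.
    by apply: (etrans (rank_upE _)); rewrite /= eqxx.
  by rewrite /pivot /= tE ffunE eqxx /= ltnn.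
move: oA; rewrite -sum1_card; apply/negP.
rewrite (eq_bigl (fun p => door (p.1, p.2))); last first.
  by move=> [a k]; rewrite finset.in_set.
rewrite -(pair_big_dep xpredT (fun a k => door (a, k)) (fun _ _ => 1%N)) /=.
elim/big_ind: _ => // [a b a0 b0|a _]; first by rewrite oddD (negbTE a0) (negbTE b0).
rewrite sum1dep_card.
have [d dN] : exists d : 'I_n.+2, forall j : 'I_n.+2, label (corner a j) != d.
  apply: contrapT => all_; apply: none; exists a => d; apply: contrapT => nd.
  by apply: all_; exists d => j; apply/eqP => E; apply: nd; exists j.
have [dd|dd] := eqVneq d dropped.
  apply: (even_almost_surjections (l := fun j : 'I_n.+2 => label (corner a j)) (t := dropped)).
  by move=> j; rewrite -dd; exact: dN.
rewrite (_ : finset.finset _ = finset.set0) ?cards0 //; apply/setP => k.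
rewrite finset.in_set finset.in_set0; apply/negP => /forallP/(_ d).
by rewrite dd /= => /existsP[j /andP[_ /eqP E]]; have := dN j; rewrite E eqxx.
Qed.

End KuhnTriangulation.

(** A discrete Poincaré-Miranda theorem: tests separating opposite faces all change value within one
    unit cube. *)
Lemma discrete_miranda n N (f : 'I_n.+1 -> ('I_n.+1 -> nat) -> bool) : (0 < N)%N ->
  (forall i x, (forall j, x j <= N)%N -> x i = 0%N -> f i x = false) ->
  (forall i x, (forall j, x j <= N)%N -> x i = N -> f i x = true) ->
  exists2 x : 'I_n.+1 -> nat, forall j, (x j < N)%N & forall i,
    (exists2 p, forall j, (x j <= p j <= (x j).+1)%N & f i p = false) /\
    (exists2 p, forall j, (x j <= p j <= (x j).+1)%N & f i p = true).
Proof.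
move=> N0 f0 fN; pose top := @ord_max n.
pose cl (y : 'I_n.+1 -> nat) j := minn (y j) N.
have clN y j : (cl y j <= N)%N by rewrite geq_minr.
(* One layer is added outside the cube to carry the prescribed tests; elsewhere points are clipped
   back to the cube. *)
pose F i (y : 'I_n.+1 -> nat) :=
  if y top == N.+1 then (i == top) || (0 < y i)%N else f i (cl y).
have F0 i y : y i = 0%N -> F i y = false.
  move=> yi; rewrite /F; case: eqP => [yt|_]; last by rewrite f0 // /cl yi min0n.
  by rewrite yi orbF; apply/negP => /eqP E; rewrite -E yi in yt.
have FM i y : y i = N.+1 -> F i y = true.
  move=> yi; rewrite /F; case: eqP => [_|_]; first by rewrite yi orbT.
  by rewrite fN // /cl yi; apply/minn_idPr.
have Ftop i y : y top = N.+1 -> i != top -> F i y = (0 < y i)%N.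
  by move=> yt it; rewrite /F yt eqxx (negbTE it).
have [[x s] fr] := full_room F0 FM Ftop.
exists (fun j => minn (x j) N.-1) => [j|i]; first by lia.
have box (j : 'I_n.+2) v : (minn (x v) N.-1 <= cl (corner (x, s) j) v <= (minn (x v) N.-1).+1)%N.
  by rewrite /cl /corner /=; have := ltn_ord (x v); lia.
have [j lj] := fr (widen_ord (leqnSn n.+1) i).
have lji : label F (corner (x, s) j) = i :> nat by rewrite lj.
have [Fi _] := labelP lji; split.
  exists (cl (corner (x, s) j)); first exact: box.
  move: Fi; rewrite /F; case: eqP => [_|//] /negbT; rewrite negb_or -eqn0Ngt => /andP[_ /eqP y0].
  by apply: f0 => //; rewrite /cl y0 min0n.
have [it|it] := eqVneq i top.
  have [j' /label_max/(_ i) Fi'] := fr ord_max.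
  exists (cl (corner (x, s) j')); first exact: box.
  move: Fi'; rewrite /F; case: eqP => [yt _|//].
  by apply: fN => //; rewrite it /cl yt; apply/minn_idPr.
(* At a corner labelled [top] the test of [top] fails, so the corner is not in the added layer, and
   its earlier tests are successes of [f] itself. *)
have [j' lj'] := fr (widen_ord (leqnSn n.+1) top).
have lj't : label F (corner (x, s) j') = top :> nat by rewrite lj'.
have [Ft Fl] := labelP lj't.
exists (cl (corner (x, s) j')); first exact: box.
have : F i (corner (x, s) j').
  by apply: Fl; move: it; rewrite -(inj_eq val_inj) /=; have := ltn_ord i; lia.
rewrite {1}/F; case: eqP => // yt.
by rewrite FM in Ft.
Qed.

(** * Dimension *)

Section Bricks.
Local Open Scope nat_scope.

(** Pigeonhole: each of the [k] coordinates lies on a wall for at most one of the [k + 1] shifts. *)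
Lemma brick_colour k (w : 'I_k -> nat) :
  exists2 c : nat, (c <= k)%N & forall i, ~~ (k.+1 %| (w i).+1 + (k - c)).
Proof.
apply: contrapT => none.
have /choice[h hP] (c : 'I_k.+1) : exists i, (k.+1 %| (w i).+1 + (k - c)).
  apply: contrapT => nc; apply: none; exists c; first by rewrite -ltnS ltn_ord.
  by move=> i; apply/negP => di; apply: nc; exists i.
have h_inj : injective h.
  move=> c c' E; have := hP c; have := hP c'; rewrite -E /dvdn => /eqP E2 /eqP E1.
  have /eqP : (w (h c)).+1 + (k - c) = (w (h c)).+1 + (k - c') %[mod k.+1].
    by rewrite E1 E2.
  rewrite eqn_modDl !modn_small ?ltnS ?leq_subr // => /eqP.
  by have := ltn_ord c; have := ltn_ord c' => ? ? ?; apply: val_inj => /=; lia.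
by have := leq_card h h_inj; rewrite !card_ord ltnn.
Qed.

Lemma near_brick d a b : (0 < d)%N -> ~~ (d %| a) -> ~~ (d %| b) ->
  (a <= b.+1)%N -> (b <= a.+1)%N -> a %/ d = b %/ d.
Proof.
move=> d0 da db ab ba.
have [->//|[E|E]] : a = b \/ (a = b.+1 \/ b = a.+1) by lia.
  by rewrite E divnS // -E (negbTE da).
by rewrite E divnS // -E (negbTE db).
Qed.

Lemma brick_bound d a b : (0 < d)%N -> a %/ d = b %/ d -> (a < b + d)%N.
Proof.
move=> d0 E; rewrite (divn_eq a d) E {2}(divn_eq b d).
have := ltn_pmod a d0; lia.
Qed.

(* Lebesgue: colour the points of a grid by the residue, among [k.+1] shifts, of a
   brick decomposition of the target avoiding walls; a colour class splits into
   small far apart pieces, none of which joins opposite faces. *)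
Lemma no_thin_grid n k N (w : ('I_n.+1 -> nat) -> 'I_k -> nat) :
  (0 < N)%N -> (k <= n)%N ->
  (forall p q, (forall j, p j <= N)%N -> (forall j, q j <= N)%N ->
     (forall j, p j <= q j + 2)%N -> (forall j, q j <= p j + 2)%N ->
     forall i, (w p i <= (w q i).+1)%N) ->
  (forall p q, (forall j, p j <= N)%N -> (forall j, q j <= N)%N ->
     (forall i, w p i <= w q i + k)%N -> (forall i, w q i <= w p i + k)%N ->
     forall j, (p j + 2 < q j + N)%N) -> False.
Proof.
move=> N0 kn near far.
pose a c p (i : 'I_k) := ((w p i).+1 + (k - c))%N.
pose col c p := forall i, ~~ (k.+1 %| a c p i).
(* [p] touches a brick of colour [i] that reaches the lower face in direction [i]. By [far], such a
   brick never comes near the upper face. *)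
pose L (i : 'I_n.+1) p := p i = 0%N \/ exists q q',
  [/\ forall j, (q j <= N)%N /\ (q' j <= N)%N,
      forall j, (p j <= (q j).+1)%N /\ (q j <= (p j).+1)%N,
      col i q /\ col i q', forall l, a i q l %/ k.+1 = a i q' l %/ k.+1
    & (q' i <= 1)%N].
have [|i p pN p0|i p pN pi|x xN xP] := @discrete_miranda n N (fun i p => ~~ `[< L i p >]).
- exact: N0.
- by apply/negbTE; rewrite negbK; apply/asboolP; left.
- apply/asboolP => -[p0|[q [q' [qN pq _ qq' q1]]]]; first by rewrite p0 in pi; lia.
  have B l : (w q l <= w q' l + k)%N /\ (w q' l <= w q l + k)%N.
    by have := brick_bound (ltn0Sn k) (qq' l);
       have := brick_bound (ltn0Sn k) (esym (qq' l)); rewrite /a; lia.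
  have := far q q' (fun j => (qN j).1) (fun j => (qN j).2) (fun l => (B l).1) (fun l => (B l).2) i.
  by have := (pq i).1; lia.
have xN' j : (x j <= N)%N by exact: ltnW.
have [c ck cP] := brick_colour (w x).
(* The colour of [x] doubles as a direction. In that direction all points of the cube at [x] touch
   the brick of [x], so [L] cannot take both values there. *)
have cn : (c < n.+1)%N by rewrite ltnS (leq_trans ck).
pose i := Ordinal cn.
have [[p px /negbFE/asboolP Lp] [p' p'x /asboolP Lp']] := xP i.
have near_x q l : (forall j, (q j <= N)%N) -> (forall j, (x j <= q j + 2)%N /\ (q j <= x j + 2)%N) ->
    col i q -> a i q l %/ k.+1 = a i x l %/ k.+1.
  move=> qN qx cq; apply: near_brick; [by []|exact: cq|exact: cP| |].
  - have := near q x qN xN' (fun j => (qx j).2) (fun j => (qx j).1) l.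
    by rewrite /a; lia.
  - have := near x q xN' qN (fun j => (qx j).1) (fun j => (qx j).2) l.
    by rewrite /a; lia.
apply: Lp'; right; exists x.
case: Lp => [p0|[q [q' [qN pq [cq cq'] qq' q1]]]].
  exists x; split=> //; first by move=> j; have /andP[? ?] := p'x j; lia.
  by have /andP[? ?] := px i; lia.
exists q'; split=> //.
- by move=> j; split; [exact: xN'|exact: (qN j).2].
- by move=> j; have /andP[? ?] := p'x j; lia.
- move=> l; rewrite -(qq' l); apply/esym; apply: near_x => // j; first exact: (qN j).1.
  by have := pq j; have /andP[? ?] := px j; lia.
Qed.

End Bricks.

Lemma closed_diagonal (E : topologicalType) : hausdorff_space E ->
  closed [set z : E * E | z.1 = z.2].
Proof.
move=> hE [p q] cl; apply: hE => A B pA qB.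
have nAB : nbhs (p, q) (A `*` B) by exists (A, B) => //; split.
have [[a b] [/= ab [Aa Bb]]] := cl (A `*` B) nAB.
by exists a; split=> //; rewrite ab.
Qed.

(** * Open cells inside skeleta *)

Section Cells.
Variables (R : realType) (gT : finGroupType) (E : gspace gT) (S : free_gcw R E).
Local Notation m := (@cell_map R gT E S _).
Local Notation dim := (@cell_dim R gT E S).

Lemma cell_unique g (c : cell S) y g' (c' : cell S) y' :
  open_disk R (dim c) y -> open_disk R (dim c') y' ->
  gs_act E g (m y) = gs_act E g' (m y') ->
  (g, existT (fun c => 'rV[R]_(dim c)) c y) = (g', existT _ c' y').
Proof.
move=> Oy Oy' E1.
have [p [_ pu]] := cell_partition S (gs_act E g (m y)).
by rewrite -(pu (g, existT _ c y) (conj Oy erefl)) (pu (g', existT _ c' y') (conj Oy' E1)).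
Qed.

Lemma cell_map_inj g (c : cell S) (y y' : 'rV[R]_(dim c)) :
  open_disk R (dim c) y -> open_disk R (dim c) y' ->
  gs_act E g (m y) = gs_act E g (m y') -> y = y'.
Proof.
move=> Oy Oy' /(cell_unique Oy Oy')/(congr1 snd) /= E1.
by have := projT2_eq E1; rewrite (Prop_irrelevance (projT1_eq E1) erefl).
Qed.

Lemma disk_split n (y : 'rV[R]_n) : disk R n y -> open_disk R n y \/ sphere R n y.
Proof.
by rewrite /disk /open_disk /sphere /= le_eqVlt => /orP[/eqP|]; [right|left].
Qed.

Lemma sphere_lower (c : cell S) y g' (c' : cell S) y' : sphere R (dim c) y ->
  open_disk R (dim c') y' -> m y = gs_act E g' (m y') -> (dim c' < dim c)%N.
Proof.
have [n] := ubnP (dim c); elim: n c y g' => // n IH c y g' cn Sy Oy' E1.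
have [F _ [Flt Fsub]] := cell_boundary c.
have [p Fp [_ [z Dz <-] pz]] : (\bigcup_(p in F) gs_act E p.1 @` (m @` disk R (dim p.2))) (m y).
  by apply: Fsub; exists y.
have [Oz|Sz] := disk_split Dz.
  have := cell_unique Oz Oy' (etrans pz E1) => /(congr1 (fun q => projT1 q.2)) /= <-.
  exact: Flt.
apply: ltn_trans (Flt _ Fp); apply: (IH _ z (p.1^-1 * g')%g) => //.
  by rewrite ltnS in cn; exact: leq_trans (Flt _ Fp) cn.
by rewrite lactM -E1 -pz -lactM mulVg lact1.
Qed.

(** In other words, a cell is open in the skeleton of its dimension. A closed cell of that skeleton
    other than [(g0, c0)] lies wholly in the set, its boundary being in lower cells; for the
    remaining cells only the boundary matters, and induction applies. *)
Lemma other_cells_closed g0 (c0 : cell S) : closed [set x : E | exists g c (y : 'rV[R]_(dim c)),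
  [/\ open_disk R _ y, x = gs_act E g (m y), (dim c <= dim c0)%N & (g, c) <> (g0, c0)]].
Proof.
set A := [set x | _]; apply: (cell_weak (f := S)) => h c.
apply: compact_closed; first exact: disk_hausdorff.
have [n] := ubnP (dim c); elim: n h c => // n IH h c; rewrite ltnS => cn.
have cS : compact (sphere R (dim c) `&` [set x | A (gs_act E h (m x))]).
  have := @cell_sphere_compact gT E (cell S) dim (fun c => 'rV[R]_(dim c))
    (fun c => disk R (dim c)) (fun c => open_disk R (dim c)) (@cell_map R gT E S)
    (cell_hausdorff S) _ (@cell_continuous R gT E S) _ A n IH h c cn.
  rewrite disk_sphere; apply.
    by move=> c1; rewrite disk_sphere; exact: sphere_compact.
  by move=> c1; rewrite disk_sphere; exact: cell_boundary.
have [[dc gc]|nc] := pselect ((dim c <= dim c0)%N /\ (h, c) <> (g0, c0)).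
  rewrite (_ : _ `&` _ = disk R (dim c)); first exact: disk_compact.
  apply/seteqP; split=> [y []//|y Dy]; split=> //=.
  have [Oy|Sy] := disk_split Dy; first by exists h, c, y.
  have [[g [c' y']] [[/= Oy' yE] _]] := cell_partition S (gs_act E h (m y)).
  have lt : (dim c' < dim c)%N.
    apply: (sphere_lower (g' := (h^-1 * g)%g) Sy Oy').
    by rewrite lactM -yE -lactM mulVg lact1.
  exists g, c', y'; split=> //; first exact: leq_trans (ltnW lt) dc.
  by case=> _ E1; move: lt; rewrite E1 ltnNge dc.
rewrite (_ : _ `&` _ = sphere R (dim c) `&` [set x | A (gs_act E h (m x))]) //.
apply/seteqP; split=> y [Dy Ay]; split=> //; last by rewrite -disk_sphere in Dy; case: Dy.
have [Oy|//] := disk_split Dy; case: Ay => g [c' [y' [Oy' /(cell_unique Oy Oy') E1 dc gc]]].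
by case: nc; move: dc gc; have := congr1 (fun q => (q.1, projT1 q.2)) E1 => /= -[-> <-].
Qed.

End Cells.

Lemma continuous_comp_maps (X Y Z : topologicalType) (f : X -> Y) (g : Y -> Z) :
  continuous f -> continuous g -> continuous (fun x => g (f x)).
Proof. by move=> cf cg x; exact: continuous_comp (cf x) (cg (f x)). Qed.

Lemma sum_vertices (R : realType) (K : simplicial_complex) (I : finType) (v : I -> K)
    (x : realization R K) : injective v -> in_simplex (range v) x ->
  \sum_i val x (v i) = 1.
Proof.
move=> vi xs; have e : seq_fset tt (map v (enum I)) =i map v (enum I) by exact: seq_fsetE.
rewrite -(@sum_coord R K (seq_fset tt (map v (enum I))) x); last first.
  move=> u /xs [i _ <-]; rewrite /= e; apply/mapP; exists i => //.
  by rewrite mem_enum.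
rewrite (perm_big (map v (enum I))); first by rewrite big_map big_enum.
apply: (uniq_perm (fset_uniq _)) => //.
by rewrite map_inj_uniq // enum_uniq.
Qed.

Lemma sqr_le1_ge (R : realFieldType) (y : R) : y ^+ 2 <= 1 -> 0 <= y + 1.
Proof. by move=> y1; nra. Qed.

Lemma blend_near (R : realFieldType) (t b d : R) : 0 < t -> 0 <= b -> b <= 1 ->
  0 < d <= 1 -> `|(1 - t) * b + t * d - b| <= t.
Proof.
move=> t0 b0 b1 /andP[d0 d1]; rewrite (_ : _ - b = t * (d - b)); last by ring.
rewrite normrM gtr0_norm // -[leRHS]mulr1; apply: ler_wpM2l; first exact: ltW.
by rewrite ler_norml; lra.
Qed.

(** * A simplex of dimension [r + 1] does not embed in a complex of dimension [r] *)

Section Dimension.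
Variables (R : realType) (gT : finGroupType) (E : gspace gT) (S : free_gcw R E).
Variables (X : simplicial_complex) (f : realization R X -> E) (r : nat).
Variable v : 'I_r.+2 -> X.
Hypothesis f_cont : continuous f.
Hypothesis f_inj : injective f.
Hypothesis v_inj : injective v.
Hypothesis sv : simplex (range v).
Hypothesis dim_le : forall c : cell S, (cell_dim c <= r)%N.
Local Notation m := (@cell_map R gT E S _).
Local Notation dim := (@cell_dim R gT E S).
Local Notation B := (@in_simplex R X (range v)).

(** Take a point of the simplex in a cell of the largest dimension met; near it the image avoids all
    other cells of at most that dimension. *)
Lemma simplex_chart : exists g0 (c0 : cell S) (x0 : realization R X) (e : R),
  [/\ B x0, 0 < e & forall x, B x -> (forall u, `|val x u - val x0 u| < e) ->
    exists2 y, open_disk R (dim c0) y & f x = gs_act E g0 (m y)].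
Proof.
pose P k := `[< exists x g (c : cell S) y,
  [/\ B x, open_disk R (dim c) y, f x = gs_act E g (m y) & dim c = k] >].
have exP : exists k, P k.
  have [x xE] := vertex_point R (v ord0).
  have [[g [c y]] [[Oy yE] _]] := cell_partition S (f x).
  exists (dim c); apply/asboolP; exists x, g, c, y; split=> //.
  by rewrite /in_simplex /= -/(supp x) xE => _ ->; exists ord0.
have ubP k : P k -> (k <= r)%N by move=> /asboolP[x [g [c [y [_ _ _ <-]]]]].
case: (ex_maxnP exP ubP) => k /asboolP[x0 [g0 [c0 [y0 [Bx0 Oy0 E0 ck]]]]] kmax.
have oU : open (f @^-1` ~` [set x : E | exists g c (y : 'rV[R]_(dim c)),
    [/\ open_disk R _ y, x = gs_act E g (m y), (dim c <= dim c0)%N & (g, c) <> (g0, c0)]]).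
  by move/continuousP: f_cont; apply; apply: closed_openC; exact: other_cells_closed.
have Ux0 : (f @^-1` ~` [set x : E | exists g c (y : 'rV[R]_(dim c)),
    [/\ open_disk R _ y, x = gs_act E g (m y), (dim c <= dim c0)%N & (g, c) <> (g0, c0)]]) x0.
  move=> [g [c [y [Oy yE _ nc]]]]; apply: nc.
  have := cell_unique Oy Oy0 (etrans (esym yE) E0) => E1.
  by have := congr1 (fun q => (q.1, projT1 q.2)) E1.
have [e e0 eU] := oU _ sv x0 Ux0 Bx0.
exists g0, c0, x0, e; split=> // x Bx xe.
have nA := eU x Bx xe.
have [[g [c y]] [[/= Oy yE] _]] := cell_partition S (f x).
have dk : (dim c <= dim c0)%N.
  by rewrite ck; apply: kmax; apply/asboolP; exists x, g, c, y.
have [gc|gc] := pselect ((g, c) = (g0, c0)); last first.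
  by case: nA; exists g, c, y.
by case: gc => gg cc; subst g c; exists y.
Qed.

(** A cube of dimension [r + 1] in the simplex is charted in a disk of dimension [k <= r]; rounding
    disk coordinates gives a function that [no_thin_grid] rules out. *)
Lemma no_large_simplex : False.
Proof.
have [g0 [c0 [x0 [e [Bx0 e0 chart]]]]] := simplex_chart.
pose k := dim c0; pose m0 (y : 'rV[R]_k) := gs_act E g0 (m y).
pose Q := B `&` [set x | \sum_i `|val x (v i) - val x0 (v i)| <= e / 2].
have Bout x u : B x -> ~ range v u -> val x u = 0.
  by move=> Bx nu; apply: contrapT => /eqP xu; apply: nu; exact: Bx.
have coord_le (F : 'I_r.+2 -> R) i : `|F i| <= \sum_i `|F i|.
  by rewrite (bigD1 i) //= lerDl sumr_ge0.
have chartQ x : Q x -> exists2 y, open_disk R k y & f x = m0 y.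
  move=> [Bx xe]; apply: chart => // u.
  have [[i _ <-]|nu] := pselect (range v u); last first.
    by rewrite !Bout // subrr normr0.
  apply: le_lt_trans (coord_le (fun i => val x (v i) - val x0 (v i)) i) _.
  by apply: le_lt_trans xe _; lra.
have cQ : compact Q.
  have -> : Q = B `&` (fun x => \sum_i `|val x (v i) - val x0 (v i)| : R) @^-1` [set t | t <= e / 2] by [].
  apply: within_preimage_compact; last exact: closed_le.
    apply: continuous_subspaceT; apply: continuous_sumr => i _ x.
    have a1 := @coord_cont R X (v i) x.
    have a2 : continuous (fun _ : realization R X => val x0 (v i) : R)
      by move=> z; exact: (@cst_continuous (realization R X) R).
    exact: (cvg_norm (cvgB a1 (a2 x))).
  exact: simplex_compact.
have chart_open x y : Q x -> disk R k y -> f x = m0 y -> open_disk R k y.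
  move=> Qx Dy E1; have [y' Oy' E2] := chartQ x Qx.
  have [//|Sy] := disk_split Dy.
  have := sphere_lower (g' := 1%g) Sy Oy'; rewrite ltnn => h.
  suff : false by []; apply: h.
  have : m0 y = m0 y' by rewrite -E1 -E2.
  move/(congr1 (gs_act E g0^-1%g)); rewrite /m0 -!lactM mulVg !lact1 //.
(* The graph of the chart; its compactness yields moduli of continuity in both directions. *)
pose Z : set (realization R X * 'rV[R]_k) := (Q `*` disk R k) `&`
  (fun z => (f z.1, m0 z.2)) @^-1` [set z : E * E | z.1 = z.2].
have cZ : compact Z.
  apply: within_preimage_compact; last exact: closed_diagonal (cell_hausdorff S).
    have c1 : {within Q `*` disk R k, continuous (f \o fst)}.
      by apply: continuous_subspaceT; apply: continuous_comp_maps => // z; exact: cvg_fst.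
    have c2 : {within Q `*` disk R k, continuous (m0 \o snd)}.
      apply: (@within_comp_maps _ _ _ _ (disk R k)).
      - by apply: continuous_subspaceT => z; exact: cvg_snd.
      - by move=> z [].
      - apply: within_comp; last exact: gs_continuous.
        exact: cell_continuous.
    by move=> z; exact: (cvg_pair (c1 z) (c2 z)).
  by apply: compact_setX => //; exact: disk_compact.
pose Fy (z : (realization R X * 'rV[R]_k) * (realization R X * 'rV[R]_k)) :=
  \sum_i `|z.1.2 ord0 i - z.2.2 ord0 i|.
pose Fx (z : (realization R X * 'rV[R]_k) * (realization R X * 'rV[R]_k)) :=
  \sum_i `|val z.1.1 (v i) - val z.2.1 (v i)|.
have fstc (A A' : topologicalType) : continuous (@fst A A') by move=> z; exact: cvg_fst.
have sndc (A A' : topologicalType) : continuous (@snd A A') by move=> z; exact: cvg_snd.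
have cFy : continuous Fy.
  apply: continuous_sumr => i _ z.
  have a1 : continuous (fun z : (realization R X * 'rV[R]_k) * (realization R X * 'rV[R]_k) => z.1.2 ord0 i).
    apply: (continuous_comp_maps (f := fun z => z.1.2) (g := fun y : 'rV[R]_k => y ord0 i)).
      exact: (continuous_comp_maps (fstc _ _) (sndc _ _)).
    by move=> y; exact: coord_continuous.
  have a2 : continuous (fun z : (realization R X * 'rV[R]_k) * (realization R X * 'rV[R]_k) => z.2.2 ord0 i).
    apply: (continuous_comp_maps (f := fun z => z.2.2) (g := fun y : 'rV[R]_k => y ord0 i)).
      exact: (continuous_comp_maps (sndc _ _) (sndc _ _)).
    by move=> y; exact: coord_continuous.
  exact: (cvg_norm (cvgB (a1 z) (a2 z))).
have cFx : continuous Fx.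
  apply: continuous_sumr => i _ z.
  have a1 : continuous (fun z : (realization R X * 'rV[R]_k) * (realization R X * 'rV[R]_k) => val z.1.1 (v i) : R).
    apply: (continuous_comp_maps (f := fun z => z.1.1) (g := fun x : realization R X => val x (v i) : R)).
      exact: (continuous_comp_maps (fstc _ _) (fstc _ _)).
    exact: coord_cont.
  have a2 : continuous (fun z : (realization R X * 'rV[R]_k) * (realization R X * 'rV[R]_k) => val z.2.1 (v i) : R).
    apply: (continuous_comp_maps (f := fun z => z.2.1) (g := fun x : realization R X => val x (v i) : R)).
      exact: (continuous_comp_maps (sndc _ _) (fstc _ _)).
    exact: coord_cont.
  exact: (cvg_norm (cvgB (a1 z) (a2 z))).
have Fy0 z : Fy z <= 0 -> z.1.2 = z.2.2.
  move=> h; apply/rowP => i; apply/eqP; rewrite -subr_eq0 -normr_le0.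
  by apply: le_trans h; rewrite /Fy (bigD1 i) //= lerDl sumr_ge0.
have Fx0 z : Z z.1 -> Z z.2 -> Fx z <= 0 -> z.1.1 = z.2.1.
  move=> [[[B1 _] _] _] [[[B2 _] _] _] h; apply: realization_eq => u.
  have [[i _ <-]|nu] := pselect (range v u); last by rewrite !Bout.
  apply/eqP; rewrite -subr_eq0 -normr_le0.
  exact: le_trans (coord_le (fun i => val z.1.1 (v i) - val z.2.1 (v i)) i) h.
pose K1 : R := r.+2%:R; have K1p : 2 <= K1 by rewrite ler_nat.
(* [t] moves [x0] towards the barycentre, making all coordinates at least [t / K1]; [eta] is the
   side of the cube placed there. The bounds keep the cube inside [Q] and its coordinates
   nonnegative. *)
have [t [t0 t1 tK]] : exists t, [/\ 0 < t, t <= 1 & K1 * t <= e / 8].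
  exists (Num.min 1 (e / 8 / K1)); have ep : 0 < e / 8 / K1 by apply: divr_gt0; lra.
  split; [by rewrite lt_min ltr01|by rewrite ge_min lexx|].
  by rewrite mulrC -ler_pdivlMr; [rewrite ge_min lexx orbT|lra].
have [eta [eta0 etaK etat]] : exists eta, [/\ 0 < eta, K1 * eta <= e / 8 & K1 * eta <= t / K1].
  exists (Num.min (e / 8 / K1) (t / K1 / K1)).
  have ep : 0 < e / 8 / K1 by apply: divr_gt0; lra.
  have tp : 0 < t / K1 / K1 by rewrite !divr_gt0 //; lra.
  split; first by rewrite lt_min ep.
    by rewrite mulrC -ler_pdivlMr; [rewrite ge_min lexx|lra].
  by rewrite mulrC -ler_pdivlMr; [rewrite ge_min lexx orbT|lra].
have eta2 : 0 < eta / 2 by lra.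
have [e1 e10 He1] : exists2 e1 : R, 0 < e1 & forall z, (Z `*` Z) z -> Fy z < e1 -> Fx z < eta / 2.
  apply: compact_modulus => //; [exact: compact_setX|exact: continuous_subspaceT|exact: continuous_subspaceT|].
  move=> z [Z1 Z2] /Fy0 E1; suff -> : Fx z = 0 by [].
  rewrite /Fx big1 // => i _; apply/eqP; rewrite normr_eq0 subr_eq0.
  suff -> : z.1.1 = z.2.1 by [].
  by apply: f_inj; case: Z1 => _ /= ->; case: Z2 => _ /= ->; rewrite E1.
pose k1 : R := k.+1%:R; have k1p : 1 <= k1 by rewrite ler1n.
(* Points whose values of [w] agree up to [k] differ by at most [k1 * delta] in each of the [k] disk
   coordinates, hence by less than [e1] in all. *)
pose delta := e1 / k1 / k1.
have d0 : 0 < delta by rewrite !divr_gt0 //; lra.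
have [e2 e20 He2] : exists2 e2 : R, 0 < e2 & forall z, (Z `*` Z) z -> Fx z < e2 -> Fy z < delta.
  apply: compact_modulus => //; [exact: compact_setX|exact: continuous_subspaceT|exact: continuous_subspaceT|].
  move=> z [Z1 Z2] /(Fx0 z Z1 Z2) E1; suff -> : Fy z = 0 by [].
  rewrite /Fy big1 // => i _; apply/eqP; rewrite normr_eq0 subr_eq0.
  suff -> : z.1.2 = z.2.2 by [].
  case: Z1 => -[Q1 D1] /= E2; case: Z2 => -[Q2 D2] /= E3.
  apply: (cell_map_inj (g := g0) (chart_open _ _ Q1 D1 E2) (chart_open _ _ Q2 D2 E3)).
  by rewrite -/(m0 _) -E2 -/(m0 _) -E3 E1.
(* Large enough for two grid steps to move the disk coordinates by less than [delta]; being at least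
   4, it also absorbs the margin of 2 in [no_thin_grid]. *)
pose N := (Num.truncn (4 * K1 * eta / e2)).+4.
have N4 : (4 <= N)%N by [].
have Np : 4 <= N%:R :> R by rewrite ler_nat.
have NE : 4 * K1 * eta / N%:R < e2.
  rewrite ltr_pdivrMr; last by lra.
  rewrite [e2 * _]mulrC -ltr_pdivrMr //.
  apply: lt_le_trans (truncnS_gt _) _; rewrite ler_nat /N.
  by move: (Num.truncn _) => c; clear; lia.
pose q (p : 'I_r.+1 -> nat) j : R := eta * (p j)%:R / N%:R.
pose a i := (1 - t) * val x0 (v i) + t / K1.
(* Coordinate [ord0] pays for the increase of the others, so the sum stays 1. *)
pose c (p : 'I_r.+1 -> nat) (i : 'I_r.+2) :=
  if unlift ord0 i is Some j then a i + q p j else a i - \sum_j q p j.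
have c0E p : c p ord0 = a ord0 - \sum_j q p j by rewrite /c unlift_none.
have c1E p j : c p (lift ord0 j) = a (lift ord0 j) + q p j by rewrite /c liftK.
have q0 p j : 0 <= q p j by rewrite /q !mulr_ge0 // ?invr_ge0 ?ler0n // ltW.
have qle p j : (p j <= N)%N -> q p j <= eta.
  move=> pN; rewrite /q -mulrA; apply: ler_piMr; first exact: ltW.
  rewrite ler_pdivrMr ?mul1r ?ler_nat //; lra.
have sum_le (F : 'I_r.+1 -> R) b : 0 <= b -> (forall j, F j <= b) -> \sum_j F j <= K1 * b.
  move=> b0 Fb; apply: (@le_trans _ _ (\sum_(j < r.+1) b)); first exact: ler_sum.
  rewrite sumr_const card_ord -[_ *+ _]mulr_natl ler_wpM2r // ler_nat //.
have K0 : 0 < K1 by lra.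
have tK0 : 0 < t / K1 by exact: divr_gt0.
have a_ge i : t / K1 <= a i.
  by rewrite /a lerDr mulr_ge0 ?coord_ge0 //; lra.
have sa : \sum_i a i = 1.
  rewrite /a big_split /= -mulr_sumr sum_vertices // sumr_const card_ord.
  rewrite -[_ *+ _]mulr_natl -/K1 mulrCA divff ?lt0r_neq0 //; lra.
have sc p : \sum_i c p i = 1.
  rewrite -sa big_ord_recl [in RHS]big_ord_recl c0E.
  rewrite [X in _ + X = _](eq_bigr (fun j => a (lift ord0 j) + q p j)) => [|j _]; last exact: c1E.
  by rewrite big_split /=; ring.
have c_ge p i : (forall j, p j <= N)%N -> 0 <= c p i.
  move=> pN; have [j ->|->] := unliftP ord0 i.
    by rewrite c1E addr_ge0 // ltW // (lt_le_trans tK0).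
  rewrite c0E subr_ge0 (le_trans _ (a_ge _)) // (le_trans _ etat) //.
  by apply: sum_le => [|j]; [exact: ltW|exact: qle].
have a_near : \sum_i `|a i - val x0 (v i)| <= e / 8.
  apply: le_trans tK; rewrite mulr_natl -[X in _ *+ X](card_ord r.+2) -sumr_const.
  apply: ler_sum => i _; have x1 := coord_le1 x0 (v i); have x00 := coord_ge0 x0 (v i).
  have K2 : 0 < K1^-1 <= 1 by rewrite invr_gt0 K0 invf_le1 //; lra.
  exact: blend_near.
have diff_le p p' : \sum_i `|c p i - c p' i| <= 2 * \sum_j `|q p j - q p' j|.
  rewrite big_ord_recl !c0E [X in _ + X <= _](eq_bigr (fun j => `|q p j - q p' j|)); last first.
    by move=> j _; rewrite /= !c1E; congr (`|_|); ring.
  rewrite (_ : a ord0 - _ - _ = \sum_j (q p' j - q p j)); last first.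
    by rewrite sumrB; ring.
  have h : `|\sum_j (q p' j - q p j)| <= \sum_j `|q p j - q p' j|.
    apply: le_trans (ler_norm_sum _ _ _) _; apply: ler_sum => j _.
    by rewrite distrC.
  by move: h; lra.
have /choice[z zP] p : exists z : realization R X * 'rV[R]_k,
    (forall j, p j <= N)%N -> Z z /\ forall i, val z.1 (v i) = c p i.
  have [pN|npN] := pselect (forall j, p j <= N)%N; last first.
    by exists (x0, 0) => pN.
  have cs : simplex [set u | exists2 i, 0 < c p i & v i = u].
    apply: (simplex_face sv) => [u [i _ <-]|]; first by exists i.
    have : \sum_i c p i != 0 by rewrite sc oner_eq0.
    rewrite psumr_neq0 => [/hasP[i _ /= ci]|i _]; last exact: c_ge.
    by exists (v i), i.
  have c_ge' i : 0 <= c p i by exact: c_ge.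
  pose x : realization R X := exist (fun h : X -> R => h \in @barycentric R X) _
    (mem_set (weight_barycentric c_ge' cs)).
  have xE i : val x (v i) = c p i.
    rewrite /= /weight_point sc divr1 (big_pred1 i) // => i'.
    by rewrite /= (inj_eq v_inj).
  have Bx : B x.
    move=> u /=; rewrite (weight_point_neq0 c_ge' cs) => /asboolP[i _ <-].
    by exists i.
  have Qx : Q x.
    split=> //=; have cp : \sum_i `|c p i - c (fun _ => 0%N) i| <= 2 * (K1 * eta).
      apply: le_trans (diff_le _ _) _; rewrite ler_pM2l //.
      apply: sum_le => [|j]; first exact: ltW.
      by rewrite {2}/q mulr0 mul0r subr0 ger0_norm // qle.
    have -> : \sum_i `|val x (v i) - val x0 (v i)| =
      \sum_i `|c p i - c (fun _ => 0%N) i + (a i - val x0 (v i))|.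
      apply: eq_bigr => i _; rewrite xE.
      suff -> : c (fun _ => 0%N) i = a i by rewrite addrA subrK.
      have qz j : q (fun _ => 0%N) j = 0 by rewrite /q mulr0 mul0r.
      have [j ->|->] := unliftP ord0 i; first by rewrite c1E qz addr0.
      by rewrite c0E big1 ?subr0.
    apply: le_trans (ler_sum _ (fun i _ => ler_normD _ _)) _.
    by rewrite big_split /=; move: cp etaK a_near e0; lra.
  have [y Oy yE] := chartQ x Qx.
  by exists (x, y) => _; split=> //; split=> //; split=> //; exact: ltW.
(* Disk coordinates are at least -1, so this is nonnegative and can be rounded down. *)
pose u p i := ((z p).2 ord0 i + 1) / delta.
have ubox p i : (forall j, p j <= N)%N -> 0 <= u p i.
  move=> /zP[[[_ Dy] _] _]; rewrite /u divr_ge0 ?(ltW d0) //.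
  exact: sqr_le1_ge (le_trans (sqnorm_coord _ i) Dy).
pose w p i := Num.truncn (u p i).
refine (@no_thin_grid r k N w isT (dim_le c0) _ _).
- move=> p p' pN pN' pp pp' i; have [Zp xp] := zP p pN; have [Zp' xp'] := zP p' pN'.
  have : Fy (z p, z p') < delta.
    apply: He2 => //; apply: le_lt_trans NE; rewrite /Fx /=.
    under eq_bigr do rewrite xp xp'.
    apply: le_trans (diff_le _ _) _.
    rewrite (_ : 4 * K1 * eta / N%:R = 2 * (K1 * (2 * (eta / N%:R)))); last by ring.
    rewrite ler_pM2l //; have eN : 0 <= eta / N%:R by rewrite divr_ge0 ?ler0n // ltW.
    apply: sum_le => [|j]; first by rewrite mulr_ge0.
    rewrite /q mulrAC [X in _ - X]mulrAC -mulrBr normrM ger0_norm // mulrC.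
    apply: ler_wpM2r => //.
    have := pp j; have := pp' j; rewrite -!(ler_nat R) !natrD => h1 h2.
    by rewrite ler_norml; lra.
  move=> Fd; rewrite /w truncn_le_nat.
  have h : (z p).2 ord0 i - (z p').2 ord0 i < delta.
    apply: le_lt_trans Fd; apply: le_trans (ler_norm _) _.
    by rewrite /Fy /= (bigD1 i) //= lerDl sumr_ge0.
  have : u p i < u p' i + 1.
    by rewrite /u -ltrBlDl -mulrBl ltr_pdivrMr // mul1r; lra.
  by have := truncnS_gt (u p' i); rewrite -(natr1 _.+1); lra.
- move=> p p' pN pN' ww ww' j; have [Zp xp] := zP p pN; have [Zp' xp'] := zP p' pN'.
  have udiff (s s' : 'I_r.+1 -> nat) i : (forall j, s j <= N)%N -> (forall j, s' j <= N)%N ->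
      (w s i <= w s' i + k)%N -> (z s).2 ord0 i - (z s').2 ord0 i <= k1 * delta.
    move=> sN sN'; rewrite -(ler_nat R) natrD => h.
    have h1 := truncnS_gt (u s i).
    have : (w s' i)%:R <= u s' i by rewrite truncn_le ubox.
    move: h h1; rewrite -[X in X < _](mulrK (unitf_gt0 d0)) -natr1 -/(w s i) => h h1 h2.
    have : u s i - u s' i <= k1 by rewrite /k1 -natr1; move: h h1 h2; rewrite mulrK ?unitf_gt0 //; lra.
    by rewrite /u -mulrBl ler_pdivrMr //; lra.
  have : Fx (z p, z p') < eta / 2.
    apply: He1 => //; rewrite /Fy /=.
    apply: (@le_lt_trans _ _ (\sum_(i < k) k1 * delta)).
      apply: ler_sum => i _; rewrite ler_norml.
      have := udiff p p' i pN pN' (ww i); have := udiff p' p i pN' pN (ww' i); lra.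
    rewrite sumr_const card_ord -[_ *+ _]mulr_natl /delta.
    have k1p' : 0 < k1 by exact: lt_le_trans k1p.
    rewrite [k1 * _]mulrC divfK ?gt_eqF // mulrCA gtr_pMr //.
    by rewrite ltr_pdivrMr // mul1r ltr_nat.
  move=> Fe; have : `|q p j - q p' j| < eta / 2.
    apply: le_lt_trans Fe; rewrite /Fx /=.
    have := coord_le (fun i => val (z p).1 (v i) - val (z p').1 (v i)) (lift ord0 j).
    by rewrite xp xp' !c1E opprD addrACA subrr add0r.
  rewrite ltr_norml => /andP[_]; rewrite /q -mulrBl -mulrBr.
  rewrite ltr_pdivrMr; last by lra.
  rewrite mulrAC -mulrA ltr_pM2l // => h.
  have {h} : (p j * 2 < N + p' j * 2)%N.
    by rewrite -(ltr_nat R) natrD !natrM; move: h; lra.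
  by move: N4; clear; lia.
Qed.

End Dimension.

Lemma simplex_card (R : realType) (gT : finGroupType) (E : gspace gT) (S : free_gcw R E)
    (r : nat) (X : gcomplex gT) : (forall c : cell S, (cell_dim c <= r)%N) ->
  triangulates R X E ->
  forall (s : set X) (A : {fset X}), simplex s -> [set` A] `<=` s -> (#|` A| <= r.+1)%N.
Proof.
move=> Sr [f [h [cf _ fK _ _]]] s A ss As; rewrite leqNgt; apply/negP => rA.
have /fset0Pn[a aA] : A != fset0 by rewrite -cardfs_gt0 (leq_ltn_trans _ rA).
pose v (i : 'I_r.+2) := nth a A i.
have vA i : v i \in A by apply: mem_nth; exact: leq_trans (ltn_ord i) rA.
have v_inj : injective v.
  move=> i j /eqP; rewrite nth_uniq ?fset_uniq //; first by move/eqP/val_inj.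
    exact: leq_trans (ltn_ord i) rA.
  exact: leq_trans (ltn_ord j) rA.
apply: (no_large_simplex (f := f) (v := v) cf (can_inj fK) v_inj _ Sr).
apply: (simplex_face ss) => [u [i _ <-]|]; first exact/As/vA.
by exists (v ord0), ord0.
Qed.

(** * Joins of copies of the group *)

Section FiniteMax.
Variables (R : realType) (k : nat).

Definition max_value (g : 'I_k.+1 -> R) : R := \big[Num.max/g ord0]_i g i.

Lemma max_value_ge g i : g i <= max_value g.
Proof. exact: le_bigmax. Qed.

Lemma max_value_attained g : exists i, max_value g = g i.
Proof.
apply: contrapT => none; have lt i : g i < max_value g.
  rewrite lt_neqAle max_value_ge andbT; apply/eqP => E; apply: none.
  by exists i.
have : max_value g < max_value g by apply: bigmax_lt => // i _; exact: lt.
by rewrite ltxx.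
Qed.

Lemma max_value_cont (X : topologicalType) (g : 'I_k.+1 -> X -> R) :
  (forall i, continuous (g i)) -> continuous (fun x => max_value (g^~ x)).
Proof.
move=> cg; rewrite /max_value; elim: (index_enum _) => [|i s IH].
  by under eq_fun do rewrite big_nil; exact: cg.
under eq_fun do rewrite big_cons.
move=> x; apply: (@continuous_max R X (g i) (fun x => \big[Num.max/g ord0 x]_(j <- s) g j x)).
  exact: cg.
exact: IH.
Qed.

End FiniteMax.

Lemma continuous_row (R : realType) (X : topologicalType) n (F : X -> 'rV[R]_n) :
  (forall j, continuous (fun x => F x ord0 j)) -> continuous F.
Proof.
move=> cF x; apply/cvg_ballP => e e0.
have : \forall y \near x, forall j, ball (F x ord0 j) e (F y ord0 j).
  by apply: filter_forall => j; have /cvg_ballP := cF j x; apply.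
by apply: filterS => y hy; split=> // i j; rewrite (ord1 i); exact: hy.
Qed.

(** * Extension of maps from the boundary of a simplex *)

Section SimplexExtension.
Variables (R : realType) (r k : nat) (K : simplicial_complex) (v : 'I_k.+1 -> K).
Variable Y : topologicalType.
Hypothesis v_inj : injective v.
Hypothesis sv : simplex (range v).
Hypothesis kr : (k <= r)%N.
Hypothesis cY : pred_connected R r Y.
Local Notation D := (@in_simplex R K (range v)).
Local Notation O := [set x : realization R K | supp x = range v].

(** Coordinates on the hyperplane of sum zero, one for each vertex. *)
Let ell (y : 'rV[R]_k) (i : 'I_k.+1) : R :=
  if unlift ord0 i is Some j then y ord0 j else - \sum_j y ord0 j.

Let ell0 y : ell y ord0 = - \sum_j y ord0 j.
Proof. by rewrite /ell unlift_none. Qed.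

Let ellS y j : ell y (lift ord0 j) = y ord0 j.
Proof. by rewrite /ell liftK. Qed.

Let sum_ell y : \sum_i ell y i = 0.
Proof.
rewrite big_ord_recl ell0 [X in _ + X = _](eq_bigr (fun j => y ord0 j)) ?addNr //.
Qed.

Let ell_cont i : continuous (fun y => ell y i).
Proof.
have cy j : continuous (fun y : 'rV[R]_k => y ord0 j : R).
  by move=> y; exact: coord_continuous.
have [j ->|->] := unliftP ord0 i; first by under eq_fun do rewrite ellS; exact: cy.
under eq_fun do rewrite ell0.
have cs := continuous_sumr (P := xpredT) (r := index_enum 'I_k) (fun j _ => cy j).
by move=> y; exact: (cvgN (cs y)).
Qed.

(** Subtracting the least coordinate moves a vector to the boundary of the positive cone;
    normalised, it is a boundary point of the simplex. *)
Let w (i : 'I_k.+1) (y : 'rV[R]_k) : R := ell y i + max_value (fun i => - ell y i).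

Let w_ge0 i y : 0 <= w i y.
Proof. by rewrite /w -lerBlDl sub0r; exact: (max_value_ge (fun i => - ell y i)). Qed.

Let w_zero y : exists i, w i y = 0.
Proof.
have [i E] := max_value_attained (fun i => - ell y i).
by exists i; rewrite /w E subrr.
Qed.

Let w_pos y : sphere R k y -> exists i, 0 < w i y.
Proof.
move=> Sy; apply: contrapT => none.
have w0 i : w i y = 0.
  apply/eqP; rewrite eq_le w_ge0 andbT leNgt; apply/negP => h.
  by apply: none; exists i.
have : \sum_i w i y = 0 by rewrite big1.
rewrite /w big_split /= sum_ell add0r sumr_const card_ord => /eqP.
rewrite mulrn_eq0 /= => /eqP M0.
have y0 j : y ord0 j = 0 by have := w0 (lift ord0 j); rewrite /w M0 addr0 ellS.
have : sqnorm y = 0 by rewrite /sqnorm big1 // => j _; rewrite y0 expr0n.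
by rewrite Sy; apply/eqP; rewrite oner_eq0.
Qed.

Let w_cont i : continuous (w i).
Proof.
have c2 : continuous (fun y => max_value (fun i => - ell y i)).
  apply: (max_value_cont (g := fun i y => - ell y i)) => j y.
  by have h := @ell_cont j y; exact: (cvgN h).
by move=> y; have h := @ell_cont i y; exact: (cvgD h (c2 y)).
Qed.

Let kap : R := k.+1%:R^-1.

Let kapE : kap *+ k = 1 - kap.
Proof.
apply/eqP; rewrite eq_sym subr_eq -mulrSr /kap -[_ *+ _]mulr_natl divff //.
Qed.

Let u (x : realization R K) : 'rV[R]_k := \row_j (val x (v (lift ord0 j)) - kap).

(** On the simplex, the product of all barycentric coordinates: zero on the boundary but not at the
    barycentre, where [u] vanishes. So the denominator in [b] is never zero, and on the boundary it
    is [nrm]. *)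
Let t (x : realization R K) : R := `|(\prod_(j < k) val x (v (lift ord0 j))) *
  (1 - \sum_(j < k) val x (v (lift ord0 j)))|.

Let nrm x := Num.sqrt (sqnorm (u x)).

Let sqnormZ (a : R) (x : 'rV[R]_k) : sqnorm (a *: x) = a ^+ 2 * sqnorm x.
Proof. by rewrite /sqnorm mulr_sumr; apply: eq_bigr => i _; rewrite mxE exprMn. Qed.

Let den_gt0 x : 0 < nrm x + t x.
Proof.
rewrite lt_neqAle addr_ge0 ?sqrtr_ge0 ?normr_ge0 // andbT eq_sym.
rewrite paddr_eq0 ?sqrtr_ge0 ?normr_ge0 // sqrtr_eq0 normr_eq0; apply/negP => /andP[u0].
have xk j : val x (v (lift ord0 j)) = kap.
  apply/eqP; rewrite -subr_eq0 -sqrf_eq0 eq_le sqr_ge0 andbT (le_trans _ u0) //.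
  by have := sqnorm_coord (u x) j; rewrite mxE.
rewrite (eq_bigr (fun=> kap)) => [|j _]; last exact: xk.
rewrite [X in 1 - X](eq_bigr (fun=> kap)) => [|j _]; last exact: xk.
rewrite sumr_const prodr_const card_ord kapE subKr mulf_eq0 expf_eq0.
by rewrite /kap invr_eq0 pnatr_eq0 andbF.
Qed.

Let b x : 'rV[R]_k := (nrm x + t x)^-1 *: u x.

Let b_cont : continuous b.
Proof.
have cv i : continuous (fun x : realization R K => val x (v i) : R) by exact: coord_cont.
have cst (a : R) : continuous (fun _ : realization R K => a).
  by move=> z; exact: (@cst_continuous (realization R K) R).
have cu j : continuous (fun x => u x ord0 j).
  have -> : (fun x => u x ord0 j) = (fun x => val x (v (lift ord0 j)) - kap).
    by apply/funext => x; rewrite mxE.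
  by move=> x; exact: (cvgB (cv (lift ord0 j) x) (cst kap x)).
have cn : continuous nrm.
  apply: (@continuous_comp_maps _ _ _ u (fun y => Num.sqrt (sqnorm y))).
    exact: continuous_row.
  by move=> y; apply: continuous_comp; [exact: sqnorm_cont|exact: sqrt_continuous].
have ct : continuous t.
  have c1 := continuous_prodr (P := xpredT) (r := index_enum 'I_k) (fun j _ => cv (lift ord0 j)).
  have c2 := continuous_sumr (P := xpredT) (r := index_enum 'I_k) (fun j _ => cv (lift ord0 j)).
  by move=> x; exact: (cvg_norm (cvgM (c1 x) (cvgB (cst 1 x) (c2 x)))).
apply: continuous_row => j.
have -> : (fun x => b x ord0 j) = (fun x => (nrm x + t x)^-1 * u x ord0 j).
  by apply/funext => x; rewrite mxE.
move=> x.
have a1 : (fun x => nrm x + t x : R) @ x --> (nrm x + t x : R) by exact: (cvgD (cn x) (ct x)).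
have n0 : nrm x + t x != 0 by rewrite gt_eqF // den_gt0.
have a2 : (fun x => (nrm x + t x)^-1 : R) @ x --> ((nrm x + t x)^-1 : R) by exact: (cvgV n0 a1).
exact: (cvgM a2 (cu j x)).
Qed.

Let nrm2 x : sqnorm (u x) = nrm x ^+ 2.
Proof. by rewrite sqr_sqrtr // sqnorm_ge0. Qed.

Let b_disk x : disk R k (b x).
Proof.
rewrite /disk /= /b sqnormZ nrm2 -exprMn expr_le1 //; last first.
  by rewrite mulr_ge0 ?invr_ge0 ?(ltW (den_gt0 x)) ?sqrtr_ge0.
by rewrite mulrC ler_pdivrMr ?den_gt0 // mul1r lerDl normr_ge0.
Qed.

Let boundary_vertex x : (D `\` O) x -> exists i, val x (v i) = 0.
Proof.
move=> [Dx nO]; apply: contrapT => none; apply: nO; apply/seteqP; split=> // _ [i _ <-].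
by apply/eqP => xi; apply: none; exists i.
Qed.

Let t_boundary x : (D `\` O) x -> t x = 0.
Proof.
move=> Bx; have [i xi] := boundary_vertex Bx; have [Dx _] := Bx.
have := sum_vertices v_inj Dx; rewrite big_ord_recl => s1.
apply/eqP; rewrite normr_eq0 mulf_eq0; have [j ij|i0] := unliftP ord0 i.
  by rewrite (bigD1 j) //= -ij xi !mul0r eqxx.
by apply/orP; right; rewrite -s1 -i0 xi add0r subrr.
Qed.

Let b_sphere x : (D `\` O) x -> sphere R k (b x).
Proof.
move=> Bx; have := den_gt0 x; rewrite /sphere /= /b sqnormZ nrm2 t_boundary // addr0 => n0.
by rewrite -exprMn mulVf ?expr1n // gt_eqF.
Qed.

Let ell_b x i : (D `\` O) x -> ell (b x) i = (val x (v i) - kap) / nrm x.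
Proof.
move=> Bx; have bE j : b x ord0 j = (val x (v (lift ord0 j)) - kap) / nrm x.
  by rewrite !mxE t_boundary // addr0 mulrC.
have [j ->|->] := unliftP ord0 i; first by rewrite ellS bE.
rewrite ell0 (eq_bigr _ (fun j _ => bE j)) -mulr_suml sumrB sumr_const card_ord kapE.
have := sum_vertices v_inj Bx.1; rewrite big_ord_recl => s1.
by rewrite -mulNr; congr (_ / _); move: s1; set A := \sum_i _; lra.
Qed.

Let w_b x i : (D `\` O) x -> w i (b x) = val x (v i) / nrm x.
Proof.
move=> Bx; have n0 : 0 < nrm x by have := den_gt0 x; rewrite t_boundary // addr0.
suff M : max_value (fun i => - ell (b x) i) = kap / nrm x.
  by rewrite /w M ell_b // -mulrDl subrK.
apply/eqP; rewrite eq_le; apply/andP; split.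
  have [j ->] := max_value_attained (fun i => - ell (b x) i).
  by rewrite ell_b // -mulNr opprB ler_pM2r ?invr_gt0 // gerBl coord_ge0.
have [j xj] := boundary_vertex Bx.
apply: le_trans (max_value_ge (fun i => - ell (b x) i) j).
by rewrite ell_b // xj sub0r mulNr opprK.
Qed.

(** A homeomorphism with the disk is avoided: [rho] maps the sphere to the boundary, [b] maps the
    simplex to the disk, and [rho] after [b] is the identity on the boundary. Extend [f \o rho] over
    the disk and compose with [b]. *)
Lemma simplex_extension (f : realization R K -> Y) :
  {within D `\` O, continuous f} ->
  exists2 h : realization R K -> Y, {within D, continuous h} & {in D `\` O, h =1 f}.
Proof.
move=> cf; have [x0 _] := vertex_point R (v ord0).
have ws y : sphere R k y -> simplex [set z | exists2 i, 0 < w i y & v i = z].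
  move=> Sy; have [i wi] := w_pos Sy; apply: (simplex_face sv); last by exists (v i), i.
  by move=> _ [j _ <-]; exists j.
have [rho [crho rhoE]] := weight_map (D := sphere R k) (Phi := v) (w := w) x0
  (fun i x _ => w_ge0 i x) ws (fun i => continuous_subspaceT (@w_cont i)).
have rhoB y : sphere R k y -> (D `\` O) (rho y).
  move=> Sy; have sP z : supp (rho y) z <-> exists2 i, 0 < w i y & v i = z.
    exact: (@weight_map_supp R K _ v (w^~ y) (rho y) z (fun i => w_ge0 i y) (ws y Sy) (rhoE y Sy)).
  split; first by move=> z /(sP z) [i _ <-]; exists i.
  move=> E; have [i wi] := w_zero y.
  have /(sP (v i)) [j wj /v_inj ji] : supp (rho y) (v i) by rewrite E; exists i.
  by rewrite ji wi ltxx in wj.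
have rhob x : (D `\` O) x -> rho (b x) = x.
  move=> Bx; have n0 : 0 < nrm x by have := den_gt0 x; rewrite t_boundary // addr0.
  apply: realization_eq => z; rewrite (rhoE _ (b_sphere Bx)) /weight_point.
  have -> : \sum_i w i (b x) = (nrm x)^-1.
    rewrite (eq_bigr _ (fun i _ => w_b i Bx)) -mulr_suml sum_vertices ?mul1r //.
    by case: Bx.
  have [[i _ <-]|nz] := pselect (range v z).
    rewrite (big_pred1 i) => [|j]; last by rewrite /= (inj_eq v_inj).
    by rewrite w_b // invrK mulfVK // gt_eqF.
  rewrite big_pred0 => [|j]; last by apply/eqP => vj; apply: nz; exists j.
  rewrite mul0r; apply/esym; apply: contrapT => /eqP xz; apply: nz.
  by case: Bx => Dx _; exact: Dx.
have [H cH HE] := sphere_extension (f := f \o rho) kr cY (within_comp_maps crho rhoB cf).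
exists (H \o b).
  apply: (within_comp_maps (D := disk R k)) => //.
  by apply: continuous_subspaceT; exact: b_cont.
move=> x /set_mem Bx; rewrite /= HE; last exact/mem_set/b_sphere.
by rewrite /= rhob.
Qed.

End SimplexExtension.

(** * The join as a free complex, and its map to [E] *)

Section FreeJoin.
Variables (R : realType) (gT : finGroupType) (r : nat).
Local Notation V := ('I_r.+1 * gT)%type.

Definition join_simplex : set (set V) := [set A | A !=set0 /\
  forall x y, A x -> A y -> x.1 = y.1 -> x = y].

Lemma join_simplex_finite A : join_simplex A -> finite_set A.
Proof. by move=> _; exact: finite_finset. Qed.

Lemma join_simplex_neq0 A : join_simplex A -> A !=set0.
Proof. by case. Qed.

Lemma join_simplex_vertex x : join_simplex [set x].
Proof. by split; [exists x|move=> y z -> ->]. Qed.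

Lemma join_simplex_face A B : join_simplex A -> B `<=` A -> B !=set0 -> join_simplex B.
Proof. by move=> [_ iA] BA B0; split=> // x y /BA Ax /BA Ay; exact: iA. Qed.

Definition join_complex : simplicial_complex := SimplicialComplex
  join_simplex_finite join_simplex_neq0 join_simplex_vertex join_simplex_face.

Definition join_act g (x : join_complex) : join_complex := (x.1, g * x.2)%g.

Lemma join_act1 x : join_act 1%g x = x.
Proof. by case: x => i h; rewrite /join_act mul1g. Qed.

Lemma join_actM g h x : join_act (g * h)%g x = join_act g (join_act h x).
Proof. by rewrite /join_act mulgA. Qed.

Lemma join_act_simplex g (A : set join_complex) : simplex A -> simplex (join_act g @` A).
Proof.
move=> [[x Ax] iA]; split; first by exists (join_act g x), x.
by move=> _ _ [y Ay <-] [z Az <-] /= yz; rewrite (iA y z).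
Qed.

Definition free_join : gcomplex gT := @GComplex gT join_complex
  (LeftAction join_act1 join_actM) join_act_simplex.

Lemma join_act_inj g : injective (join_act g).
Proof. by move=> [i h] [j h'] [-> /mulgI ->]. Qed.

(* One simplex in each orbit: its vertex of least index carries the unit. *)
Definition normal_simplex (A : {set V}) := `[< join_simplex [set` A] /\
  exists i, (i, 1%g) \in A /\ forall y, y \in A -> (i <= y.1)%N >].

Local Notation cell := {A : {set V} | normal_simplex A}.

(** Translate by the inverse of the group element at the least index. *)
Lemma join_normal (A : set free_join) : join_simplex A ->
  exists g (c : cell), A = join_act g @` [set` val c].
Proof.
move=> [[x Ax] iA].
have exP : exists n, `[< exists y, A y /\ y.1 = n :> nat >] by exists x.1; apply/asboolP; exists x.
case: (ex_minnP exP) => n /asboolP[[i g] [Ay /= yn]] nmin.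
pose B : {set V} := finset.finset (fun y => `[< A (join_act g y) >]).
have BE y : (y \in B) = `[< A (join_act g y) >] by rewrite finset.in_set.
have NB : normal_simplex B.
  apply/asboolP; split; last first.
    exists i; split; first by rewrite BE /join_act /= mulg1; apply/asboolP.
    move=> y; rewrite BE => /asboolP Agy; rewrite yn; apply: nmin; apply/asboolP.
    by exists (join_act g y).
  split; first by exists (i, 1%g); rewrite /= BE /join_act /= mulg1; apply/asboolP.
  move=> y z; rewrite /= !BE => /asboolP Ay' /asboolP Az yz.
  by apply: (@join_act_inj g); apply: iA.
exists g, (exist (fun A => normal_simplex A) B NB); apply/seteqP; split => [y Ay'|_ [y + <-]] /=.
  have E : join_act g (join_act g^-1%g y) = y by rewrite -join_actM mulgV join_act1.
  by exists (join_act g^-1%g y) => //=; rewrite BE E; apply/asboolP.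
by move=> yB; have := (yB : y \in B); rewrite BE => /asboolP.
Qed.

Lemma join_normal_inj g (c : cell) g' (c' : cell) :
  join_act g @` [set` val c] = join_act g' @` [set` val c'] -> g = g' /\ c = c'.
Proof.
move=> E; have /asboolP[_ [i [ic imin]]] := valP c.
have /asboolP[[_ inj'] [i' [ic' imin']]] := valP c'.
have [y yc' yE] : (join_act g' @` [set` val c']) (join_act g (i, 1%g)).
  by rewrite -E; exists (i, 1%g).
have [z zc zE] : (join_act g @` [set` val c]) (join_act g' (i', 1%g)).
  by rewrite E; exists (i', 1%g).
have ii : i' = i.
  apply: val_inj; apply/eqP; rewrite eqn_leq.
  have := imin' y yc'; have := imin z zc.
  have -> : z.1 = i' by exact: (congr1 fst zE).
  have -> : y.1 = i by exact: (congr1 fst yE).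
  by move=> -> ->.
have gg : g = g'.
  have yi : y = (i', 1%g).
    by apply: inj' => //=; rewrite (congr1 fst yE : y.1 = i).
  by have := congr1 snd yE; rewrite yi /= !mulg1.
split=> //; apply: val_inj; apply/setP => x; subst g'.
have H (A B : {set V}) : join_act g @` [set` A] = join_act g @` [set` B] -> x \in A -> x \in B.
  move=> AB xA; have [w wB /join_act_inj <-//] : (join_act g @` [set` B]) (join_act g x).
  by rewrite -AB; exists x.
by apply/idP/idP; apply: H.
Qed.

Lemma supp_act (K : gcomplex gT) g (x : realization R K) :
  supp (gs_act (realization_gspace R K) g x) = gc_act K g @` supp x.
Proof. exact: gc_act_support. Qed.

Lemma join_supp_normal (x : realization R free_join) :
  exists g (c : cell) (y : realization R free_join), supp y = [set` val c] /\
    x = gs_act (realization_gspace R free_join) g y.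
Proof.
have [g [c gc]] := join_normal (supp_simplex x).
exists g, c, (gs_act (realization_gspace R free_join) g^-1%g x); split.
  rewrite supp_act gc image_comp (_ : _ \o _ = id) ?image_id //.
  by apply/funext => y /=; rewrite -join_actM mulVg join_act1.
by rewrite -lactM mulgV lact1.
Qed.

(** The normal simplices serve as cells in [cellular_extension], with identity maps as
    characteristic maps and [simplex_extension] for the extension property. *)
Lemma join_map (E : gspace gT) : pred_connected R r E ->
  equivariant_map (realization_gspace R free_join) E.
Proof.
move=> cE; pose EJ := realization_gspace R free_join.
pose D (c : cell) : set EJ := @in_simplex R free_join [set` val c].
pose O (c : cell) : set EJ := [set x : realization R free_join | supp x = [set` val c]].
have sc (c : cell) : @simplex free_join [set` val c].
  by have /asboolP[] := valP c.
have c0 (c : cell) : (0 < #|val c|)%N.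
  by have [[x xc] _] := sc c; apply/card_gt0P; exists x.
have c_le (c : cell) : (#|val c| <= r.+1)%N.
  have [_ ic] := sc c.
  have e : #|[set x.1 | x in val c]%SET| = #|val c|.
    by apply: card_in_imset => x y xc yc; exact: ic.
  by have := max_card (mem [set x.1 | x in val c]%SET); rewrite e card_ord.
have cD (c : cell) : compact (D c) by apply: simplex_compact; exact: sc.
pose dim (c : cell) := #|val c|.-1.
apply: (@cellular_extension gT EJ cell dim (fun=> EJ) D O (fun=> id) _ _ cD _ _ _ _ _ E r).
- exact: realization_hausdorff.
- by move=> c; exact: realization_hausdorff.
(* The boundary of a simplex is the finite union of its parts where one coordinate vanishes. *)
- move=> c; rewrite (_ : D c `\` O c = \bigcup_(v in [set` val c])
    (D c `&` (fun x : realization R free_join => val x v : R) @^-1` [set 0])).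
    apply: bigcup_compact; first exact: finite_finset.
    move=> v _; apply: within_preimage_compact.
    - by apply: continuous_subspaceT; exact: coord_cont.
    - exact: cD.
    - exact: (compact_closed (@Rhausdorff R) (@compact_set1 R 0)).
  apply/seteqP; split=> [x [Dx nO]|x [v vc [Dx xv]]].
    apply: contrapT => none; apply: nO; apply/seteqP; split=> // v vc.
    by apply/eqP => xv; apply: none; exists v.
  split=> // Ox; move: vc; rewrite -Ox /supp /= => /eqP; exact.
- by move=> c; apply: continuous_subspaceT => x; exact: cvg_id.
- move=> x; have [g [c [y [yc xy]]]] := join_supp_normal x.
  by exists g, (existT (fun=> EJ) c y).
- move=> g c y g' c' y' Oy Oy' E1.
  have := congr1 (@supp R free_join) E1; rewrite !supp_act Oy Oy' => /join_normal_inj[gg cc].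
  subst g' c'; split=> //; congr existT.
  by have := congr1 (gs_act EJ g^-1%g) E1; rewrite -!lactM mulVg !lact1.
- move=> c; exists [set p : gT * cell | (dim p.2 < dim c)%N]; first exact: finite_finset.
  split=> // _ [x [Dx nO] <-].
  have [g [c' [y [yc xy]]]] := join_supp_normal x.
  exists (g, c'); last by exists y => //; exists y => //; rewrite /D /in_simplex /= -/(supp y) yc.
  rewrite /= /dim -ltnS !prednK //.
  rewrite -(card_imset _ (@join_act_inj g)); apply: proper_card.
  have xE : supp x = join_act g @` [set` val c'] by rewrite xy supp_act yc.
  have sub : supp x `<=` [set` val c] by [].
  rewrite finset.properEneq; apply/andP; split.
    apply/eqP => Ec; apply: nO; rewrite /O /= xE -Ec; apply/seteqP; split => z.
      by move=> [w wc <-]; exact: (imset_f _ wc).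
    by move=> /imsetP[w wc ->]; exists w.
  apply/fintype.subsetP => z /imsetP[w wc ->]; apply: sub; rewrite xE.
  by exists w.
- by move=> c; rewrite /dim -ltnS prednK.
- move=> A cA; apply: compact_closed; first exact: realization_hausdorff.
  rewrite (_ : A = \bigcup_(p in [set: gT * cell]) gs_act EJ p.1 @`
      (D p.2 `&` [set x | A (gs_act EJ p.1 x)])).
    apply: bigcup_compact; first exact: finite_finset.
    move=> p _; apply: continuous_compact; last exact: cA.
    by apply: continuous_subspaceT; exact: gs_continuous.
  apply/seteqP; split => [x Ax|_ [p _ [x [_ Ax] <-]]//].
  have [g [c [y [yc xy]]]] := join_supp_normal x.
  exists (g, c) => //; exists y; last by rewrite xy.
  split; first by rewrite /D /in_simplex /= -/(supp y) yc.
  by move: Ax; rewrite xy.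
- by case: cE.
- move=> c f cf; have e : (#|val c|.-1).+1 = #|val c| by rewrite prednK.
  pose v (i : 'I_(#|val c|.-1).+1) : free_join := enum_val (cast_ord e i).
  have v_inj : injective v by move=> i j /enum_val_inj/cast_ord_inj.
  have vE : range v = [set` val c].
    apply/seteqP; split => [_ [i _ <-]|x xc]; first exact: enum_valP.
    exists (cast_ord (esym e) (enum_rank_in xc x)) => //.
    by rewrite /v cast_ordKV enum_rankK_in.
  have sv : @simplex free_join (range v) by rewrite vE.
  have kr : (#|val c|.-1 <= r)%N by rewrite -ltnS prednK.
  by have := simplex_extension v_inj sv kr cE (f := f); rewrite vE; apply.
Qed.

End FreeJoin.

(** * Small simplices *)

Lemma vertex_point_val (R : realType) (K : simplicial_complex) (x : realization R K) v :
  supp x = [set v] -> val x v = 1.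
Proof.
move=> xv; have := @sum_coord R K [fset v]%fset x; rewrite big_seq_fset1; apply.
by rewrite xv => _ ->; rewrite /= inE.
Qed.

Lemma supp1_eq (R : realType) (K : simplicial_complex) (x y : realization R K) v :
  supp x = [set v] -> supp y = [set v] -> x = y.
Proof.
move=> xv yv; apply: realization_eq => u.
have [->|uv] := eqVneq u v; first by rewrite (vertex_point_val xv) (vertex_point_val yv).
have out (z : realization R K) : supp z = [set v] -> val z u = 0.
  move=> zv; apply: contrapT => /eqP zu; have : supp z u by [].
  by rewrite zv => E; move: uv; rewrite E eqxx.
by rewrite !out.
Qed.

(** Adjacent grid vertices differ by at most 1 in a coordinate and by at most [rho] in the
    coordinate sum, which is at least [M]; so their projections approach each other as [M] grows. *)
Lemma quotient_near (R : realFieldType) (a a' m m' M rho : R) : 0 < M -> 0 <= a -> a <= m ->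
  a <= a' -> a' <= a + 1 -> M <= m -> m <= m' -> m' <= m + rho ->
  `|a / m - a' / m'| <= (1 + rho) / M.
Proof.
move=> M0 a0 am aa aa1 Mm mm mr.
have m0 : 0 < m by exact: lt_le_trans Mm.
have m0' : 0 < m' by exact: lt_le_trans mm.
have rho0 : 0 <= rho by lra.
have iM : m'^-1 <= M^-1 by rewrite lef_pV2 ?posrE // (le_trans Mm).
have i0 : 0 <= m'^-1 by rewrite invr_ge0 ltW.
have am1 : 0 <= a / m <= 1.
  by rewrite divr_ge0 ?(ltW m0) //= ler_pdivrMr ?mul1r.
have X1 : 0 <= (m' - m) / m' <= rho / M.
  by rewrite mulr_ge0 ?subr_ge0 //= ler_pM ?subr_ge0 //; lra.
have X2 : 0 <= (a' - a) / m' <= 1 / M.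
  by rewrite mulr_ge0 ?subr_ge0 //= ler_pM ?subr_ge0 //; lra.
have -> : a / m - a' / m' = a / m * ((m' - m) / m') - (a' - a) / m'.
  by field; rewrite !gt_eqF.
have X3 : 0 <= a / m * ((m' - m) / m') <= rho / M.
  case/andP: am1 => u0 u1; case/andP: X1 => v0 v1; rewrite mulr_ge0 //=.
  by apply: le_trans v1; exact: ler_piMl.
rewrite [leRHS]mulrDl; move: X2 X3; set u := (a' - a) / m'; set w := a / m * _.
move=> /andP[u0 u1] /andP[w0 w1].
have r0 : 0 <= rho / M by rewrite divr_ge0 // ltW.
have r1 : 0 <= 1 / M by rewrite divr_ge0 // ltW.
move: r0 r1 u0 u1 w0 w1; move: (rho / M) (1 / M) u w => p1 p2 u w *.
by rewrite ler_norml; apply/andP; split; lra.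
Qed.

(** * From (i) to (ii) *)

Section StatementItoII.
Variables (R : realType) (gT : finGroupType) (T : graph) (to : graph_action gT T).
Variables (r s : nat) (E : gspace gT).
Hypothesis s1 : (1 <= s)%N.
Hypothesis isE : is_E R r E.
Hypothesis tri : triangulable R E.
Local Notation H := (hom_gcomplex to (complete_graph s.-1)).
Local Notation J := (free_join gT r).

(** A vertex of the barycentric subdivision, being a simplex of [X], goes to its dimension paired
    with an equivariantly chosen group element. Members of a chain have distinct dimensions, at most
    [r], so chains go to simplices. *)
Lemma grid_to_join : exists K : gcomplex gT, triangulates R K E /\
  exists2 lam : K -> J, forall A, simplex A -> simplex (lam @` A) &
    forall g n, lam (gc_act K g n) = gc_act J g (lam n).
Proof.
have [_ [S [Sr _]]] := isE; have [X tX] := tri.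
exists (grid X 1); split; first exact: grid_triangulates.
have fX := triangulates_free tX (gcw_free S).
pose L := @LeftAction gT gT (@mulg gT) (@mul1g gT) (fun g h x => esym (mulgA g h x)).
have [gam gamE _] := equivariant_choice (a := gc_act (grid X 1)) (b := L)
  (P := fun _ _ => True) (fun g n => @grid_vertex_free R gT X 1 isT fX n g)
  (fun _ _ _ _ => I) (fun _ => ex_intro _ 1%g I).
pose c (n : grid X 1) := #|` fset_set (nsupp (val n))|.
have nP (n : grid X 1) : simplex (nsupp (val n)) /\ forall v, (val n v <= 1)%N.
  by have [] := set_valP n.
have fin (n : grid X 1) : finite_set (nsupp (val n)) by exact: simplex_finite (nP n).1.
have inn (n : grid X 1) v : (v \in fset_set (nsupp (val n))) = (val n v != 0%N).
  by rewrite in_fset_set //; apply/idP/idP => [/set_mem|h]; [|apply/mem_set].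
have c0 n : (0 < c n)%N.
  have [v nv] := simplex_neq0 (nP n).1; rewrite cardfs_gt0; apply/fset0Pn.
  by exists v; rewrite inn.
have cr n : (c n <= r.+1)%N.
  apply: (simplex_card Sr tX (nP n).1) => v /=.
  by rewrite inn.
have cE g n : c (gc_act (grid X 1) g n) = c n.
  have E1 : nsupp (val (gc_act (grid X 1) g n)) = gc_act X g @` nsupp (val n).
    exact: nsupp_shift.
  rewrite /c E1 fset_set_image // card_imfset //.
  exact: can_inj (gc_actK g).
pose lam n : J := (inord (c n).-1 : 'I_r.+1, gam n).
exists lam => [A sA|g n]; last by rewrite /lam cE gamE.
  have [fA [x0 Ax0] chA] := sA; split; first by exists (lam x0), x0.
  have key (x y : grid X 1) : near_above (val x) (val y) -> c x = c y -> x = y.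
    move=> xy cxy; have /eqP fxy : fset_set (nsupp (val x)) == fset_set (nsupp (val y)).
      rewrite eqEfcard -/(c y) -/(c x) cxy leqnn andbT; apply/fsubsetP => v.
      by rewrite !inn; have := xy v; lia.
    apply: val_inj; apply/funext => v; have := inn x v; rewrite fxy inn.
    by have := (nP x).2 v; have := (nP y).2 v; have := xy v; lia.
  move=> _ _ [x Ax <-] [y Ay <-] /= /(congr1 val) /=.
  have lt n : ((c n).-1 < r.+1)%N by rewrite prednK.
  rewrite !inordK // => cxy.
  have {}cxy : c x = c y by rewrite -(prednK (c0 x)) cxy prednK.
  suff -> : x = y by [].
  by have [h|h] := chA x y Ax Ay; [exact: key|apply/esym/key].
Qed.

Lemma statement_i_ii : statement_i R to E s -> statement_ii R to E s.
Proof.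
move=> Hi [phi [cphi ephi]].
have [cE [S [Sr _]]] := isE.
have [K [tK [lam slam elam]]] := grid_to_join.
have [theta [ctheta etheta]] := join_map cE.
pose psi (x : realization R J) : realization R H := phi (theta x).
have cpsi : continuous psi by exact: continuous_comp_maps ctheta cphi.
have cJ : compact [set: realization R J].
  rewrite (_ : setT = [set x | supp x `<=` [set` fset_set [set: J]]]).
    exact: finite_support_compact.
  apply/seteqP; split=> // x _ v _; rewrite /= in_fset_set ?inE //.
  exact: finite_finset.
have [A psiA] : exists A : {fset H}, forall x, supp (psi x) `<=` [set` A].
  have [A hA] := compact_finite_support (continuous_compact (continuous_subspaceT cpsi) cJ).
  by exists A => x; apply: hA; exists x.
(* Small enough for every point to have a coordinate of at least [c]: with all of them smaller, the
   sum over [A] would be below 1. *)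
pose c : R := #|` A|.+1%:R^-1; have c0 : 0 < c by rewrite invr_gt0 ltr0n.
pose F (z : realization R J * realization R J) := \sum_w `|val z.1 w - val z.2 w|.
pose G (z : realization R J * realization R J) := \sum_(a <- A) `|val (psi z.1) a - val (psi z.2) a|.
have fstc : continuous (@fst (realization R J) (realization R J)) by move=> z; exact: cvg_fst.
have sndc : continuous (@snd (realization R J) (realization R J)) by move=> z; exact: cvg_snd.
have cF : continuous F.
  apply: continuous_sumr => w _ z.
  have a1 := continuous_comp_maps fstc (@coord_cont R J w).
  have a2 := continuous_comp_maps sndc (@coord_cont R J w).
  exact: (cvg_norm (cvgB (a1 z) (a2 z))).
have cG : continuous G.
  apply: continuous_sumr => a _ z.
  have a1 := continuous_comp_maps fstc (continuous_comp_maps cpsi (@coord_cont R H a)).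
  have a2 := continuous_comp_maps sndc (continuous_comp_maps cpsi (@coord_cont R H a)).
  exact: (cvg_norm (cvgB (a1 z) (a2 z))).
have [e e0 He] : exists2 e : R, 0 < e & forall z, ([set: realization R J] `*` [set: realization R J]) z -> F z < e -> G z < c.
  apply: compact_modulus; [exact: compact_setX|exact: continuous_subspaceT|exact: continuous_subspaceT|].
  move=> [x y] _ Fz; suff -> : G (x, y) = 0 by [].
  suff -> : x = y by rewrite /G big1 // => a _; rewrite subrr normr0.
  apply: realization_eq => w; apply/eqP; rewrite -subr_eq0 -normr_le0.
  by apply: le_trans Fz; rewrite /F (bigD1 w) //= lerDl sumr_ge0.
(* [B / M] bounds [F] on adjacent vertices: each vertex of the join collects at most [r + 1]
   coordinate changes, each bounded by [quotient_near] with [rho = r + 1]. *)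
pose B : R := #|{: 'I_r.+1 * gT}|%:R * (r.+1%:R * (1 + r.+1%:R)).
have B0 : 0 <= B by rewrite !mulr_ge0 // addr_ge0.
pose M := (Num.truncn (B / e)).+1; have M0 : (0 < M)%N by [].
have MB : B / M%:R < e.
  rewrite ltr_pdivrMr ?ltr0n // mulrC -ltr_pdivrMr //; exact: truncnS_gt.
pose X := grid K M.
have tX : triangulates R X E by exact: grid_triangulates.
have fX (n : X) g : gc_act X g n = n -> g = 1%g.
  exact: (@grid_vertex_free R gT K M M0 (triangulates_free tK (gcw_free S)) n g).
have /choice[vp vpE] (n : X) : exists x : realization R X, supp x = [set n].
  exact: vertex_point.
have vp_act g n : vp (gc_act X g n) = gs_act (realization_gspace R X) g (vp n).
  apply: (@supp1_eq _ _ _ _ (gc_act X g n)) => //.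
  by rewrite supp_act vpE image_set1.
pose y n := grid_down M0 (vp n).
have yE n v : val (y n) v = (val n v)%:R / grid_mass (vp n).
  rewrite /y grid_downE; congr (_ / _); rewrite /grid_point.
  have sub : supp (vp n) `<=` [set` [fset n]%fset].
    by rewrite vpE => _ ->; rewrite /= inE.
  by rewrite (fsum_support _ sub) big_seq_fset1 (vertex_point_val (vpE n)) mul1r.
have gpE n v : grid_point (vp n) v = (val n v)%:R.
  have m0 := grid_mass_gt0 M0 (vp n).
  have := yE n v; rewrite /y grid_downE => /(congr1 (fun a => a * grid_mass (vp n))).
  by rewrite !divfK // gt_eqF.
pose q n : realization R J := push slam (y n).
pose Psi n := psi (q n).
have Psi_act g n : Psi (gc_act X g n) = gs_act (realization_gspace R H) g (Psi n).
  rewrite /Psi /psi /q /y vp_act (grid_down_equivariant M0) (equivariant_push slam elam).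
  by rewrite etheta ephi.
have near (n n' : X) : near_above (val n) (val n') -> F (q n, q n') < e.
  move=> nn; have [sn' _ _] := set_valP n'.
  pose W := fset_set (nsupp (val n')).
  have fW : finite_set (nsupp (val n')) := simplex_finite sn'.
  have inW v : (v \in W) = (val n' v != 0%N).
    by rewrite in_fset_set //; apply/idP/idP => [/set_mem|h]; [|apply/mem_set].
  have cW : (#|` W| <= r.+1)%N.
    by apply: (simplex_card Sr tK sn') => v /=; rewrite inW.
  have W' v : val n' v != 0%N -> v \in W by rewrite inW.
  have Wn v : val n v != 0%N -> v \in W by rewrite inW; have := nn v; lia.
  have gsub (k : X) : (forall v, val k v != 0%N -> v \in W) ->
      [set v | grid_point (vp k) v != 0] `<=` [set` W].
    by move=> kW v /=; rewrite gpE pnatr_eq0; exact: kW.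
  have mE (k : X) : (forall v, val k v != 0%N -> v \in W) ->
      grid_mass (vp k) = \sum_(v <- W) (val k v)%:R.
    by move=> kW; rewrite (grid_massE (gsub k kW)); apply: eq_bigr => v _; rewrite gpE.
  have ysub (k : X) : (forall v, val k v != 0%N -> v \in W) -> supp (y k) `<=` [set` W].
    move=> kW v yv; apply: kW; have : val (y k) v != 0 by exact: yv.
    by rewrite yE mulf_eq0 pnatr_eq0 negb_or => /andP[].
  have dy v : v \in W -> `|val (y n) v - val (y n') v| <= (1 + r.+1%:R) / M%:R.
    move=> vW; rewrite !yE; have /andP[nn1 nn2] := nn v.
    apply: quotient_near.
    - by rewrite ltr0n.
    - exact: ler0n.
    - rewrite (mE n Wn) (bigD1_seq v) ?fset_uniq //= lerDl.
      by apply: sumr_ge0.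
    - by rewrite ler_nat.
    - by rewrite natr1 ler_nat.
    - exact: grid_mass_ge.
    - rewrite (mE n Wn) (mE n' W'); apply: ler_sum => u _.
      by rewrite ler_nat; have /andP[] := nn u.
    - rewrite (mE n Wn) (mE n' W'); apply: (@le_trans _ _ (\sum_(u <- W) ((val n u)%:R + 1))).
        by apply: ler_sum => u _; rewrite natr1 ler_nat; have /andP[] := nn u.
      by rewrite big_split /= lerD2l big_const_seq count_predT iter_addr_0 ler_nat.
  have dq w : `|val (q n) w - val (q n') w| <= r.+1%:R * ((1 + r.+1%:R) / M%:R).
    rewrite /q /= (fsum_support _ (ysub n Wn)) (fsum_support _ (ysub n' W')) -sumrB.
    apply: le_trans (ler_norm_sum _ _ _) _.
    apply: (@le_trans _ _ (\sum_(v <- W) (1 + r.+1%:R) / M%:R)).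
      rewrite big_seq [leRHS]big_seq; apply: ler_sum => v vW.
      rewrite -mulrBl normrM; apply: le_trans (dy v vW).
      by apply: ler_piMr => //; case: eqP => _; rewrite ?normr1 ?normr0.
    rewrite big_const_seq count_predT iter_addr_0 -[_ *+ _]mulr_natl.
    apply: ler_wpM2r; last by rewrite ler_nat.
    by rewrite divr_ge0 // addr_ge0.
  apply: le_lt_trans MB; rewrite /F /=.
  apply: (@le_trans _ _ (\sum_(w : 'I_r.+1 * gT) r.+1%:R * ((1 + r.+1%:R) / M%:R))).
    by apply: ler_sum => w _; exact: dq.
  by rewrite sumr_const -[_ *+ _]mulr_natl /B !mulrA.
have actE (x : realization R H) g (a : H) :
    val (gs_act (realization_gspace R H) g x) (gc_act H g a) = val x a.
  by rewrite [LHS](_ : _ = val x (gc_act H g^-1%g (gc_act H g a))) // gc_actK.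
have [Sg SgE SgP] : exists2 Sg : X -> H, (forall g n, Sg (gc_act X g n) = gc_act H g (Sg n)) &
    forall n, c <= val (Psi n) (Sg n).
  apply: (equivariant_choice (a := gc_act X) (b := gc_act H) (P := fun n a => c <= val (Psi n) a)).
  - by move=> g n; exact: fX.
  - by move=> g n a; rewrite Psi_act actE.
  move=> n; apply: contrapT => none.
  have := sum_coord (psiA (q n)) ; apply/eqP; rewrite lt_eqF //.
  apply: (@le_lt_trans _ _ (\sum_(a <- A) c)).
    apply: ler_sum => a _; rewrite leNgt; apply/negP => h; apply: none.
    by exists a; exact: ltW.
  rewrite big_const_seq count_predT iter_addr_0 -[_ *+ _]mulr_natl.
  by rewrite ltr_pdivrMr ?ltr0n // mul1r ltr_nat.
have comp (n n' : X) : F (q n, q n') < e -> (Sg n <= Sg n')%O \/ (Sg n' <= Sg n)%O.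
  (* [Sg n] has weight at least [c] at [Psi n], and weights change by less than [c]; so it also lies
     in the support of [Psi n'], which is a chain containing [Sg n']. *)
  move=> Fe; have Gc := He (q n, q n') (conj Logic.I Logic.I) Fe.
  have Sn : supp (Psi n) (Sg n).
    exact: (lt0r_neq0 (lt_le_trans c0 (SgP n))).
  have Sn' : supp (Psi n') (Sg n').
    exact: (lt0r_neq0 (lt_le_trans c0 (SgP n'))).
  have SnA : Sg n \in A by exact: psiA Sn.
  have d : `|val (Psi n) (Sg n) - val (Psi n') (Sg n)| < c.
    apply: le_lt_trans Gc; rewrite /G /= (bigD1_seq (Sg n)) ?fset_uniq //= lerDl.
    by apply: sumr_ge0.
  have Sn2 : supp (Psi n') (Sg n).
    suff h : 0 < val (Psi n') (Sg n) by exact: lt0r_neq0 h.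
    move: d (SgP n); rewrite ltr_norml => /andP[_].
    by move: (val (Psi n) (Sg n)) (val (Psi n') (Sg n)) => a b; lra.
  have [_ _ ch] := supp_simplex (Psi n').
  exact: ch.
have adjX (n n' : one_skeleton X) : adj n n' -> (Sg n <= Sg n')%O \/ (Sg n' <= Sg n)%O.
  move=> [->|[_ _ ch]]; first by left.
  have [h|h] := ch n n' (or_introl erefl) (or_intror erefl); first exact/comp/near.
  apply: comp; rewrite /F; under eq_bigr do rewrite distrC; exact: near.
have [+ _] := chi_geP (@tensor_over gT T to (one_skeleton X) (gc_act X)) s1.
move/(_ (Hi X tX)); apply.
(* Equivariance of [Sg] makes the set of allowed colours depend only on the class. *)
pose col (p : T * X) := val (Sg p.2) p.1.
have col_act g p : col (@diag_act gT T to (one_skeleton X) (gc_act X) g p) = col p.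
  by rewrite /col /diag_act /= SgE /= -ractM mulVg ract1.
have /choice[k kP] (C : @tensor_over gT T to (one_skeleton X) (gc_act X)) :
    exists a : 'I_s.-1, forall p, val C p -> col p a.
  have [p Cp] := tensor_rep C; have [ne _] := set_valP (Sg p.2).
  have [a ap] := ne p.1; exists a => p' Cp'.
  by have [g ->] := tensor_orbit Cp Cp'; rewrite col_act.
exists k => C D [p [p' [Cp Dp' pp1 pp2]]].
have kC := kP C p Cp; have kD := kP D p' Dp'.
have [/hom_leP le|/hom_leP le] := adjX _ _ pp2.
  have [_ mh] := set_valP (Sg p'.2); apply: (mh _ _ pp1) => //; exact: le.
have [_ mh] := set_valP (Sg p.2); apply: (mh _ _ pp1) => //; exact: le.
Qed.

End StatementItoII.

Theorem theorem10p1 (R : realType) (gT : finGroupType) (T : graph)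
    (to : graph_action gT T) (r s : nat) (E : gspace gT) :
  finite_set [set: T]%classic -> (1 <= s)%N -> is_E R r E ->
  [/\ triangulable R E ->
        statement_i R to E s -> statement_ii R to E s,
      statement_ii R to E s -> statement_iii R to E s,
      statement_iii R to E s -> statement_iv R T r s
    & vertex_critical T -> is_Aut to ->
        (statement_iv R T r s -> statement_i R to E s) /\
        (triangulable R E ->
           [<-> statement_i R to E s; statement_ii R to E s;
                statement_iii R to E s; statement_iv R T r s])].
Proof.
move=> fT s1 isE; split.
- by move=> tri; exact (statement_i_ii s1 isE tri).
- exact (statement_ii_iii s1).
- exact (statement_iii_iv isE).
move=> critical Aut; split; first exact (statement_iv_i fT s1 isE critical Aut).
move=> tri; tfae.
- exact (statement_i_ii s1 isE tri).
- exact (statement_ii_iii s1).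
- exact (statement_iii_iv isE).
- exact (statement_iv_i fT s1 isE critical Aut).
Qed.
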